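(* Let $H$ be a finite-dimensional Hopf algebra over a field $\Bbbk$, with normalized integrals $\lambda\in H^*$ (right) and $\Lambda\in H$ (left), $\lambda(\Lambda)=1$. For any positive integers $m,n$, the Kuperberg invariant of the framed 3-manifold $(\mathbb M_{m,n},\mathfrak f_{m,n})$ satisfies $$K(\mathbb M_{m,n},\mathfrak f_{m,n},H)=\mathrm{Tr}\big((S\otimes S)\circ\Psi^{m,n}\big)$$ $$=\lambda S\Big(S^{-2}(\Lambda^2_{(4)})S^{-1}(\Lambda^1_{(2)})\Lambda^2_{(2)}P^{(m)}(\Lambda^1_{(4)})\Big)\cdot\lambda S\Big(P^{(n-1)}(\Lambda^2_{(1)})\Lambda^1_{(3)}S^{-1}(\Lambda^2_{(3)})S^{-2}(\Lambda^1_{(1)})\Lambda^2_{(5)}\Big),$$ where $\Lambda^1,\Lambda^2$ denote two copies of $\Lambda$ and $\Psi^{m,n}:H^{\otimes2}\to H^{\otimes2}$ is the $\Bbbk$-linear operator $$\Psi^{m,n}(x\otimes y)=S^{-2}(y_{(4)})S^{-1}(x_{(2)})y_{(2)}P^{(m-1)}(x_{(4)})\otimes P^{(n-1)}(y_{(1)})x_{(3)}S^{-1}(y_{(3)})S^{-2}(x_{(1)})\qquad(x,y\in H).$$ Moreover, $K(\mathbb M_{m,n},\mathfrak f_{m,n},H)$ is a gauge invariant of $H$.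
   Context: **Gauge invariants.** $\mathrm{Rep}(H)$ is the tensor category of finite-dimensional $H$-modules over $\Bbbk$. A quantity $f(H)$ is a gauge invariant if $f(H)=f(H')$ whenever $\mathrm{Rep}(H)\simeq\mathrm{Rep}(H')$ as tensor categories (equivalently, whenever $H'\cong H_F$ is a Drinfeld twist of $H$ by a 2-cocycle $F$). **Hopf algebra conventions.** $H$ has comultiplication $\Delta$, counit $\varepsilon$, antipode $S$; $\Delta^{(0)}=\varepsilon(\cdot)1_H$, $\Delta^{(1)}=\mathrm{id}$, $\Delta^{(n+1)}=(\mathrm{id}\otimes\Delta^{(n)})\Delta$; Sweedler notation with summation suppressed. Right integral $\lambda\in H^*$: $\lambda(h_{(1)})h_{(2)}=\lambda(h)1$; left integral $\Lambda\in H$: $h\Lambda=\varepsilon(h)\Lambda$; $\lambda S=\lambda\circ S$. $P^{(n)}(x)=x_{(1)}\cdots x_{(n)}$ is the $n$-th Sweedler power, $P^{(0)}=\varepsilon(\cdot)1$. The distinguished grouplikes $\alpha\in H^*$, $g\in H$ are defined by $\Lambda h=\alpha(h)\Lambda$ and $h_{(1)}\lambda(h_{(2)})=\lambda(h)g$. For $n\in\mathbb Z$ put $\Lambda_{n-\frac12}=\alpha^{-n}\rightharpoonup S(\Lambda)$ and $\lambda_{n-\frac12}=g^n\rightharpoonup\lambda$, where $f\rightharpoonup h=h_{(1)}f(h_{(2)})$ and $(h\rightharpoonup f)(x)=f(xh)$; thus $\Lambda_{-\frac12}=S(\Lambda)$, $\Lambda_{\frac12}=\Lambda$, $\lambda_{-\frac12}=\lambda$,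 $\lambda_{\frac12}=\lambda\circ S^{-1}$. Let $T(x)=\alpha^{-1}(x_{(1)})S^{-2}(x_{(2)})\alpha(x_{(3)})$. **Framed Heegaard diagrams.** A framing $\mathfrak f$ of a closed oriented 3-manifold $M$ is an orthonormal triple of tangent vector fields up to homotopy. A Heegaard diagram $(\Sigma_g,\mu,\eta)$ of $M$ consists of a closed surface of genus $g$ with upper curves $\mu_1,\dots,\mu_g$ and lower curves $\eta_1,\dots,\eta_g$ (two families of disjoint non-separating simple closed curves), bounding meridian disks of the upper and the lower handlebody respectively. A combing of $\Sigma_g$ is a vector field $b_1$ with $2g$ singularities of index $-1$, one on each curve (the base point of the curve, where the two outward-pointing vectors are tangent to the curve), and one singularity of index $+2$ off all curves; it extends to a unit vector field on $M$. A second field $b_2\perp b_1$ is encoded by twist fronts: arcs in $\Sigma_g$ on which $b_2$ is normal to $\Sigma_g$ and points from the lower to the upper handlebody, transversely oriented in the direction in which $b_2$ rotates by the right-hand rule relative to $b_1$; seen from the upper handlebody, the transverse direction is counterclockwise near base points of upper curves and clockwise near base points of lower curves. Orient all curves. For a curve $c$ and a point $p$ on it, $\theta_c(p)$ is the total counterclockwise rotation of the tangent of $c$ relative to $b_1$ from the base point to $p$, in units $1=360^\circ$, and $\theta_c=\theta(c)$ is the total over the whole curve; $\phi_c(p)$ is the signed number of crossings with twist fronts from the base point to $p$ (sign $+$ if the transverse orientation agrees with the orientation of $c$), and $\phi_c$ is the total, the base point contributing half of its sign on return. The diagram is a framed Heegaard diagram if $\theta_{\mu_j}=-\phi_{\mu_j}$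 and $\theta_{\eta_i}=\phi_{\eta_i}$ for all $i,j$; then $b_2$ extends to $M$ and the diagram represents the framing $(b_1,b_2,b_1\times b_2)$ (its diagram framing). **Kuperberg invariant.** Take a framed Heegaard diagram of $(M,\mathfrak f)$ with $g\ge1$. For $p\in\eta_i\cap\mu_j$ put $s(p)=2(\theta_{\eta_i}(p)-\theta_{\mu_j}(p))+\frac12$ and $t(p)=\phi_{\eta_i}(p)-\phi_{\mu_j}(p)$. For each lower curve $\eta_i$ with $n_i$ intersection points, form $\Delta^{(n_i)}(\Lambda_{\theta(\eta_i)})$ and label the $x$-th intersection point $p$ on $\eta_i$ (counted from its base point) by $S^{s(p)}T^{t(p)}$ applied to the $x$-th tensor factor. For each upper curve $\mu_j$ let $W_j$ be the product in $H$ of the labels in the order in which they occur along $\mu_j$ from its base point. Then $K(M,\mathfrak f,H)=\prod_j\lambda_{-\theta(\mu_j)}(W_j)\in\Bbbk$ (summed over the Sweedler components). This does not depend on the choice of framed Heegaard diagram of $(M,\mathfrak f)$ (Kuperberg). **The framed manifolds $(\mathbb M_{m,n},\mathfrak f_{m,n})$.** For integers $p,q,r\ge2$ let $\mathbb P$ be $\mathbb S^2$, $\mathbb H^2$ or $\mathbb R^2$ according to whether $p^{-1}+q^{-1}+r^{-1}$ is $>1$, $<1$ or $=1$; let $\Theta(p,q,r)=\langle u,v,w\mid u^p=v^q=w^r=uvw=1\rangle$ be the orientation-preserving triangle group acting on $\mathbb P$, and $X(p,q,r)=\Theta(p,q,r)\backslash I^+(\mathbb P)$, where $I^+(\mathbb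 P)$ is the Lie group of orientation-preserving isometries of $\mathbb P$. Put $\mathbb M_{m,n}=X(2,m+1,n+1)$; its fundamental group is $\langle x,y,z\mid x^2=y^{m+1}=z^{n+1}=xyz\rangle\cong\langle a,b\mid a^m=bab,\ b^n=aba\rangle$. It has a genus $2$ framed Heegaard diagram with lower curves $\eta_1,\eta_2$, upper curves $\mu_1,\mu_2$ and the following data (which determine $K$); $\mathfrak f_{m,n}$ is its diagram framing. - Along $\eta_1$ the intersection points are, in order, $p_1,\dots,p_{m+3}$; along $\eta_2$ they are $q_1,\dots,q_{n+3}$. $\theta_{\eta_1}(p_1)=\theta_{\eta_2}(q_1)=\frac14$; $\theta=\frac12$ at all other points of $\eta_1,\eta_2$; $\theta_{\eta_i}=\phi_{\eta_i}=\frac12$. - Along $\mu_1$, in order: $p_1,\ p_{m+3},p_{m+2},\dots,p_5,\ q_{n+1},\ p_3,\ q_{n+3}$, with $\theta_{\mu_1}$ equal to $0$ at $p_1$, $-\frac34$ at $p_{m+3},\dots,p_5$ and $q_{n+1}$, $-\frac14$ at $p_3$, $\frac14$ at $q_{n+3}$. - Along $\mu_2$, in order: $q_1,\ p_2,\ q_{n+2},\ p_4,\ q_n,q_{n-1},\dots,q_2$, with $\theta_{\mu_2}$ equal to $0$ at $q_1$, $\frac14$ at $p_2$, $-\frac14$ at $q_{n+2}$, $-\frac34$ at $p_4$ and at $q_n,\dots,q_2$. - $\theta_{\mu_j}=-\frac12$, $\phi_{\mu_j}=\frac12$, and all $\phi_c(p)=0$ at intersection points. (For $m=1$ the list $p_{m+3},\dots,p_5$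 is empty; for $n=1$ the list $q_n,\dots,q_2$ is empty.) *)

(* Defs.v *)
From HB Require Import structures.
From mathcomp Require Import all_boot all_order all_algebra all_field.
From mathcomp Require Import zify.

Set Implicit Arguments.
Unset Strict Implicit.
Unset Printing Implicit Defensive.

Import Order.TTheory GRing.Theory Num.Theory VectorInternalTheory.
Local Open Scope ring_scope.

(* Tensor product of finite-dimensional spaces, in coordinates: with respect  *)
(* to the bases fixed by v2r, the (i, j) entry of a tensor is the coefficient *)
(* of tbase i *t tbase j.  The universal property is tliftE and tens_ext.     *)

Section TensorProduct.
Variable k : fieldType.
Implicit Types U V W : vectType k.

Definition tens V W : vectType k := 'M[k]_(dim V, dim W).

Definition ptens V W (v : V) (w : W) : tens V W := (v2r v)^T *m v2r w.

Definition tbase V (i : 'I_(dim V)) : V := r2v (delta_mx 0 i).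

Definition tsum V W U (f : V -> W -> U) (t : tens V W) : U :=
  \sum_i \sum_j t i j *: f (tbase i) (tbase j).

Fact tsum_is_linear V W U (f : V -> W -> U) : linear (tsum f).
Proof.
move=> a s t; rewrite /tsum scaler_sumr -big_split; apply: eq_bigr => i _ /=.
rewrite scaler_sumr -big_split; apply: eq_bigr => j _ /=.
by rewrite !mxE scalerDl scalerA.
Qed.

HB.instance Definition _ V W U (f : V -> W -> U) :=
  GRing.isLinear.Build k (tens V W) U _ (tsum f) (tsum_is_linear f).

(* The linear map induced by f; meaningful only for bilinear f. *)
Definition tlift V W U (f : V -> W -> U) : 'Hom(tens V W, U) :=
  linfun (tsum f).

Definition tmap V V' W W' (f : 'Hom(V, V')) (g : 'Hom(W, W')) :
    'Hom(tens V W, tens V' W') :=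
  tlift (fun v w => ptens (f v) (g w)).

Definition tassoc U V W : 'Hom(tens (tens U V) W, tens U (tens V W)) :=
  tlift (fun t w => tlift (fun u v => ptens u (ptens v w)) t).

Definition tunitl V : 'Hom(tens k^o V, V) := tlift (fun (a : k^o) v => a *: v).

Definition tunitr V : 'Hom(tens V k^o, V) := tlift (fun v (a : k^o) => a *: v).

Definition bilin V W U (f : V -> W -> U) : Prop :=
  (forall w, linear (fun v => f v w)) /\ (forall v, linear (f v)).

Lemma tbase_sum V (v : V) : v = \sum_i v2r v 0 i *: tbase i.
Proof.
rewrite -{1}[v]v2rK {1}[v2r v]row_sum_delta linear_sum.
by apply: eq_bigr => i _; rewrite linearZ.
Qed.

Lemma ptensE V W (v : V) (w : W) i j :
  ptens v w i j = v2r v 0 i * v2r w 0 j.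
Proof. by rewrite mxE big_ord1 mxE. Qed.

Lemma ptens_bilin V W : bilin (@ptens V W).
Proof.
split=> [w a u v|v a u w]; apply/matrixP=> i j; rewrite !mxE !big_ord1 !mxE.
  by rewrite linearP !mxE mulrDl mulrA.
by rewrite linearP !mxE mulrDr mulrCA.
Qed.

Lemma tliftE V W U (f : V -> W -> U) (v : V) (w : W) :
  bilin f -> tlift f (ptens v w) = f v w.
Proof.
case=> fl fr; rewrite lfunE /= /tsum.
pose fL w0 := GRing.isLinear.Build k V U _ (fun v0 => f v0 w0) (fl w0).
pose fLl w0 : {linear V -> U} := HB.pack (fun v0 => f v0 w0) (fL w0).
pose fR v0 := GRing.isLinear.Build k W U _ (f v0) (fr v0).
pose fRl v0 : {linear W -> U} := HB.pack (f v0) (fR v0).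
rewrite [in RHS](tbase_sum v) -[RHS]/(fLl w _) linear_sum.
apply: eq_bigr => i _; rewrite linearZ /= [in RHS](tbase_sum w).
rewrite -[f (tbase i) _]/(fRl (tbase i) _) linear_sum scaler_sumr.
by apply: eq_bigr => j _; rewrite linearZ /= ptensE scalerA.
Qed.

Lemma tens_ext V W U (f g : 'Hom(tens V W, U)) :
  (forall v w, f (ptens v w) = g (ptens v w)) -> f = g.
Proof.
move=> fg; apply/lfunP=> t.
have -> : t = \sum_i \sum_j t i j *: ptens (tbase i) (tbase j).
  rewrite [LHS]matrix_sum_delta; apply: eq_bigr => i _; apply: eq_bigr => j _.
  congr (_ *: _); apply/matrixP=> a b.
  by rewrite ptensE /tbase !r2vK !mxE eqxx /= -natrM mulnb.
rewrite !linear_sum; apply: eq_bigr => i _; rewrite !linear_sum.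
by apply: eq_bigr => j _; rewrite [LHS]linearZ [RHS]linearZ; apply/congr1/fg.
Qed.

Lemma tmapE V V' W W' (f : 'Hom(V, V')) (g : 'Hom(W, W')) v w :
  tmap f g (ptens v w) = ptens (f v) (g w).
Proof.
have [pl pr] := @ptens_bilin V' W'.
by rewrite tliftE //; split=> [w0 a u1 u2|v0 a u1 u2]; rewrite linearP ?pl ?pr.
Qed.

Definition tr_lfun V (f : 'End(V)) : k := \tr (f2mx f).

(* Integer powers of an endomorphism; f^-1 is the two-sided inverse whenever  *)
(* f is bijective.                                                            *)
Definition lfun_expz V (f : 'End(V)) (z : int) (x : V) : V :=
  match z with
  | Posz n => iter n f x
  | Negz n => iter n.+1 (f^-1)%VF x
  end.

End TensorProduct.

(* (a (x) b)(c (x) d) = ac (x) bd. *)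
Definition tmul (k : fieldType) (A : falgType k) (s t : tens A A) : tens A A :=
  tlift (fun a b => tlift (fun c d => ptens (a * c) (b * d)) t) s.

Record hopfAlgebra (k : fieldType) := HopfAlgebra {
  hopf_sort :> falgType k;
  cop : 'Hom(hopf_sort, tens hopf_sort hopf_sort);
  counit : 'Hom(hopf_sort, k^o);
  antipode : 'End(hopf_sort);
  copA : forall x,
    tassoc _ _ _ (tmap cop \1%VF (cop x)) = tmap \1%VF cop (cop x);
  cop_counitl : forall x, tunitl _ (tmap counit \1%VF (cop x)) = x;
  cop_counitr : forall x, tunitr _ (tmap \1%VF counit (cop x)) = x;
  cop1 : cop 1 = ptens 1 1;
  copM : forall x y, cop (x * y) = tmul (cop x) (cop y);
  counit1 : counit 1 = 1;
  counitM : forall x y, counit (x * y) = counit x * counit y;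
  antipodel : forall x,
    tlift (fun a b => antipode a * b) (cop x) = counit x *: 1;
  antipoder : forall x,
    tlift (fun a b => a * antipode b) (cop x) = counit x *: 1
}.

Section Sweedler.
Variables (k : fieldType) (H : hopfAlgebra k).

(* sweedler n x f is the sum of f [:: x_(1); ...; x_(n)] over the Sweedler    *)
(* components of x; meaningful only for f multilinear on lists of length n.   *)
Fixpoint sweedler (U : vectType k) (n : nat) (x : H) (f : seq H -> U) : U :=
  match n with
  | 0 => counit H x *: f [::]
  | 1 => f [:: x]
  | n'.+1 =>
      tlift (fun a b => sweedler n' b (fun s => f (a :: s))) (cop H x)
  end.

Definition leg (s : seq H) (i : nat) : H := s`_i.-1.

Definition spow (n : nat) (x : H) : H :=
  sweedler n x (fun s => \prod_(y <- s) y).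

Definition Sz (z : int) (x : H) : H := lfun_expz (antipode H) z x.

Definition conv (f h : H -> k) (x : H) : k :=
  tlift (fun a b => f a * h b : k^o) (cop H x).

(* Integer powers in H^* of a grouplike f, whose inverse is f \o S. *)
Definition conv_expz (f : H -> k) (z : int) : H -> k :=
  match z with
  | Posz n => iter n (conv f) (counit H)
  | Negz n => iter n.+1 (conv (f \o antipode H)) (counit H)
  end.

Definition hitl (f : H -> k) (h : H) : H :=
  tlift (fun a b => f b *: a) (cop H h).

Definition right_integral (lam : 'Hom(H, k^o)) : Prop :=
  forall h, tlift (fun a b => lam a *: b) (cop H h) = lam h *: 1.

Definition left_integral (Lam : H) : Prop :=
  forall h, h * Lam = counit H h *: Lam.

(* Normalized integrals and the distinguished grouplikes they determine. *)
Record integrals := Integrals {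
  lam : 'Hom(H, k^o);
  Lam : H;
  alpha : 'Hom(H, k^o);
  gl : H;
  lam_integral : right_integral lam;
  Lam_integral : left_integral Lam;
  lam_Lam : lam Lam = 1;
  alphaP : forall h, Lam * h = alpha h *: Lam;
  glP : forall h, tlift (fun a b => lam b *: a) (cop H h) = lam h *: gl
}.

Variable I : integrals.

(* Lam_half n and lam_half n are the integrals of index n - 1/2. *)
Definition Lam_half (n : int) : H :=
  hitl (conv_expz (alpha I) (- n)) (antipode H (Lam I)).

Definition lam_half (n : int) (x : H) : k := lam I (x * gl I ^ n).

Definition half_index (r : rat) : int := Num.floor (r + 1 / 2).

Definition Tlfun : 'End(H) := linfun (fun x =>
  sweedler 3 x (fun s =>
    (conv_expz (alpha I) (-1) (leg s 1) * alpha I (leg s 3))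
      *: Sz (-2) (leg s 2))).

Definition lamS (x : H) : k := lam I (antipode H x).

End Sweedler.

(* Combinatorial data of a framed Heegaard diagram.  The intersection point   *)
(* (i, x) is the x-th point of the i-th lower curve, x = 1, 2, ...  A mark    *)
(* (theta, phi) records the rotation and the twist-front count accumulated    *)
(* from the base point of the curve.                                          *)

Notation mark := (rat * int)%type.

Record diagram := Diagram {
  genus : nat;
  lower : 'I_genus -> seq mark;
  upper : 'I_genus -> seq (('I_genus * nat) * mark);
  lower_rot : 'I_genus -> rat;
  lower_tw : 'I_genus -> rat;
  upper_rot : 'I_genus -> rat;
  upper_tw : 'I_genus -> rat
}.

Section Diagram.
Variable D : diagram.

Definition lower_mark (p : 'I_(genus D) * nat) : mark :=
  nth (0, 0) (lower p.1) p.2.-1.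

Definition diagram_points : seq ('I_(genus D) * nat) :=
  [seq (i, x) | i <- enum 'I_(genus D), x <- iota 1 (size (lower i))].

Definition s_exp (v : ('I_(genus D) * nat) * mark) : rat :=
  2 * ((lower_mark v.1).1 - v.2.1) + 1 / 2.

Definition t_exp (v : ('I_(genus D) * nat) * mark) : int :=
  (lower_mark v.1).2 - v.2.2.

(* The framing conditions, together with the integrality that the exponents   *)
(* and half-integral indices of the Kuperberg invariant require.              *)
Record framed_diagram : Prop := FramedDiagram {
  genus_gt0 : (0 < genus D)%N;
  points_once :
    perm_eq (flatten [seq unzip1 (upper j) | j <- enum 'I_(genus D)])
            diagram_points;
  s_exp_int : forall j v, v \in upper j -> s_exp v \is a Num.int;
  lower_half : forall i : 'I_(genus D), lower_rot i + 1 / 2 \is a Num.int;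
  upper_half : forall j : 'I_(genus D), upper_rot j + 1 / 2 \is a Num.int;
  upper_framed : forall j : 'I_(genus D), upper_rot j = - upper_tw j;
  lower_framed : forall i : 'I_(genus D), lower_rot i = lower_tw i
}.

Variables (k : fieldType) (H : hopfAlgebra k) (I : integrals H).

(* Sum over the Sweedler components of Lam_{theta(eta_i)} for i in r, where   *)
(* L i is the list of components along eta_i.                                 *)
Fixpoint diagram_sum (r : seq 'I_(genus D)) (L : 'I_(genus D) -> seq H)
    (F : ('I_(genus D) -> seq H) -> k) : k :=
  if r is i :: r' then
    @sweedler k H k^o (size (lower i)) (Lam_half I (half_index (lower_rot i)))
      (fun s => diagram_sum r' (fun j => if j == i then s else L j) F)
  else F L.

Definition point_label (L : 'I_(genus D) -> seq H)
    (v : ('I_(genus D) * nat) * mark) : H :=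
  Sz (Num.floor (s_exp v))
    (lfun_expz (Tlfun I) (t_exp v) (leg (L v.1.1) v.1.2)).

Definition upper_word (L : 'I_(genus D) -> seq H) (j : 'I_(genus D)) : H :=
  \prod_(v <- upper j) point_label L v.

Definition kuperberg : k :=
  diagram_sum (enum 'I_(genus D)) (fun=> [::]) (fun L =>
    \prod_(j < genus D)
      lam_half I (half_index (- upper_rot j)) (upper_word L j)).

End Diagram.

(* The genus 2 framed Heegaard diagram of (M_{m,n}, f_{m,n}), where M_{m,n} is *)
(* the quotient X(2, m+1, n+1); the framed manifold enters only through it.   *)
(* Index 0 stands for eta_1, mu_1 and index 1 for eta_2, mu_2.                *)
Section DiagramMN.
Variables m n : nat.

Let p (x : nat) : 'I_2 * nat := (ord0, x).
Let q (x : nat) : 'I_2 * nat := (ord_max, x).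
Let at_ (v : 'I_2 * nat) (theta : rat) : ('I_2 * nat) * mark := (v, (theta, 0)).

Definition diagram_mn : diagram := {|
  genus := 2;
  lower := fun i =>
    (1 / 4, 0) :: nseq (if i == ord0 then m + 2 else n + 2)%N (1 / 2, 0);
  upper := fun j =>
    if j == ord0 then
      [:: at_ (p 1) 0]
      ++ [seq at_ (p x) (- (3 / 4)) | x <- rev (iota 5 (m - 1))]
      ++ [:: at_ (q (n + 1)) (- (3 / 4)); at_ (p 3) (- (1 / 4));
             at_ (q (n + 3)) (1 / 4)]
    else
      [:: at_ (q 1) 0; at_ (p 2) (1 / 4); at_ (q (n + 2)) (- (1 / 4));
          at_ (p 4) (- (3 / 4))]
      ++ [seq at_ (q x) (- (3 / 4)) | x <- rev (iota 2 (n - 1))];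
  lower_rot := fun=> 1 / 2;
  lower_tw := fun=> 1 / 2;
  upper_rot := fun=> - (1 / 2);
  upper_tw := fun=> 1 / 2
|}.

End DiagramMN.

Lemma diagram_mn_framed (m n : nat) :
  (0 < m)%N -> (0 < n)%N -> framed_diagram (diagram_mn m n).
Proof.
case: m n => [//|m] [//|n] _ _.
have E2 : enum 'I_2 = [:: ord0; ord_max].
  by apply: (inj_map val_inj); rewrite val_enum_ord.
split=> //=.
- rewrite /diagram_points /= E2 /= !cats0 !size_nseq /unzip1.
  rewrite !map_cat -!map_comp /comp.
  rewrite /= !subn1 !addn1 !addn2 !addn3 /=; apply/permP => a.
  have E : count (preim (pair ord_max) a) (iota 2 n ++ [:: n.+2; n.+3; n.+4])
           = count (preim (pair ord_max) a) (2 :: 3 :: 4 :: iota 5 n)%N.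
    rewrite -[[:: 2, 3, 4 & _]%N]/(iota 2 (3 + n)) addnC iotaD /=.
    by congr (count _ (_ ++ _)); rewrite /= !addSn !add0n.
  move: E; rewrite /= !(count_cat, count_map, count_rev) /=.
  rewrite !(count_cat, count_map, count_rev) /=.
  set c2 := count _ (iota 2 n); set c1 := count _ (iota 5 m).
  by set c5 := count _ (iota 5 n) => E; lia.
- have fl (r : rat) (z : int) : r = z%:~R -> r \is a Num.int.
    by move=> ->; apply: intr_int.
  have L (i : 'I_2) (x : nat) : (1 < x)%N ->
      (x <= if i == ord0 then m + 4 else n + 4)%N ->
      (lower_mark (D := diagram_mn m.+1 n.+1) (i, x)).1 = 1 / 2.
    case: x => [//|[//|x]] _ hx; rewrite /lower_mark /= nth_nseq.
    by case: eqP hx => _ hx; rewrite ifT //; lia.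
  move=> j v; case: ifP => _; rewrite !inE.
    rewrite mem_cat !inE.
    case/orP=> [/eqP->|/orP[/mapP[x]|/or3P[]/eqP->]];
      rewrite /s_exp; first exact: (fl _ 1).
    + by rewrite mem_rev mem_iota => hx ->; apply: (fl _ 3); rewrite L //=; lia.
    + by apply: (fl _ 3); rewrite L //=; lia.
    + by apply: (fl _ 2); rewrite L //=; lia.
    by apply: (fl _ 1); rewrite L //=; lia.
  case/or4P=> [/eqP->|/eqP->|/eqP->|/orP[/eqP->|/mapP[x]]]; rewrite /s_exp.
  + exact: (fl _ 1).
  + by apply: (fl _ 1); rewrite L //=; lia.
  + by apply: (fl _ 2); rewrite L //=; lia.
  + by apply: (fl _ 3); rewrite L //=; lia.
  by rewrite mem_rev mem_iota => hx ->; apply: (fl _ 3); rewrite L //=; lia.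
Qed.

Section Psi.
Variables (k : fieldType) (H : hopfAlgebra k).

Definition Psi (m n : nat) : 'End(tens H H) :=
  tlift (fun x y =>
    sweedler 4 x (fun a => sweedler 4 y (fun b =>
      ptens
        (Sz (-2) (leg b 4) * Sz (-1) (leg a 2) * leg b 2
           * spow (m - 1) (leg a 4))
        (spow (n - 1) (leg b 1) * leg a 3 * Sz (-1) (leg b 3)
           * Sz (-2) (leg a 1))))).

Definition integral_formula (I : integrals H) (m n : nat) : k :=
  @sweedler k H k^o 4 (Lam I) (fun a => @sweedler k H k^o 5 (Lam I) (fun b =>
    lamS I (Sz (-2) (leg b 4) * Sz (-1) (leg a 2) * leg b 2
              * spow m (leg a 4))
    * lamS I (spow (n - 1) (leg b 1) * leg a 3 * Sz (-1) (leg b 3)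
              * Sz (-2) (leg a 1) * leg b 5))).

End Psi.

(* The tensor category of finite-dimensional modules. *)

Section Modules.
Variables (k : fieldType) (H : hopfAlgebra k).

Record hmod := HMod {
  hmod_sort :> vectType k;
  hact : 'Hom(H, 'End(hmod_sort));
  hact1 : forall v, hact 1 v = v;
  hactM : forall x y v, hact (x * y) v = hact x (hact y v)
}.

Definition hlin (V W : hmod) (f : 'Hom(V, W)) : Prop :=
  forall x v, f (hact V x v) = hact W x (f v).

Definition hiso (V W : hmod) (f : 'Hom(V, W)) : Prop :=
  hlin f /\ exists g : 'Hom(W, V),
    [/\ hlin g, (g \o f)%VF = \1%VF & (f \o g)%VF = \1%VF].

Definition unit_fun (x : H) : 'End(k^o) := counit H x *: \1%VF.

Fact unit_fun_linear : linear unit_fun.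
Proof. by move=> a x y; rewrite /unit_fun linearP scalerDl scalerA. Qed.

HB.instance Definition _ :=
  GRing.isLinear.Build k H 'End(k^o) _ unit_fun unit_fun_linear.

Definition unit_act : 'Hom(H, 'End(k^o)) := linfun unit_fun.

Lemma unit_actE x (a : k^o) : unit_act x a = counit H x *: a.
Proof. by rewrite /unit_act lfunE /= scale_lfunE id_lfunE. Qed.

Fact unit_act1 (a : k^o) : unit_act 1 a = a.
Proof. by rewrite unit_actE counit1 scale1r. Qed.

Fact unit_actM x y (a : k^o) : unit_act (x * y) a = unit_act x (unit_act y a).
Proof. by rewrite !unit_actE counitM scalerA. Qed.

Definition hunit : hmod := HMod unit_act1 unit_actM.

Variables V W : hmod.

(* x acts on v (x) w as x_(1) v (x) x_(2) w. *)
Definition tens_act : 'Hom(H, 'End(tens V W)) :=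
  (tlift (fun a b => tmap (hact V a) (hact W b)) \o cop H)%VF.

Lemma tmap_act_bilin : bilin (fun a b => tmap (hact V a) (hact W b)).
Proof.
have [pl pr] := @ptens_bilin k V W.
split=> [b c x y|b c x y]; apply: tens_ext => v w;
  by rewrite add_lfunE scale_lfunE !tmapE linearP add_lfunE scale_lfunE ?pl ?pr.
Qed.

Let act2 : 'Hom(tens H H, 'End(tens V W)) :=
  tlift (fun a b => tmap (hact V a) (hact W b)).

Let act2E a b v w :
  act2 (ptens a b) (ptens v w) = ptens (hact V a v) (hact W b w).
Proof. by rewrite /act2 (tliftE _ _ tmap_act_bilin) tmapE. Qed.

Fact tens_act1 t : tens_act 1 t = t.
Proof.
have -> : tens_act 1 = \1%VF; last by rewrite id_lfunE.
apply: tens_ext => v w.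
by rewrite id_lfunE comp_lfunE cop1 act2E !hact1.
Qed.

Let tmul_bilin (a b : H) : bilin (fun c d : H => ptens (a * c) (b * d)).
Proof.
have [pl pr] := @ptens_bilin k H H.
by split=> [d c x y|d c x y]; rewrite mulrDr -scalerAr ?pl ?pr.
Qed.

Let tmul_bilin2 t :
  bilin (fun a b : H => tlift (fun c d : H => ptens (a * c) (b * d)) t).
Proof.
have [pl pr] := @ptens_bilin k H H.
split=> [b e x y|b e x y].
  pose f x := tlift (fun c d : H => ptens (x * c) (b * d)).
  rewrite -/(f (e *: x + y)) -/(f x) -/(f y) -scale_lfunE -add_lfunE.
  congr (fun_of_lfun _ t); apply: tens_ext => c d.
  rewrite add_lfunE scale_lfunE /f !(tliftE _ _ (tmul_bilin _ _)).
  by rewrite mulrDl -scalerAl pl.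
pose f x := tlift (fun c d : H => ptens (b * c) (x * d)).
rewrite -/(f (e *: x + y)) -/(f x) -/(f y) -scale_lfunE -add_lfunE.
congr (fun_of_lfun _ t); apply: tens_ext => c d.
rewrite add_lfunE scale_lfunE /f !(tliftE _ _ (tmul_bilin _ _)).
by rewrite mulrDl -scalerAl pr.
Qed.

Let act2M s t u : act2 (tmul s t) u = act2 s (act2 t u).
Proof.
pose ev (u : tens V W) (f : 'End(tens V W)) := f u.
have evl w : linear (ev w) by move=> c f g; rewrite /ev add_lfunE scale_lfunE.
pose evL w : {linear 'End(tens V W) -> tens V W} :=
  HB.pack (ev w) (GRing.isLinear.Build k _ _ _ (ev w) (evl w)).
have evE w f : linfun (evL w) f = f w by rewrite lfunE.
pose mulr2 : 'End(tens H H) :=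
  tlift (fun a b : H => tlift (fun c d : H => ptens (a * c) (b * d)) t).
suff /(congr1 (fun f => fun_of_lfun f s)) :
    (linfun (evL u) \o act2 \o mulr2 = linfun (evL (act2 t u)) \o act2)%VF.
  by rewrite !comp_lfunE !evE.
apply: tens_ext => a b; rewrite !comp_lfunE !evE /mulr2.
rewrite (tliftE _ _ (tmul_bilin2 _)).
pose mull2 : 'End(tens H H) := tlift (fun c d : H => ptens (a * c) (b * d)).
suff /(congr1 (fun f => fun_of_lfun f t)) :
    (linfun (evL u) \o act2 \o mull2
     = act2 (ptens a b) \o (linfun (evL u) \o act2))%VF.
  by rewrite !comp_lfunE !evE.
apply: tens_ext => c d; rewrite !comp_lfunE !evE /mull2.
rewrite (tliftE _ _ (tmul_bilin _ _)) -comp_lfunE.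
congr (fun_of_lfun _ u); apply: tens_ext => v w.
by rewrite comp_lfunE !act2E !hactM.
Qed.

Fact tens_actM x y t : tens_act (x * y) t = tens_act x (tens_act y t).
Proof. by rewrite !comp_lfunE copM act2M. Qed.

Definition htens : hmod := HMod tens_act1 tens_actM.

End Modules.

(* k-linear functors between module categories.  A functor acts on all linear *)
(* maps, but its values matter, and are constrained, only on H-linear ones.   *)
Record hfunctor (k : fieldType) (H H' : hopfAlgebra k) := HFunctor {
  fob :> hmod H -> hmod H';
  fmor : forall V W : hmod H, 'Hom(V, W) -> 'Hom(fob V, fob W);
  fmor_hlin : forall (V W : hmod H) (f : 'Hom(V, W)), hlin f -> hlin (fmor f);
  fmor_id : forall V : hmod H, fmor \1%VF = \1%VF :> 'End(fob V);
  fmor_comp : forall (U V W : hmod H) (f : 'Hom(V, W)) (g : 'Hom(U, V)),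
    hlin f -> hlin g -> fmor (f \o g)%VF = (fmor f \o fmor g)%VF;
  fmor_linear : forall (V W : hmod H) (a : k) (f g : 'Hom(V, W)),
    hlin f -> hlin g -> fmor (a *: f + g) = a *: fmor f + fmor g
}.

Section TensorEquivalence.
Variables (k : fieldType) (H H' : hopfAlgebra k).

Definition is_equivalence (F : hfunctor H H') : Prop :=
  exists (G : hfunctor H' H)
         (eta : forall V : hmod H, 'Hom(V, G (F V)))
         (eps : forall V : hmod H', 'Hom(F (G V), V)),
  [/\ forall V, hiso (eta V),
      forall (V W : hmod H) (f : 'Hom(V, W)), hlin f ->
        (fmor G (fmor F f) \o eta V)%VF = (eta W \o f)%VF,
      forall V, hiso (eps V)
    & forall (V W : hmod H') (f : 'Hom(V, W)), hlin f ->
        (f \o eps V)%VF = (eps W \o fmor F (fmor G f))%VF].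

Record monoidal_structure (F : hfunctor H H') := MonoidalStructure {
  mJ : forall V W : hmod H, 'Hom(htens (F V) (F W), F (htens V W));
  mphi : 'Hom(hunit H', F (hunit H));
  mJ_iso : forall V W, hiso (mJ V W);
  mphi_iso : hiso mphi;
  mJ_natural : forall (V V' W W' : hmod H) (f : 'Hom(V, V')) (g : 'Hom(W, W')),
    hlin f -> hlin g ->
    (mJ V' W' \o tmap (fmor F f) (fmor F g))%VF
    = (@fmor _ _ _ F (htens V W) (htens V' W') (tmap f g) \o mJ V W)%VF;
  mJ_assoc : forall U V W : hmod H,
    (@fmor _ _ _ F (htens (htens U V) W) (htens U (htens V W)) (tassoc U V W)
       \o (mJ (htens U V) W \o tmap (mJ U V) \1))%VF
    = (mJ U (htens V W) \o (tmap \1 (mJ V W) \o tassoc (F U) (F V) (F W)))%VF;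
  mphi_l : forall V : hmod H,
    (@fmor _ _ _ F (htens (hunit H) V) V (tunitl V)
       \o (mJ (hunit H) V \o tmap mphi \1))%VF
    = tunitl (F V);
  mphi_r : forall V : hmod H,
    (@fmor _ _ _ F (htens V (hunit H)) V (tunitr V)
       \o (mJ V (hunit H) \o tmap \1 mphi))%VF
    = tunitr (F V)
}.

(* Rep(H) and Rep(H') are equivalent as tensor categories over k. *)
Definition tensor_equivalent : Prop :=
  exists F : hfunctor H H',
    is_equivalence F /\ inhabited (monoidal_structure F).

End TensorEquivalence.

Definition gauge_invariant (k : fieldType)
    (f : forall H : hopfAlgebra k, integrals H -> k) : Prop :=
  forall (H H' : hopfAlgebra k) (I : integrals H) (I' : integrals H'),
    tensor_equivalent H H' -> f H I = f H' I'.

(* Main.v *)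
From HB Require Import structures.
From Stdlib Require Import Classical_Prop.
Require Import Defs.
From mathcomp Require Import all_boot all_order all_algebra all_field.
From mathcomp Require Import zify.

Set Implicit Arguments.
Unset Strict Implicit.
Unset Printing Implicit Defensive.

Import GRing.Theory VectorInternalTheory.
Local Open Scope ring_scope.

(* Rotating the two integrals with the Frobenius identities turns the diagram   *)
(* sum into the integral formula, and Tr f = lam (S (Lam_2) f (Lam_1)) turns    *)
(* that formula into the trace of an operator Phi on H (x) H which is written   *)
(* in terms of Delta, S, S^-1 and Sweedler powers only.                         *)
(*   Phi makes sense in any Hopf cogroupoid: for a 2-cocycle twist from X to Y, *)
(* the spaces H(X, X), H(X, Y), H(Y, X), H(Y, Y) share the carrier H, and Phi   *)
(* satisfies theta_X (c d) = theta_Y (S^-2 d . c), where theta_X (c) is the     *)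
(* trace of Phi_X followed by right multiplication by c on the first factor,    *)
(* c is in H(X, Y) and d in H(Y, X).  Applied to c (x) d = x_1 (x) S x_2 with   *)
(* x = 1 in H(X, Y), this gives Tr Phi_X = Tr Phi_Y.                            *)
(*   A tensor equivalence F is turned into a twist through Q = F(H).  Since     *)
(* H (x) V is free of rank dim V, F preserves dimensions; hence Hom(Q, W) has   *)
(* dimension dim W for every W, which forces Q to be the regular module of H'.  *)
(* The coproduct F(Delta) of Q, read on a generator, is the twist.              *)

(** * Linear maps and tensor contractions *)

(** Write L for the left integral, S for the antipode and (x) for tensor products. The invariant,
    the integral formula and the operator trace are each reduced to the scalar [kupE], in which both
    copies of L are comultiplied into five factors. On the diagram side every exponent of T
    vanishes, the lower integrals are L itself ([Lamh1E]) and the upper ones are lam composed with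
    S^-1 ([lamh1E]). Rotating the first component of each coproduct of L into last place by
    [Lam_rotate] yields [kuperberg_kupE]. Cutting the last factor off a Sweedler power yields
    [integral_formulaE]. The dual bases of [Frobenius] give the trace formula [tr_Lam], which yields
    [kup_kupE].

    Gauge invariance is then a statement about the trace of [kup]. This operator uses only products,
    coproducts, S and S^-1, so it makes sense over a cogroupoid, in particular for the coproducts
    s_X Delta(-) t_Y defined by a family of twists. The coproduct of a product of elements of H(X,
    Y) and H(Y, X) can be computed through Y. Doing so in the first input ([kup_mulr]) and in the
    second ([kup1_mull]), and carrying factors round the trace, turns the operator at X into the
    operator at Y. The outcome is [kup_cyclic], a cyclicity up to S^-2; evaluated on the coproduct
    of the unit of H(X, Y), it gives equal traces at X and Y ([kup_trace_inv]).

    Finally, a tensor equivalence F must be shown to come from a twist. F preserves dimensions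
    ([dim_equiv]), so Q = F(H) has the same Hom dimensions as the regular module of H', and a
    cancellation argument in the style of Krull and Schmidt ([regular_like_iso]) makes Q free of
    rank one. On a generator q0, the images of right multiplications define an algebra isomorphism
    from H to H', and the image of the coproduct is t (q0 (x) q0) for an invertible cocycle t
    ([gen_is_twist], [gen_twist_conj]). The two-object cogroupoid of t joins H' to H in
    [kup_trace_gauge]. *)

Definition lin (k : fieldType) (U V : vectType k) (f : U -> V) : Prop :=
  forall (a : k) x y, f (a *: x + y) = a *: f x + f y.

Definition trilin (k : fieldType) (U V W X : vectType k) (f : U -> V -> W -> X) : Prop :=
  [/\ forall v w, lin (fun u => f u v w), forall u w, lin (fun v => f u v w)
    & forall u v, lin (f u v)].

(* The contraction of a tensor by a bilinear map: \sw a b <- t; f a b is the  *)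
(* sum of f t' t'' over the components t' (x) t'' of t.                       *)
Definition tcon (k : fieldType) (V W U : vectType k) (t : tens V W)
  (f : V -> W -> U) : U := tlift f t.

Notation "'\sw' a b '<-' t ';' e" := (tcon t (fun a b => e))
  (at level 200, a name, b name, t at level 100, e at level 200,
   format "'[v' '\sw'  a  b  '<-'  t ';' '/' e ']'").

Definition tcon3 (k : fieldType) (V U : vectType k) (d : 'Hom(V, tens V V)) (x : V)
    (f : V -> V -> V -> U) : U :=
  \sw a y <- d x; \sw b c <- d y; f a b c.

Notation "'\sw3' a b c '<-' d , x ';' e" := (tcon3 d x (fun a b c => e))
  (at level 200, a name, b name, c name, d at level 100, x at level 100, e at level 200,
   format "'[v' '\sw3'  a  b  c  '<-'  d ,  x ';' '/' e ']'").

Section Linearity.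
Variable k : fieldType.
Implicit Types U V W : vectType k.

Lemma linfE U V (f : U -> V) : lin f -> forall x, linfun f x = f x.
Proof.
move=> fl x; pose fL := GRing.isLinear.Build k U V _ f fl.
pose g : {linear U -> V} := HB.pack f fL.
by rewrite -[f]/(g : U -> V) lfunE.
Qed.

Lemma lin_sum U V (f : U -> V) : lin f -> forall (I : Type) (r : seq I) F,
  f (\sum_(i <- r) F i) = \sum_(i <- r) f (F i).
Proof.
move=> fl I r F; rewrite -(linfE fl) linear_sum; apply: eq_bigr => i _.
exact: linfE.
Qed.

Lemma linZ U V (f : U -> V) : lin f -> forall a x, f (a *: x) = a *: f x.
Proof. by move=> fl a x; rewrite -!(linfE fl) linearZ. Qed.

Lemma falg_scaler (A : falgType k) (a : k) (x y : A) : x * (a *: y) = a *: (x * y).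
Proof. exact: esym (scalerAr a x y). Qed.

Lemma falg_scalel (A : falgType k) (a : k) (x y : A) : (a *: x) * y = a *: (x * y).
Proof. exact: esym (scalerAl a x y). Qed.

Lemma lfunZ U V (f : 'Hom(U, V)) (a : k) v : f (a *: v) = a *: f v.
Proof. exact: (linZ (fun b x y => linearP f b x y)). Qed.

Lemma functZ V (f : 'Hom(V, k^o)) (a : k) v : f (a *: v) = a * (f v : k) :> k.
Proof. exact: (@linZ V k^o f (fun b x y => linearP f b x y)). Qed.

Lemma lin_id U : lin (fun x : U => x).
Proof. by []. Qed.

Lemma lin_lfun U V W (g : 'Hom(V, W)) (f : U -> V) : lin f -> lin (fun x => g (f x)).
Proof. by move=> fl a x y; rewrite fl linearP. Qed.

Lemma lin_flip U V W (v : V) (f : U -> 'Hom(V, W)) : lin f -> lin (fun x => f x v).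
Proof. by move=> fl a x y; rewrite fl add_lfunE scale_lfunE. Qed.

Lemma lin_mulr (A : falgType k) U (c : A) (f : U -> A) :
  lin f -> lin (fun x => c * f x).
Proof. by move=> fl a x y; rewrite fl mulrDr scalerAr. Qed.

Lemma lin_mull (A : falgType k) U (c : A) (f : U -> A) :
  lin f -> lin (fun x => f x * c).
Proof. by move=> fl a x y; rewrite fl mulrDl scalerAl. Qed.

Lemma lin_mulkr U (c : k) (f : U -> k^o) : lin f -> lin (fun x => c * f x : k^o).
Proof. by move=> fl a x y; rewrite fl mulrDr /= [_ *: _]/(_ * _) mulrCA. Qed.

Lemma lin_mulkl U (c : k) (f : U -> k^o) : lin f -> lin (fun x => f x * c : k^o).
Proof. by move=> fl a x y; rewrite fl mulrDl /= [a *: f x]/(_ * _) -mulrA. Qed.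

Lemma lin_scaler U V (c : k) (f : U -> V) : lin f -> lin (fun x => c *: f x).
Proof. by move=> fl a x y; rewrite fl scalerDr !scalerA mulrC. Qed.

Lemma lin_scalel U V (c : V) (f : U -> k^o) : lin f -> lin (fun x => (f x : k) *: c).
Proof. by move=> fl a x y; rewrite fl scalerDl -scalerA. Qed.

Lemma lin_add U V (f g : U -> V) : lin f -> lin g -> lin (fun x => f x + g x).
Proof. by move=> fl gl a x y; rewrite fl gl scalerDr addrACA. Qed.

Lemma lin_opp U V (f : U -> V) : lin f -> lin (fun x => - f x).
Proof. by move=> fl a x y; rewrite fl opprD scalerN. Qed.

Lemma lin_ptensl U V W (c : W) (f : U -> V) : lin f -> lin (fun x => ptens (f x) c).
Proof. by move=> fl a x y; rewrite fl (proj1 (ptens_bilin V W)). Qed.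

Lemma lin_ptensr U V W (c : V) (f : U -> W) : lin f -> lin (fun x => ptens c (f x)).
Proof. by move=> fl a x y; rewrite fl (proj2 (ptens_bilin V W)). Qed.

Lemma lin_tconl V W U (X : vectType k) (f : V -> W -> U) (t : X -> tens V W) :
  lin t -> lin (fun x => tcon (t x) f).
Proof. by move=> tl a x y; rewrite tl /tcon linearP. Qed.

Lemma tconS V W U (t : tens V W) (f : V -> W -> U) :
  tcon t f = \sum_i \sum_j t i j *: f (tbase i) (tbase j).
Proof. by rewrite /tcon /tlift lfunE. Qed.

Lemma lin_tconr V W U (X : vectType k) (f : X -> V -> W -> U) (t : tens V W) :
  (forall v w, lin (fun x => f x v w)) -> lin (fun x => tcon t (f x)).
Proof.
move=> fl a x y; rewrite !tconS scaler_sumr -big_split; apply: eq_bigr => i _ /=.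
rewrite scaler_sumr -big_split; apply: eq_bigr => j _ /=.
by rewrite fl scalerDr !scalerA mulrC.
Qed.

Lemma lin_tcon3l V U (X : vectType k) d (f : V -> V -> V -> U) (t : X -> V) :
  lin t -> lin (fun x => tcon3 d (t x) f).
Proof. by move=> tl; apply: lin_tconl; apply: lin_lfun. Qed.

Lemma lin_tcon3r V U (X : vectType k) d (f : X -> V -> V -> V -> U) (t : V) :
  (forall a b c, lin (fun x => f x a b c)) -> lin (fun x => tcon3 d t (f x)).
Proof. by move=> fl; apply: lin_tconr => ? ?; apply: lin_tconr => ? ?. Qed.

Lemma trilin1 U V W (X : vectType k) (f : U -> V -> W -> X) v w : trilin f -> lin (fun u => f u v w).
Proof. by case. Qed.

Lemma trilin2 U V W (X : vectType k) (f : U -> V -> W -> X) u w : trilin f -> lin (fun v => f u v w).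
Proof. by case. Qed.

Lemma trilin3 U V W (X : vectType k) (f : U -> V -> W -> X) u v : trilin f -> lin (f u v).
Proof. by case. Qed.

Lemma lin_sumr U V (I : finType) (f : I -> U -> V) :
  (forall i, lin (f i)) -> lin (fun x => \sum_i f i x).
Proof.
move=> fl a x y; rewrite scaler_sumr -big_split; apply: eq_bigr => i _.
exact: fl.
Qed.

Lemma lin_comp U V W (g : V -> W) (f : U -> V) : lin g -> lin f -> lin (fun x => g (f x)).
Proof. by move=> gl fl a x y; rewrite fl gl. Qed.

Lemma lin_complf U V W (X : vectType k) (g : 'Hom(V, W)) (f : X -> 'Hom(U, V)) :
  lin f -> lin (fun x => (g \o f x)%VF).
Proof. by move=> fl a x y; rewrite fl comp_lfunDr comp_lfunZr. Qed.

Lemma lin_compfl U V W (X : vectType k) (g : 'Hom(U, V)) (f : X -> 'Hom(V, W)) :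
  lin f -> lin (fun x => (f x \o g)%VF).
Proof. by move=> fl a x y; rewrite fl comp_lfunDl comp_lfunZl. Qed.

Lemma bilinI U V W (f : U -> V -> W) :
  (forall v, lin (fun u => f u v)) -> (forall u, lin (f u)) -> bilin f.
Proof. by split. Qed.

End Linearity.

(** Succeeds when the bound variable is absent from the body, which tells which factor of a product
    carries the variable. *)
Ltac is_cst f :=
  lazymatch f with (fun x => ?c) => let d := constr:(c) in idtac end.

Ltac lin_hyp :=
  match goal with
  | H : lin _ |- _ => first [ exact: H | apply: (lin_comp H) ]
  | H : bilin _ |- _ =>
    first [ exact: (proj1 H _) | exact: (proj2 H _)
          | apply: (lin_comp (proj1 H _)) | apply: (lin_comp (proj2 H _)) ]
  | H : trilin _ |- _ =>
    first [ apply: (lin_comp (trilin1 _ _ H)) | apply: (lin_comp (trilin2 _ _ H))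
          | apply: (lin_comp (trilin3 _ _ H)) ]
  | H : forall x, lin (@?f x) |- _ => first [ exact: H | apply: (lin_comp (H _)) ]
  | H : forall x, bilin (@?f x) |- _ =>
    first [ apply: (lin_comp (proj1 (H _) _)) | apply: (lin_comp (proj2 (H _) _)) ]
  | H : forall x y, lin (@?f x y) |- _ => first [ exact: H | apply: (lin_comp (H _ _)) ]
  | H : forall x y, bilin (@?f x y) |- _ =>
    first [ apply: (lin_comp (proj1 (H _ _) _)) | apply: (lin_comp (proj2 (H _ _) _)) ]
  | H : forall x y z, lin (@?f x y z) |- _ => first [ exact: H | apply: (lin_comp (H _ _ _)) ]
  | H : forall x y z, bilin (@?f x y z) |- _ =>
    first [ apply: (lin_comp (proj1 (H _ _ _) _)) | apply: (lin_comp (proj2 (H _ _ _) _)) ]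
  | H : forall x y z t, lin (@?f x y z t) |- _ =>
    first [ exact: H | apply: (lin_comp (H _ _ _ _)) ]
  | H : forall x y z t, bilin (@?f x y z t) |- _ =>
    first [ apply: (lin_comp (proj1 (H _ _ _ _) _))
          | apply: (lin_comp (proj2 (H _ _ _ _) _)) ]
  end.

(** A Sweedler expression is linear in a variable because the variable occurs once. The tactic
    follows that occurrence through the head symbols and uses hypotheses of linearity for unknown
    functions. *)
Ltac lin_step :=
  lazymatch goal with
  | |- bilin _ => apply: bilinI => ?
  | |- trilin _ => split=> ? ?
  | |- forall _, _ => intro
  | |- lin _ => cbv beta;
    lazymatch goal with
    | |- lin (fun x => x) => exact: lin_id
    | |- lin (fun_of_lfun _) => exact: (lin_lfun _ (@lin_id _ _))
    | |- lin (ptens _) => exact: (lin_ptensr _ (@lin_id _ _))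
    | |- lin ( *%R _) => exact: (lin_mulr _ (@lin_id _ _))
    | |- lin ( *:%R _) => exact: (lin_scaler _ (@lin_id _ _))
    | |- lin (fun x => tcon (@?t x) (@?f x)) =>
      first [ is_cst f; apply: lin_tconl | apply: lin_tconr => ? ? ]
    | |- lin (fun x => tcon3 (@?d x) (@?t x) (@?f x)) =>
      first [ is_cst f; apply: lin_tcon3l | apply: lin_tcon3r => ? ? ? ]
    | |- lin (fun x => @?f x * @?g x) =>
      first [ is_cst f; first [ apply: lin_mulr | apply: lin_mulkr ]
            | first [ apply: lin_mull | apply: lin_mulkl ] ]
    | |- lin (fun x => @?f x *: @?g x) =>
      first [ is_cst f; apply: lin_scaler | apply: lin_scalel ]
    | |- lin (fun x => @?f x + @?g x) => apply: lin_add
    | |- lin (fun x => - @?f x) => apply: lin_opp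
    | |- lin (fun x => ptens (@?f x) (@?g x)) =>
      first [ is_cst f; apply: lin_ptensr | apply: lin_ptensl ]
    | |- lin (fun x => comp_lfun (@?f x) (@?g x)) =>
      first [ is_cst f; apply: lin_complf | apply: lin_compfl ]
    | |- lin (fun x => fun_of_lfun (@?f x) (@?g x)) =>
      first [ is_cst f; apply: lin_lfun | apply: lin_flip ]
    | |- _ => lin_hyp
    end
  end.
Ltac lin := repeat lin_step.

Section Contraction.
Variable k : fieldType.
Implicit Types U V W : vectType k.

Lemma tcon_ext V W U (t : tens V W) (f g : V -> W -> U) :
  (forall v w, f v w = g v w) -> tcon t f = tcon t g.
Proof.
by move=> fg; rewrite !tconS; do 2!apply: eq_bigr => ? _; rewrite fg.
Qed.

Lemma tcon_ptens V W U (v : V) (w : W) (f : V -> W -> U) :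
  bilin f -> tcon (ptens v w) f = f v w.
Proof. exact: tliftE. Qed.

Lemma tcon_lin V W U U' (g : U -> U') (t : tens V W) (f : V -> W -> U) :
  lin g -> g (tcon t f) = \sw a b <- t; g (f a b).
Proof.
move=> gl; rewrite !tconS (lin_sum gl); apply: eq_bigr => i _.
by rewrite (lin_sum gl); apply: eq_bigr => j _; rewrite (linZ gl).
Qed.

Lemma tcon_lfun V W U U' (g : 'Hom(U, U')) (t : tens V W) (f : V -> W -> U) :
  g (tcon t f) = \sw a b <- t; g (f a b).
Proof. by apply: tcon_lin; lin. Qed.

(** Contractions are finite sums, hence commute: Sweedler components of independent elements may be
    listed in any order. *)
Lemma tcon_exch V W V' W' U (t : tens V W) (s : tens V' W') (f : V -> W -> V' -> W' -> U) :
  (\sw a b <- t; \sw c d <- s; f a b c d) = (\sw c d <- s; \sw a b <- t; f a b c d).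
Proof.
rewrite tconS.
transitivity (\sum_i \sum_j \sw c d <- s; t i j *: f (tbase i) (tbase j) c d).
  by do 2!apply: eq_bigr => ? _; apply: (tcon_lin (g := fun x => _ *: x)); lin.
rewrite [RHS]tconS.
under eq_bigr => i _ do under eq_bigr => j _ do rewrite tconS.
under [RHS]eq_bigr => i _ do under eq_bigr => j _ do rewrite tconS scaler_sumr.
transitivity (\sum_i \sum_j \sum_p \sum_q (s p q * t i j) *: f (tbase i) (tbase j) (tbase p) (tbase q)).
  by do 4!apply: eq_bigr => ? _; rewrite scalerA.
transitivity (\sum_i \sum_p \sum_q \sum_j (s p q * t i j) *: f (tbase i) (tbase j) (tbase p) (tbase q)).
  by apply: eq_bigr => i _; rewrite exchange_big; apply: eq_bigr => p _; rewrite exchange_big.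
rewrite exchange_big; apply: eq_bigr => p _; rewrite exchange_big; apply: eq_bigr => q _.
apply: eq_bigr => i _; rewrite scaler_sumr; apply: eq_bigr => j _.
by rewrite scalerA.
Qed.

Lemma tcon3_ext V U d (x : V) (f g : V -> V -> V -> U) :
  (forall a b c, f a b c = g a b c) -> tcon3 d x f = tcon3 d x g.
Proof. by move=> fg; do 2!apply: tcon_ext => ? ?. Qed.

Lemma tcon3_lin V U U' (g : U -> U') d (x : V) (f : V -> V -> V -> U) :
  lin g -> g (tcon3 d x f) = \sw3 a b c <- d, x; g (f a b c).
Proof.
by move=> gl; rewrite /tcon3 (tcon_lin _ _ gl); apply: tcon_ext => a b; apply: tcon_lin.
Qed.

Lemma tcon3_tcon V W V' U (t : tens V W) d (x : V') (f : V' -> V' -> V' -> V -> W -> U) :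
  (\sw3 a b c <- d, x; \sw p q <- t; f a b c p q)
  = (\sw p q <- t; \sw3 a b c <- d, x; f a b c p q).
Proof.
rewrite /tcon3 [RHS]tcon_exch; apply: tcon_ext => a y.
by rewrite [RHS]tcon_exch.
Qed.

Lemma tcon3_exch V V' U d (x : V) d' (x' : V') (f : V -> V -> V -> V' -> V' -> V' -> U) :
  (\sw3 a b c <- d, x; \sw3 p q r <- d', x'; f a b c p q r)
  = (\sw3 p q r <- d', x'; \sw3 a b c <- d, x; f a b c p q r).
Proof.
rewrite {2}/tcon3 tcon3_tcon; apply: tcon_ext => p y.
exact: (tcon3_tcon (d' y) d x (fun a b c => f a b c p)).
Qed.

Lemma tcon_id V W (t : tens V W) : (\sw a b <- t; ptens a b) = t.
Proof.
rewrite -[RHS](id_lfunE t) /tcon; congr (fun_of_lfun _ t).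
by apply: tens_ext => v w; rewrite id_lfunE tliftE //; apply: ptens_bilin.
Qed.

Lemma tcon_tcon V W V' W' U (t : tens V W) (f : V -> W -> tens V' W') (g : V' -> W' -> U) :
  tcon (tcon t f) g = \sw a b <- t; tcon (f a b) g.
Proof. by apply: (tcon_lin (g := fun s => tcon s g)); lin. Qed.

(** Taking [ptens] as the bilinear test map recovers the tensor. Equations between tensors thus
    become Sweedler computations. *)
Lemma tcon_inj V W (t s : tens V W) :
  (forall U (f : V -> W -> U), bilin f -> tcon t f = tcon s f) -> t = s.
Proof.
move=> ts; rewrite -(tcon_id t) -(tcon_id s); apply: ts; lin.
Qed.

Lemma tmap_tcon V W V' W' (f : 'Hom(V, V')) (g : 'Hom(W, W')) t :
  tmap f g t = \sw a b <- t; ptens (f a) (g b).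
Proof. by []. Qed.

Lemma tcon_tmap V W V' W' U (f : 'Hom(V, V')) (g : 'Hom(W, W')) t
    (h : V' -> W' -> U) : bilin h ->
  tcon (tmap f g t) h = \sw a b <- t; h (f a) (g b).
Proof.
by move=> hb; rewrite tmap_tcon tcon_tcon; apply: tcon_ext => v w; rewrite tcon_ptens.
Qed.

Lemma tassoc_ptens U V W (u : U) (v : V) (w : W) :
  tassoc U V W (ptens (ptens u v) w) = ptens u (ptens v w).
Proof.
rewrite /tassoc tliftE; last first.
  by apply: bilinI => ?; [apply: lin_lfun | apply: lin_tconr]; lin.
by rewrite tliftE //; lin.
Qed.

Lemma f2mxE V W (f : 'Hom(V, W)) i : row i (f2mx f) = v2r (f (tbase i)).
Proof. by rewrite unlock /= /tbase !r2vK -rowE. Qed.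

Lemma v2r_lfun V W (f : 'Hom(V, W)) v : v2r (f v) = v2r v *m f2mx f.
Proof. by rewrite unlock /= r2vK. Qed.

Lemma lin_tr V : lin (@tr_lfun k V : 'End(V) -> k^o).
Proof.
have trE (f : 'End(V)) : tr_lfun f = \sum_i v2r (f (tbase i)) 0 i.
  by apply: eq_bigr => i _; rewrite -f2mxE mxE.
move=> a f g; rewrite !trE -[RHS]/(a * _ + _) mulr_sumr -big_split.
by apply: eq_bigr => i _; rewrite add_lfunE scale_lfunE linearP !mxE.
Qed.

Lemma tr_lfunC V W (f : 'Hom(V, W)) (g : 'Hom(W, V)) :
  tr_lfun (g \o f)%VF = tr_lfun (f \o g)%VF.
Proof.
have cM U1 U2 U3 (p : 'Hom(U2, U3)) (q : 'Hom(U1, U2)) :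
    f2mx (p \o q)%VF = f2mx q *m f2mx p.
  apply/row_matrixP => i; rewrite f2mxE comp_lfunE row_mul f2mxE.
  exact: v2r_lfun.
by rewrite /tr_lfun !cM mxtrace_mulC.
Qed.

(** The map factors through the line [k^o], so cyclicity of the trace reduces it to a scalar on that
    line. *)
Lemma tr_rank1 V (f : 'Hom(V, k^o)) (v : V) :
  tr_lfun (linfun (fun w => (f w : k) *: v)) = f v.
Proof.
pose g : 'Hom(k^o, V) := linfun (fun a : k^o => (a : k) *: v).
have gE a : g a = a *: v by rewrite linfE //; lin.
have -> : linfun (fun w => (f w : k) *: v) = (g \o f)%VF.
  by apply/lfunP => w; rewrite comp_lfunE gE linfE //; lin.
rewrite tr_lfunC.
have -> : (f \o g)%VF = (f v : k) *: \1%VF.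
  apply/lfunP => a; rewrite comp_lfunE gE linearZ scale_lfunE id_lfunE.
  exact: mulrC.
rewrite (linZ (@lin_tr k^o)) -[RHS]mulr1; congr (_ * _).
rewrite /tr_lfun.
have -> : f2mx (\1%VF : 'End(k^o)) = 1%:M; last by rewrite mxtrace1.
by apply/row_matrixP => i; rewrite f2mxE id_lfunE /tbase r2vK row1.
Qed.

End Contraction.

(** * Traces of operators on a tensor product of two spaces *)

Section TwoFoldTrace.
Variables (k : fieldType) (A B : vectType k).

Definition Tr2 (h : A -> B -> tens A B) : k^o := @tr_lfun k _ (tlift h).

Lemma Tr2_ext (h g : A -> B -> tens A B) : (forall x y, h x y = g x y) -> Tr2 h = Tr2 g.
Proof.
move=> hg; congr (@tr_lfun k _); apply/lfunP => t; exact: tcon_ext.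
Qed.

Lemma Tr2_sw (V W : vectType k) (t : tens V W) (h : V -> W -> A -> B -> tens A B) :
  Tr2 (fun x y => \sw a b <- t; h a b x y) = \sw a b <- t; Tr2 (h a b).
Proof.
rewrite /Tr2 -(@tcon_lin k _ _ _ k^o (@tr_lfun k _)); last exact: lin_tr.
congr (@tr_lfun k _); apply/lfunP => s; rewrite -[LHS]/(tcon s _) tcon_exch.
by rewrite (tcon_lin (g := fun f : 'End(tens A B) => f s)) //; lin.
Qed.

Lemma Tr2_move (f : 'End(A)) (g : 'End(B)) (h : A -> B -> tens A B) : bilin h ->
  Tr2 (fun x y => tmap f g (h x y)) = Tr2 (fun x y => h (f x) (g y)).
Proof.
move=> hb; rewrite /Tr2.
have -> : tlift (fun x y => tmap f g (h x y)) = (tmap f g \o tlift h)%VF.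
  by apply/lfunP => t; rewrite comp_lfunE [RHS]tcon_lfun.
have -> : tlift (fun x y => h (f x) (g y)) = (tlift h \o tmap f g)%VF.
  apply: tens_ext => v w; rewrite comp_lfunE tmapE !tliftE //.
  by case: hb => hl hr; apply: bilinI => ?; [apply: lin_comp (hl _) _ | apply: lin_comp (hr _) _]; lin.
exact: tr_lfunC.
Qed.

End TwoFoldTrace.

(** * Cogroupoids *)

(* The linear dual of a Hopf cogroupoid in which all the spaces H(X, Y) have  *)
(* the same carrier A: the comultiplication of H(X, Y) is cgd X Y, the        *)
(* product of A restricts to H(X, Y) x H(Y, Z) -> H(X, Z), and cgS X Y maps   *)
(* H(X, Y) to H(Y, X), with inverse cgT Y X.                                  *)
Record cogroupoid (k : fieldType) (A : falgType k) (T : Type) := Cogroupoid {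
  cgd : T -> T -> 'Hom(A, tens A A);
  cge : 'Hom(A, k^o);
  cgS : T -> T -> 'End(A);
  cgT : T -> T -> 'End(A);
  cg_coassoc : forall X Y x (U : vectType k) (f : A -> A -> A -> U),
    trilin f ->
    (\sw a b <- cgd X Y x; \sw c d <- cgd X Y a; f c d b)
    = (\sw a b <- cgd X Y x; \sw c d <- cgd X Y b; f a c d);
  cg_counitl : forall X Y x, (\sw a b <- cgd X Y x; (cge a : k) *: b) = x;
  cg_counitr : forall X Y x, (\sw a b <- cgd X Y x; (cge b : k) *: a) = x;
  cg_copM : forall X Y Z x y (U : vectType k) (f : A -> A -> U), bilin f ->
    tcon (cgd X Z (x * y)) f
    = \sw a b <- cgd X Y x; \sw c d <- cgd Y Z y; f (a * c) (b * d);
  cg_cop1 : forall X, cgd X X 1 = ptens 1 1;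
  cg_counit1 : cge 1 = 1 :> k;
  cg_counitM : forall x y, cge (x * y) = (cge x : k) * cge y :> k;
  cg_antil : forall X Y x, (\sw a b <- cgd X Y x; cgS X Y a * b) = (cge x : k) *: 1;
  cg_antir : forall X Y x, (\sw a b <- cgd X Y x; a * cgS X Y b) = (cge x : k) *: 1;
  cgTK : forall X Y x, cgS Y X (cgT X Y x) = x;
  cgSK : forall X Y x, cgT Y X (cgS X Y x) = x
}.

Section Cogroupoid.
Variables (k : fieldType) (A : falgType k) (T : Type) (G : cogroupoid A T).
Implicit Types (X Y Z : T) (U : vectType k) (x y : A).
Local Notation D := (cgd G).
Local Notation e x := (cge G x : k).
Local Notation S := (cgS G).
Local Notation Ti := (cgT G).

Lemma counitl_lin X Y x U (f : A -> U) : lin f ->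
  (\sw a b <- D X Y x; e a *: f b) = f x.
Proof.
move=> fl; rewrite -[in RHS](cg_counitl G X Y x) (tcon_lin _ _ fl).
by apply: tcon_ext => a b; rewrite (linZ fl).
Qed.

Lemma counitr_lin X Y x U (f : A -> U) : lin f ->
  (\sw a b <- D X Y x; e b *: f a) = f x.
Proof.
move=> fl; rewrite -[in RHS](cg_counitr G X Y x) (tcon_lin _ _ fl).
by apply: tcon_ext => a b; rewrite (linZ fl).
Qed.

Lemma coA X Y x U (f : A -> A -> A -> U) : trilin f ->
  (\sw a b <- D X Y x; \sw c d <- D X Y a; f c d b)
  = (\sw a b <- D X Y x; \sw c d <- D X Y b; f a c d).
Proof. exact: cg_coassoc. Qed.

(** Common form of the four cancellations S(x_1) x_2, x_1 S(x_2), S^-1(x_2) x_1 and x_2 S^-1(x_1),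
    so that removing an adjacent pair is proved once for all of them. *)
Definition antipodal X Y (m : A -> A -> A) :=
  bilin m /\ forall x, (\sw a b <- D X Y x; m a b) = e x *: 1.

Lemma antipodal_lin X Y m x U (f : A -> U) : antipodal X Y m -> lin f ->
  (\sw a b <- D X Y x; f (m a b)) = e x *: f 1.
Proof. by move=> [_ ma] fl; rewrite -(tcon_lin _ _ fl) ma (linZ fl). Qed.

Lemma antipodal_23 X Y m x U (g : A -> A -> U) : antipodal X Y m -> bilin g ->
  (\sw a b <- D X Y x; \sw c d <- D X Y b; g a (m c d)) = g x 1.
Proof.
move=> am [gl gr]; rewrite -(counitr_lin X Y x (gl 1)); apply: tcon_ext => a b.
exact: (antipodal_lin _ am (gr a)).
Qed.

Lemma antipodal_12 X Y m x U (g : A -> A -> U) : antipodal X Y m -> bilin g ->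
  (\sw a b <- D X Y x; \sw c d <- D X Y b; g (m a c) d) = g 1 x.
Proof.
move=> am [gl gr]; have [[ml mr] _] := am.
rewrite -(@coA X Y x U (fun a c d => g (m a c) d)).
  rewrite -(counitl_lin X Y x (gr 1)); apply: tcon_ext => a b.
  exact: (antipodal_lin _ am (gl b)).
split=> [b c|a c|a b]; last exact: gr.
  exact: (lin_comp (gl _) (ml _)).
exact: (lin_comp (gl _) (mr _)).
Qed.

Lemma anti_Sl X Y : antipodal X Y (fun a b => S X Y a * b).
Proof. by split=> [|x]; [lin | exact: cg_antil]. Qed.

Lemma anti_Sr X Y : antipodal X Y (fun a b => a * S X Y b).
Proof. by split=> [|x]; [lin | exact: cg_antir]. Qed.

(** The expression S(x_1 y_1) x_2 y_2 S(y_3) S(x_3) collapses from the right to S(xy) and from the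
    left to S(y) S(x). *)
Lemma cgSM X Y Z x y : S X Z (x * y) = S Y Z y * S X Y x.
Proof.
transitivity (\sw x1 x' <- D X Y x; \sw x2 x3 <- D X Y x';
    \sw y1 y' <- D Y Z y; \sw y2 y3 <- D Y Z y';
    S X Z (x1 * y1) * (x2 * (y2 * S Y Z y3) * S X Y x3)).
  rewrite -[LHS]mulr1.
  rewrite -(antipodal_23 x (g := fun a b => S X Z (a * y) * b) (anti_Sr X Y)); last by lin.
  apply: tcon_ext => x1 x'; apply: tcon_ext => x2 x3.
  rewrite (antipodal_23 y (g := fun a b => S X Z (x1 * a) * (x2 * b * S X Y x3)) (anti_Sr Y Z)) ?mulr1 //.
  by lin.
rewrite -coA; last by lin.
rewrite -[RHS](counitl_lin X Y x (f := fun b => S Y Z y * S X Y b)); last by lin.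
apply: tcon_ext => x' x3; transitivity (\sw y' y3 <- D Y Z y; \sw x1 x2 <- D X Y x';
  \sw y1 y2 <- D Y Z y'; S X Z (x1 * y1) * (x2 * y2) * (S Y Z y3 * S X Y x3)).
  rewrite [RHS]tcon_exch; apply: tcon_ext => x1 x2; rewrite -coA; last by lin.
  by do 2!apply: tcon_ext => ? ?; rewrite !mulrA.
transitivity (\sw y' y3 <- D Y Z y; e y' *: (e x' *: (S Y Z y3 * S X Y x3))); last first.
  by rewrite (counitl_lin _ _ y (f := fun b => e x' *: (S Y Z b * S X Y x3))) //; lin.
apply: tcon_ext => y' y3.
rewrite -(@cg_copM k A T G X Y Z x' y' _ (fun a b => S X Z a * b * (S Y Z y3 * S X Y x3)));
  last by lin.
rewrite (antipodal_lin _ (f := fun a => a * (S Y Z y3 * S X Y x3)) (anti_Sl X Z)); last by lin.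
by rewrite cg_counitM mul1r scalerA mulrC.
Qed.

Lemma cgS1 X : S X X 1 = 1.
Proof.
have := cg_antil G X X 1; rewrite cg_cop1 tcon_ptens; last by lin.
by rewrite mulr1 cg_counit1 scale1r.
Qed.

Lemma counitS X Y x : e (S X Y x) = e x :> k.
Proof.
have := congr1 (cge G) (cg_antil G X Y x).
rewrite tcon_lfun functZ cg_counit1 mulr1 => <-.
rewrite -[LHS](counitr_lin X Y x (U := k^o) (f := fun a => cge G (S X Y a))); last by lin.
by apply: (@tcon_ext k A A k^o) => a b; rewrite cg_counitM mulrC.
Qed.

(** Both sides are convolution inverse to the coproduct: Delta(S x_1) Delta(x_2) (S x_4 (x) S x_3)
    is collapsed from either end. *)
Lemma copS X Y x U (f : A -> A -> U) : bilin f ->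
  tcon (D Y X (S X Y x)) f = \sw a b <- D X Y x; f (S X Y b) (S X Y a).
Proof.
move=> fb; have [fl fr] := fb.
transitivity (\sw x1 x' <- D X Y x; \sw x2 x'' <- D X Y x'; \sw x3 x4 <- D X Y x'';
  \sw p q <- D Y X (S X Y x1); \sw r s <- D X Y x2; f (p * (r * S X Y x4)) (q * (s * S X Y x3))).
  rewrite -(counitr_lin X Y x (f := fun z => tcon (D Y X (S X Y z)) f)); last by lin.
  apply: tcon_ext => x1 x'.
  transitivity (\sw p q <- D Y X (S X Y x1); \sw x2 x'' <- D X Y x'; \sw r s <- D X Y x2;
     \sw x3 x4 <- D X Y x''; f (p * (r * S X Y x4)) (q * (s * S X Y x3))); last first.
    rewrite tcon_exch; apply: tcon_ext => x2 x''; rewrite [RHS]tcon_exch.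
    by apply: tcon_ext => p q; rewrite tcon_exch.
  rewrite (tcon_lin (g := fun w => _ *: w)); last by lin.
  apply: tcon_ext => p q; rewrite coA; last by split=> ? ?; lin.
  transitivity (\sw r y <- D X Y x'; f (p * (r * S X Y y)) q); last first.
    apply: tcon_ext => r y.
    rewrite (antipodal_12 y (g := fun u v => f (p * (r * S X Y v)) (q * u)) (anti_Sr X Y)) ?mulr1 //.
    by lin.
  by rewrite (antipodal_lin x' (f := fun u => f (p * u) q) (anti_Sr X Y)) ?mulr1 //; lin.
pose g z w := \sw x3 x4 <- D X Y w; tcon (D Y Y z) (fun a b => f (a * S X Y x4) (b * S X Y x3)).
transitivity (\sw x1 x' <- D X Y x; \sw x2 x'' <- D X Y x'; g (S X Y x1 * x2) x'').
  do 3!apply: tcon_ext => ? ?.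
  rewrite (@cg_copM k A T G Y X Y); last by lin.
  by do 2!apply: tcon_ext => ? ?; rewrite !mulrA.
rewrite (antipodal_12 _ (anti_Sl X Y)); last by rewrite /g; lin.
by apply: tcon_ext => a b; rewrite cg_cop1 tcon_ptens ?mul1r //; lin.
Qed.

Lemma cgT1 X : Ti X X 1 = 1.
Proof. by rewrite -[in LHS](cgS1 X) cgSK. Qed.

Lemma cgS_inj X Y : injective (S X Y).
Proof. by move=> x y /(congr1 (Ti Y X)); rewrite !cgSK. Qed.

Lemma cgTM X Y Z x y : Ti X Z (x * y) = Ti Y Z y * Ti X Y x.
Proof. by apply: (@cgS_inj Z X); rewrite cgTK (@cgSM Z Y X) !cgTK. Qed.

Lemma copT X Y x U (f : A -> A -> U) : bilin f ->
  tcon (D Y X (Ti X Y x)) f = \sw a b <- D X Y x; f (Ti X Y b) (Ti X Y a).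
Proof.
move=> fb; have [fl fr] := fb.
rewrite -{2}(cgTK G X Y x) copS; last by lin.
by apply: tcon_ext => a b; rewrite !cgSK.
Qed.

Lemma anti_Tl X Y : antipodal X Y (fun a b => Ti X Y b * a).
Proof.
split=> [|x]; first by lin.
apply: (@cgS_inj Y Y); rewrite tcon_lfun linZ ?cgS1; last by lin.
rewrite -(cg_antil G X Y x).
by apply: tcon_ext => a b; rewrite (@cgSM Y X Y) cgTK.
Qed.

Lemma anti_Tr X Y : antipodal X Y (fun a b => b * Ti X Y a).
Proof.
split=> [|x]; first by lin.
apply: (@cgS_inj X X); rewrite tcon_lfun linZ ?cgS1; last by lin.
rewrite -(cg_antir G X Y x).
by apply: tcon_ext => a b; rewrite (@cgSM X Y X) cgTK.
Qed.

Fixpoint cgP X (n : nat) : 'End(A) :=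
  if n is n'.+1 then linfun (fun x => \sw a b <- D X X x; a * cgP X n' b)
  else linfun (fun x => e x *: 1).

Lemma cgP0E X x : cgP X 0 x = e x *: 1.
Proof. by rewrite /= linfE //; lin. Qed.

Lemma cgPSE X n x : cgP X n.+1 x = \sw a b <- D X X x; a * cgP X n b.
Proof. by rewrite /= linfE //; lin. Qed.

(** Both sides multiply out to x_1 y_1 x_2 y_2 ... y_n x_{n+1}, bracketed after or before the
    alternating product. The bracketing decides whether the Sweedler power is taken at Y or at X;
    this is how powers change object. *)
Lemma cgP_equiv X Y n x y U (f : A -> U) : lin f ->
  (\sw a b <- D X Y x; f (a * cgP Y n (y * b)))
  = \sw a b <- D X Y x; f (cgP X n (a * y) * b).
Proof.
move=> fl; elim: n => [|n IHn] in x y U f fl *.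
  transitivity (e y *: f x).
    rewrite -(counitr_lin X Y x (f := fun a => e y *: f a)); last by lin.
    apply: tcon_ext => a b; rewrite cgP0E cg_counitM -scalerAr mulr1 (linZ fl).
    by rewrite scalerA mulrC.
  rewrite -(counitl_lin X Y x (f := fun a => e y *: f a)); last by lin.
  apply: tcon_ext => a b; rewrite cgP0E cg_counitM -scalerAl mul1r (linZ fl).
  by rewrite scalerA.
transitivity (\sw a b <- D X Y x; \sw y1 y2 <- D Y X y; \sw b1 b2 <- D X Y b;
  f (a * (y1 * b1 * cgP Y n (y2 * b2)))).
  apply: tcon_ext => a b; rewrite cgPSE (tcon_lin (g := fun z => f (a * z))); last by lin.
  by rewrite (@cg_copM k A T G Y X Y); last by lin.
transitivity (\sw a b <- D X Y x; \sw y1 y2 <- D Y X y; \sw b1 b2 <- D X Y b;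
  f (a * y1 * (cgP X n (b1 * y2) * b2))).
  apply: tcon_ext => a b; apply: tcon_ext => y1 y2.
  rewrite -(IHn b y2 _ (fun z => f (a * y1 * z))); last by lin.
  by apply: tcon_ext => b1 b2; rewrite !mulrA.
transitivity (\sw y1 y2 <- D Y X y; \sw a b <- D X Y x; \sw b1 b2 <- D X Y a;
  f (b1 * y1 * (cgP X n (b2 * y2) * b))).
  rewrite tcon_exch; apply: tcon_ext => y1 y2; rewrite coA //.
  by split=> ? ?; lin.
rewrite tcon_exch; apply: tcon_ext => a b.
rewrite cgPSE (tcon_lin (g := fun z => f (z * b))); last by lin.
rewrite (@cg_copM k A T G X Y X); last by lin.
by rewrite tcon_exch; do 2!apply: tcon_ext => ? ?; rewrite !mulrA.
Qed.

End Cogroupoid.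

(** * Mutual conjugation of two elements and its behaviour under products *)

Section Braiding.
Variables (k : fieldType) (A : falgType k) (T : Type) (G : cogroupoid A T).
Implicit Types (X Y Z : T) (U : vectType k) (x y : A).
Local Notation D := (cgd G).
Local Notation e x := (cge G x : k).
Local Notation S := (cgS G).
Local Notation Ti := (cgT G).

Lemma cop3M X Y Z x y U (f : A -> A -> A -> U) : trilin f ->
  tcon3 (D X Z) (x * y) f
  = \sw3 a b c <- D X Y, x; \sw3 p q r <- D Y Z, y; f (a * p) (b * q) (c * r).
Proof.
move=> fl; rewrite {1}/tcon3 (@cg_copM k A T G X Y Z); last by lin.
apply: tcon_ext => a b; rewrite tcon_exch; apply: tcon_ext => p q.
rewrite (@cg_copM k A T G X Y Z); last by lin.
by rewrite tcon_exch.
Qed.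

Lemma cop3S X Y x U (f : A -> A -> A -> U) : trilin f ->
  tcon3 (D Y X) (S X Y x) f = \sw3 a b c <- D X Y, x; f (S X Y c) (S X Y b) (S X Y a).
Proof.
move=> fl; rewrite /tcon3 copS; last by lin.
rewrite -coA; last by split=> ? ?; lin.
by apply: tcon_ext => a b; rewrite copS //; lin.
Qed.

(** Among five consecutive components the last two, adjacent by coassociativity, cancel. *)
Lemma antipodal3_45 X Y m x U (h : A -> A -> A -> A -> U) : antipodal G X Y m ->
  (forall a b, bilin (h a b)) -> (forall c d, bilin (fun a b => h a b c d)) ->
  (\sw3 a b c <- D X Y, x; \sw3 p q r <- D X Y, b; h a p q (m r c))
  = \sw3 a b c <- D X Y, x; h a b c 1.
Proof.
move=> am h1 h2; have [mb _] := am; apply: tcon_ext => a w.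
transitivity (\sw p w' <- D X Y w; \sw d c <- D X Y w'; \sw q r <- D X Y d; h a p q (m r c)).
  by rewrite -[RHS]coA //; lin.
apply: tcon_ext => p w'; rewrite coA; last by lin.
exact: (antipodal_23 w' am).
Qed.

Lemma antipodal3_12 X Y m x U (h : A -> A -> A -> A -> U) : antipodal G X Y m ->
  (forall a b, bilin (h a b)) -> (forall c d, bilin (fun a b => h a b c d)) ->
  (\sw3 a b c <- D X Y, x; \sw3 p q r <- D X Y, b; h (m a p) q r c)
  = \sw3 a b c <- D X Y, x; h 1 a b c.
Proof.
move=> am h1 h2; have [mb _] := am.
transitivity (\sw a w <- D X Y x; \sw p w' <- D X Y w; \sw d c <- D X Y w'; \sw q r <- D X Y d; h (m a p) q r c).
  by apply: tcon_ext => a w; rewrite -[RHS]coA //; lin.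
transitivity (\sw a w <- D X Y x; \sw p w' <- D X Y w; tcon3 (D X Y) w' (h (m a p))).
  by do 2!apply: tcon_ext => ? ?; rewrite coA //; lin.
by rewrite (antipodal_12 x (g := fun a w => tcon3 (D X Y) w (h a))) //; lin.
Qed.

(* S(y_1) x_2 S^-1(y_3) (x) S^-1(x_1) y_2 S(x_3) *)
Definition braid X Y x y U (f : A -> A -> U) : U :=
  \sw3 a b c <- D X Y, x; \sw3 p q r <- D X Y, y;
    f (S X Y p * b * Ti X Y r) (Ti X Y a * q * S X Y c).

Lemma lin_braidl X Y y U (V : vectType k) (f : A -> A -> U) (t : V -> A) :
  bilin f -> lin t -> lin (fun z => braid X Y (t z) y f).
Proof. by move=> fb tl; rewrite /braid; lin. Qed.

Lemma lin_braidr X Y x U (V : vectType k) (f : A -> A -> U) (t : V -> A) :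
  bilin f -> lin t -> lin (fun z => braid X Y x (t z) f).
Proof. by move=> fb tl; rewrite /braid; lin. Qed.

Lemma lin_braidf X Y x y U (V : vectType k) (f : V -> A -> A -> U) :
  (forall u v, lin (fun z => f z u v)) -> lin (fun z => braid X Y x y (f z)).
Proof. by move=> fl; rewrite /braid; lin. Qed.

(** Opening the right side makes d_2 contribute three components. The last one meets S(d_3) as
    S(S(b_3) c), which cancels; the others are exactly those of the product x d. *)
Lemma braid_mulr X Y Z x d y U (f : A -> A -> U) : bilin f ->
  braid X Z (x * d) y f
  = \sw3 a b c <- D Y Z, d;
    braid X Y x (y * S Y Z b) (fun u v => f (S Y Z c * u) (Ti Y Z a * v)).
Proof.
move=> fb; rewrite /braid (@cop3M X Y Z); last by split=> ? ?; lin.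
rewrite [RHS]tcon3_exch; apply: tcon3_ext => x1 x2 x3.
transitivity (\sw3 y1 y2 y3 <- D X Z, y; \sw3 a b c <- D Y Z, d; \sw3 b1 b2 b3 <- D Y Z, b;
  f (S Z Z (S Y Z b3 * c) * S X Z y1 * x2 * b1 * Ti X Z y3)
    (Ti Y Z a * Ti X Y x1 * y2 * S Y Z b2 * S X Y x3)); last first.
  rewrite tcon3_exch; apply: tcon3_ext => a b c.
  rewrite (@cop3M X Z Y); last by split=> ? ?; lin.
  apply: tcon3_ext => y1 y2 y3; rewrite cop3S; last by split=> ? ?; lin.
  apply: tcon3_ext => b1 b2 b3.
  by rewrite !(cgSM G X Z Y, cgTM G X Z Y, cgSM G Z Y Z) cgSK !mulrA.
rewrite tcon3_exch; apply: tcon3_ext => y1 y2 y3.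
(* Applying S to the counit identity S(b) c = e keeps it a counit identity. *)
have mb : antipodal G Y Z (fun b c => S Z Z (S Y Z b * c)).
  split; first by lin.
  move=> z; rewrite (antipodal_lin _ (f := S Z Z) (anti_Sl G Y Z)) ?cgS1 //.
  by lin.
rewrite (antipodal3_45 d (h := fun a b1 b2 z => f (z * S X Z y1 * x2 * b1 * Ti X Z y3)
    (Ti Y Z a * Ti X Y x1 * y2 * S Y Z b2 * S X Y x3)) mb); [|by move=> ? ?; lin..].
apply: tcon3_ext => a b c.
by rewrite (cgTM G X Y Z) (cgSM G X Y Z) mul1r !mulrA.
Qed.

Lemma braid_mull X Y Z x d y U (f : A -> A -> U) : bilin f ->
  braid X Z x (d * y) f
  = \sw3 a b c <- D X Y, d;
    braid Y Z (S X Y b * x) y (fun u v => f (u * Ti X Y c) (v * S X Y a)).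
Proof.
move=> fb; rewrite /braid.
transitivity (\sw3 x1 x2 x3 <- D X Z, x; \sw3 y1 y2 y3 <- D Y Z, y;
   \sw3 a b c <- D X Y, d; \sw3 b1 b2 b3 <- D X Y, b;
   f (S Y Z y1 * S X Y b2 * x2 * Ti Y Z y3 * Ti X Y c)
     (Ti X Z x1 * b3 * y2 * S X Z x3 * S X X (a * S X Y b1))); last first.
  transitivity (\sw3 a b c <- D X Y, d; \sw3 x1 x2 x3 <- D X Z, x;  \sw3 b1 b2 b3 <- D X Y, b;
    \sw3 y1 y2 y3 <- D Y Z, y;
    f (S Y Z y1 * S X Y b2 * x2 * Ti Y Z y3 * Ti X Y c)
     (Ti X Z x1 * b3 * y2 * S X Z x3 * S X X (a * S X Y b1))).
    rewrite [RHS]tcon3_exch; apply: tcon3_ext => x1 x2 x3.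
    rewrite tcon3_exch; apply: tcon3_ext => a b c.
    by rewrite tcon3_exch.
  apply: tcon3_ext => a b c; rewrite (@cop3M Y X Z); last by split=> ? ?; lin.
  rewrite cop3S; last by split=> ? ?; lin.
  rewrite tcon3_exch; apply: tcon3_ext => b1 b2 b3.
  apply: tcon3_ext => x1 x2 x3; apply: tcon3_ext => y1 y2 y3.
  by rewrite !(cgSM G Y X Z, cgTM G Y X Z, cgSM G X Y X) cgSK !mulrA.
apply: tcon3_ext => x1 x2 x3; rewrite (@cop3M X Y Z); last by split=> ? ?; lin.
rewrite tcon3_exch; apply: tcon3_ext => y1 y2 y3.
have mb : antipodal G X Y (fun b c => S X X (b * S X Y c)).
  split; first by lin.
  move=> z; rewrite (antipodal_lin _ (f := S X X) (anti_Sr G X Y)) ?cgS1 //.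
  by lin.
rewrite (antipodal3_12 d (h := fun z b2 b3 c => f (S Y Z y1 * S X Y b2 * x2 * Ti Y Z y3 * Ti X Y c)
     (Ti X Z x1 * b3 * y2 * S X Z x3 * z)) mb); [|by move=> ? ?; lin..].
apply: tcon3_ext => a b c.
by rewrite (cgTM G X Y Z) (cgSM G X Y Z) mulr1 !mulrA.
Qed.

End Braiding.

Ltac linb := repeat
  lazymatch goal with
  | |- lin (fun z => @braid _ _ _ _ _ _ (@?x z) (@?y z) _ (@?f z)) =>
    first [ is_cst f; first [ is_cst x; apply: lin_braidr | apply: lin_braidl ]
          | apply: lin_braidf => ? ? ]
  | |- _ => lin_step
  end.

Definition tcon22 (k : fieldType) (V U : vectType k) (d : 'Hom(V, tens V V)) (x : V)
    (f : V -> V -> V -> V -> U) : U :=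
  \sw w y <- d x; \sw a b <- d w; \sw p q <- d y; f a b p q.

Lemma tcon22_tcon (k : fieldType) (V W W' U : vectType k) d (x : V) (t : tens W W')
    (f : W -> W' -> V -> V -> V -> V -> U) :
  (\sw c e <- t; tcon22 d x (f c e))
  = tcon22 d x (fun p q r s => \sw c e <- t; f c e p q r s).
Proof.
rewrite /tcon22 tcon_exch; apply: tcon_ext => ? ?.
by rewrite tcon_exch; apply: tcon_ext => ? ?; rewrite tcon_exch.
Qed.

(** * Passing the trace operator from one object to another *)

Section Twisting.
Variables (k : fieldType) (A : falgType k) (T : Type) (G : cogroupoid A T).
Implicit Types (X Y Z : T) (U : vectType k) (x y : A).
Variables m n : nat.
Local Notation D := (cgd G).
Local Notation e x := (cge G x : k).
Local Notation S := (cgS G).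
Local Notation Ti := (cgT G).
Local Notation P X := (cgP G X m).
Local Notation R X := (cgP G X n).

(** For the cogroupoid of a Hopf algebra and f = [ptens], this is S (x) S after the operator [Psi]
    of indices m+1 and n+1 ([Psi_kup]). The map f records what is done with the two output legs. *)
Definition kup X x y U (f : A -> A -> U) : U :=
  \sw x1 x2 <- D X X x; \sw y1 y2 <- D X X y;
    braid G X X x1 y2 (fun u v => f (S X X (P X x2) * u) (v * S X X (R X y1))).

Lemma kup_bilin X U (f : A -> A -> U) : bilin f -> bilin (fun x y => kup X x y f).
Proof. by move=> fb; rewrite /kup; linb. Qed.

Lemma kup_ext X x y U (f g : A -> A -> U) : (forall u v, f u v = g u v) ->
  kup X x y f = kup X x y g.
Proof.
by move=> fg; do 2!apply: tcon_ext => ? ?; do 2!apply: tcon3_ext => ? ? ?.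
Qed.

Lemma lin_kupf X x y U (V : vectType k) (f : V -> A -> A -> U) :
  (forall u v, lin (fun z => f z u v)) -> lin (fun z => kup X x y (f z)).
Proof. by move=> fl; rewrite /kup; linb. Qed.

Lemma braid_ext X Y x y U (f g : A -> A -> U) : (forall u v, f u v = g u v) ->
  braid G X Y x y f = braid G X Y x y g.
Proof. by move=> fg; do 2!apply: tcon3_ext => ? ? ?. Qed.

Lemma braid_lin X Y x y U (V : vectType k) (g : U -> V) (f : A -> A -> U) : lin g ->
  g (braid G X Y x y f) = braid G X Y x y (fun u v => g (f u v)).
Proof.
by move=> gl; rewrite /braid (tcon3_lin _ _ _ gl); apply: tcon3_ext => ? ? ?; rewrite (tcon3_lin _ _ _ gl).
Qed.

Lemma kup_lin X x y U (V : vectType k) (g : U -> V) (f : A -> A -> U) : lin g ->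
  g (kup X x y f) = kup X x y (fun u v => g (f u v)).
Proof.
move=> gl; rewrite /kup (tcon_lin _ _ gl); apply: tcon_ext => ? ?.
by rewrite (tcon_lin _ _ gl); apply: tcon_ext => ? ?; rewrite braid_lin.
Qed.

(** The operator after its first input has been routed through Y: the first Sweedler power is
    already taken at Y, the second still at X. *)
Definition kup1 X Y x y d U (f : A -> A -> U) : U :=
  \sw3 d1 d2 d3 <- D Y X, d; \sw x1 x2 <- D X Y x; \sw y1 y2 <- D X X y;
    braid G X Y x1 (y2 * S Y X d1)
      (fun u v => f (S Y X d3 * (S Y Y (P Y (d2 * x2)) * u)) (v * S X X (R X y1))).

(** Here x lies in H(X, Y) and d in H(Y, X). [braid_mulr] extracts three components of d from the
    braiding, and the fourth sits inside the Sweedler power. *)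
Lemma kup_mulr X Y x y d U (f : A -> A -> U) : bilin f ->
  kup X (x * d) y f
  = \sw d1 d' <- D Y X d; kup1 X Y x y d' (fun u v => f u (Ti Y X d1 * v)).
Proof.
move=> fb; rewrite /kup (@cg_copM k A T G X Y X); last by linb.
transitivity (\sw x1 x2 <- D X Y x; \sw y1 y2 <- D X X y;
   \sw a b <- D Y X d; \sw3 a1 a2 a3 <- D Y X, a;
   braid G X Y x1 (y2 * S Y X a2)
   (fun u v => f (S Y X (a3 * P X (x2 * b)) * u) (Ti Y X a1 * v * S X X (R X y1)))).
  apply: tcon_ext => x1 x2; rewrite tcon_exch; apply: tcon_ext => y1 y2.
  apply: tcon_ext => a b; rewrite (braid_mulr G X Y X); last by lin.
  apply: tcon3_ext => a1 a2 a3; apply: braid_ext => u v.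
  by rewrite (cgSM G Y X X) !mulrA.
transitivity (\sw d1 d' <- D Y X d; \sw x1 x2 <- D X Y x; \sw y1 y2 <- D X X y;
   \sw3 d2 d3 d4 <- D Y X, d'; braid G X Y x1 (y2 * S Y X d2)
   (fun u v => f (S Y X d4 * (S Y Y (P Y (d3 * x2)) * u)) (Ti Y X d1 * v * S X X (R X y1))));
     last first.
  apply: tcon_ext => d1 d'; rewrite /kup1 tcon3_tcon; apply: tcon_ext => x1 x2.
  rewrite tcon3_tcon; apply: tcon_ext => y1 y2; apply: tcon3_ext => ? ? ?.
  by apply: braid_ext => u v; rewrite !mulrA.
rewrite [RHS]tcon_exch; apply: tcon_ext => x1 x2.
rewrite [RHS]tcon_exch; apply: tcon_ext => y1 y2.
rewrite coA; last by split=> ? ?; linb.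
apply: tcon_ext => d1 d'; rewrite coA; last by linb.
apply: tcon_ext => d2 w.
rewrite (cgP_equiv G Y X m w x2 (f := fun z => braid G X Y x1 (y2 * S Y X d2)
  (fun u v => f (S Y X z * u) (Ti Y X d1 * v * S X X (R X y1))))); last by linb.
apply: tcon_ext => d3 d4; apply: braid_ext => u v.
by rewrite (cgSM G Y Y X) !mulrA.
Qed.

(** The counterpart for the second input, with a in H(X, Y) and y in H(Y, X): after it both Sweedler
    powers and the braiding live at Y. *)
Lemma kup1_mull X Y x a y d U (f : A -> A -> U) : bilin f ->
  kup1 X Y x (a * y) d f
  = tcon22 (D X Y) a (fun a1 a2 a3 a4 =>
    \sw3 d1 d2 d3 <- D Y X, d; \sw x1 x2 <- D X Y x; \sw y1 y2 <- D Y X y;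
    braid G Y Y (S X Y a3 * x1) (y2 * S Y X d1)
      (fun u v => f (S Y X d3 * (S Y Y (P Y (d2 * x2)) * u) * Ti X Y a4)
                    (v * S Y Y (R Y (y1 * a2)) * S X Y a1))).
Proof.
move=> fb; rewrite /kup1 /tcon3.
transitivity (\sw3 d1 d2 d3 <- D Y X, d; \sw x1 x2 <- D X Y x; \sw y1 y2 <- D Y X y;
   \sw a' a'' <- D X Y a; \sw3 e1 e2 e3 <- D X Y, a'';
   braid G Y Y (S X Y e2 * x1) (y2 * S Y X d1)
     (fun u v => f (S Y X d3 * (S Y Y (P Y (d2 * x2)) * u) * Ti X Y e3)
                    (v * S X Y (R X (a' * y1) * e1)))).
  do 3!apply: tcon_ext => ? ?.
  rewrite (@cg_copM k A T G X Y X); last by linb.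
  rewrite tcon_exch; do 2!apply: tcon_ext => ? ?.
  rewrite -[X in braid _ _ _ _ X]mulrA (braid_mull G X Y Y); last by lin.
  by apply: tcon3_ext => ? ? ?; apply: braid_ext => u v; rewrite (cgSM G X X Y) !mulrA.
rewrite -tcon22_tcon; apply: tcon_ext => d1 ?.
rewrite -tcon22_tcon; apply: tcon_ext => d2 d3.
rewrite -tcon22_tcon; apply: tcon_ext => x1 x2.
rewrite -tcon22_tcon; apply: tcon_ext => y1 y2.
rewrite -coA; last by split=> ? ?; linb.
apply: tcon_ext => w b.
rewrite -(cgP_equiv G X Y n w y1 (f := fun z => \sw e2 e3 <- D X Y b;
   braid G Y Y (S X Y e2 * x1) (y2 * S Y X d1)
     (fun u v => f (S Y X d3 * (S Y Y (P Y (d2 * x2)) * u) * Ti X Y e3)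
                    (v * S X Y z)))); last by linb.
do 2!apply: tcon_ext => ? ?; apply: braid_ext => u v.
by rewrite (cgSM G X Y Y) !mulrA.
Qed.

End Twisting.

(** * Carrying multiplications round the trace *)

Section TraceMoves.
Variables (k : fieldType) (A : falgType k).

Lemma lin_Tr2 (V : vectType k) (h : V -> A -> A -> tens A A) :
  (forall x y, lin (fun z => h z x y)) -> lin (fun z => Tr2 (h z)).
Proof.
move=> hl a z w; rewrite /Tr2 -[RHS](@lin_tr k _ a (tlift (h z)) (tlift (h w))).
congr (@tr_lfun k _); apply/lfunP => t; rewrite add_lfunE scale_lfunE.
exact: (lin_tconr t hl a z w).
Qed.

Lemma Tr2_mulr1 d (h : A -> A -> tens A A) : bilin h ->
  Tr2 (fun x y => tmap (amulr d) \1%VF (h x y)) = Tr2 (fun x y => h (x * d) y).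
Proof.
by move=> hb; rewrite Tr2_move //; apply: Tr2_ext => x y; rewrite id_lfunE lfunE.
Qed.

Lemma Tr2_mull1 d (h : A -> A -> tens A A) : bilin h ->
  Tr2 (fun x y => tmap (amull d) \1%VF (h x y)) = Tr2 (fun x y => h (d * x) y).
Proof.
by move=> hb; rewrite Tr2_move //; apply: Tr2_ext => x y; rewrite id_lfunE lfunE.
Qed.

Lemma Tr2_mulr2 d (h : A -> A -> tens A A) : bilin h ->
  Tr2 (fun x y => tmap \1%VF (amulr d) (h x y)) = Tr2 (fun x y => h x (y * d)).
Proof.
by move=> hb; rewrite Tr2_move //; apply: Tr2_ext => x y; rewrite id_lfunE lfunE.
Qed.

Lemma Tr2_mull2 d (h : A -> A -> tens A A) : bilin h ->
  Tr2 (fun x y => tmap \1%VF (amull d) (h x y)) = Tr2 (fun x y => h x (d * y)).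
Proof.
by move=> hb; rewrite Tr2_move //; apply: Tr2_ext => x y; rewrite id_lfunE lfunE.
Qed.

End TraceMoves.

(** * Twisted cyclicity and independence of the object *)

Section Cyclicity.
Variables (k : fieldType) (A : falgType k) (T : Type) (G : cogroupoid A T).
Implicit Types (X Y Z : T) (U : vectType k) (x y : A).
Variables m n : nat.
Local Notation D := (cgd G).
Local Notation e x := (cge G x : k).
Local Notation S := (cgS G).
Local Notation Ti := (cgT G).
Local Notation P X := (cgP G X m).
Local Notation R X := (cgP G X n).

Lemma tcon22_T X Y z U (f : A -> A -> A -> A -> U) :
  (forall a b, bilin (f a b)) -> (forall c d, bilin (fun a b => f a b c d)) ->
  tcon22 (D X Y) (Ti Y X z) f
  = tcon22 (D Y X) z (fun p q r s => f (Ti Y X s) (Ti Y X r) (Ti Y X q) (Ti Y X p)).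
Proof.
move=> f1 f2; rewrite /tcon22 copT; last by lin.
apply: tcon_ext => a b; rewrite copT; last by lin.
rewrite [RHS]tcon_exch; apply: tcon_ext => b1 b2.
by rewrite copT //; lin.
Qed.

Lemma kup1_lin X Y x y d U (V : vectType k) (g : U -> V) (f : A -> A -> U) : lin g ->
  g (kup1 G m n X Y x y d f) = kup1 G m n X Y x y d (fun u v => g (f u v)).
Proof.
move=> gl; rewrite /kup1 (tcon3_lin _ _ _ gl); apply: tcon3_ext => ? ? ?.
rewrite (tcon_lin _ _ gl); apply: tcon_ext => ? ?.
by rewrite (tcon_lin _ _ gl); apply: tcon_ext => ? ?; rewrite braid_lin.
Qed.

(** The adjacent components r and s_1 cancel through s_1 S^-1(r), which makes s_2 adjacent to e_1,
    and these cancel through s_2 S(e_1). The four surviving components are regrouped so that q and t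
    form one coproduct. *)
Lemma antipodal_collapse X Y U (K : A -> A -> A -> A -> A -> A -> U) d :
  (forall r s t u, bilin (fun p q => K p q r s t u)) ->
  (forall p q t u, bilin (fun r s => K p q r s t u)) ->
  (forall p q r s, bilin (K p q r s)) ->
  (\sw d1 d' <- D Y X d; tcon22 (D Y X) d1 (fun p q r s =>
     \sw3 e1 e2 e3 <- D Y X, d'; \sw s1 s2 <- D Y X s;
     K p q (s1 * Ti Y X r) (s2 * S Y X e1) e2 e3))
  = \sw p w <- D Y X d; \sw z u <- D Y X w; \sw q t <- D Y X z; K p q 1 1 t u.
Proof.
move=> K1 K2 K3.
transitivity (\sw d1 d' <- D Y X d; \sw w y <- D Y X d1; \sw p q <- D Y X w;
    \sw3 e1 e2 e3 <- D Y X, d'; K p q 1 (y * S Y X e1) e2 e3).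
  apply: tcon_ext => d1 d'; apply: tcon_ext => w y; apply: tcon_ext => p q.
  rewrite -(antipodal_12 y (g := fun z s => \sw3 e1 e2 e3 <- D Y X, d'; K p q z (s * S Y X e1) e2 e3) (anti_Tr G Y X)).
    by apply: tcon_ext => r s; rewrite tcon3_tcon.
  by lin.
rewrite coA; last by lin.
transitivity (\sw p w <- D Y X d; \sw q y <- D Y X w; \sw t u <- D Y X y; K p q 1 1 t u);
  last first.
  by apply: tcon_ext => p w; rewrite [RHS]coA //; lin.
rewrite -[RHS]coA; last by lin.
apply: tcon_ext => w d1.
transitivity (\sw p q <- D Y X w; \sw y d' <- D Y X d1; \sw e1 e' <- D Y X d';
    \sw e2 e3 <- D Y X e'; K p q 1 (y * S Y X e1) e2 e3).
  by rewrite [RHS]tcon_exch.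
apply: tcon_ext => p q.
by rewrite (antipodal_12 d1 (g := fun z e' => \sw e2 e3 <- D Y X e'; K p q 1 z e2 e3) (anti_Sr G Y X)) //; lin.
Qed.

Section Kernel.
Variables (X Y : T) (c : A).

(** The trace at Y with the components of d in six independent slots, so that the cancellations can
    be performed in the slots before anything is said about the trace. *)
Definition kupK (p q r s t u : A) : k^o :=
  Tr2 (fun x y => \sw x1 x2 <- D X Y x; \sw y1 y2 <- D Y Y y;
    braid G Y Y (q * x1) (y2 * s)
      (fun u' v => ptens (S Y X u * (S Y Y (P Y (t * x2)) * u') * (Ti X Y (Ti Y X p) * c))
                         (v * S Y Y (R Y (y1 * r))))).

Lemma kupK_bilin1 r s t u : bilin (fun p q => kupK p q r s t u).
Proof. by apply: bilinI => ?; apply: lin_Tr2 => x y; linb. Qed.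

Lemma kupK_bilin2 p q t u : bilin (fun r s => kupK p q r s t u).
Proof. by apply: bilinI => ?; apply: lin_Tr2 => x y; linb. Qed.

Lemma kupK_bilin3 p q r s : bilin (kupK p q r s).
Proof. by apply: bilinI => ?; apply: lin_Tr2 => x y; linb. Qed.

(** Two trips round the trace: first S^-1(d) goes from the second output to the second input, where
    [kup1_mull] expands it; then one of its components returns from output to input and is expanded
    at Y. *)
Lemma kup1_trace d d' :
  Tr2 (fun x y => kup1 G m n X Y x y d' (fun u v => ptens (u * c) (Ti Y X d * v)))
  = tcon22 (D Y X) d (fun p q r s => \sw3 e1 e2 e3 <- D Y X, d'; \sw s1 s2 <- D Y X s;
      kupK p q (s1 * Ti Y X r) (s2 * S Y X e1) e2 e3).
Proof.
(* Left multiplication on the second output is moved to the second input. *)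
transitivity (Tr2 (fun x y => kup1 G m n X Y x (Ti Y X d * y) d' (fun u v => ptens (u * c) v))).
  pose h x y := kup1 G m n X Y x y d' (fun u v => ptens (u * c) v).
  have hb : bilin h by rewrite /h /kup1; linb.
  rewrite -[RHS](Tr2_mull2 (Ti Y X d) hb); apply: Tr2_ext => x y.
  rewrite /h kup1_lin; last by lin.
  do 4!apply: tcon_ext => ? ?; apply: braid_ext => u v.
  by rewrite tmapE id_lfunE lfunE.
transitivity (tcon22 (D X Y) (Ti Y X d) (fun a1 a2 a3 a4 => Tr2 (fun x y =>
    \sw3 d1 d2 d3 <- D Y X, d'; \sw x1 x2 <- D X Y x; \sw y1 y2 <- D Y X y;
    braid G Y Y (S X Y a3 * x1) (y2 * S Y X d1)
      (fun u v => ptens (S Y X d3 * (S Y Y (P Y (d2 * x2)) * u) * Ti X Y a4 * c)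
                    (v * S Y Y (R Y (y1 * a2)) * S X Y a1))))).
  rewrite /tcon22; transitivity (Tr2 (fun x y => \sw w b <- D X Y (Ti Y X d);
    \sw a1 a2 <- D X Y w; \sw a3 a4 <- D X Y b;
    \sw3 d1 d2 d3 <- D Y X, d'; \sw x1 x2 <- D X Y x; \sw y1 y2 <- D Y X y;
    braid G Y Y (S X Y a3 * x1) (y2 * S Y X d1)
      (fun u v => ptens (S Y X d3 * (S Y Y (P Y (d2 * x2)) * u) * Ti X Y a4 * c)
                    (v * S Y Y (R Y (y1 * a2)) * S X Y a1)))).
    by apply: Tr2_ext => x y; rewrite kup1_mull //; lin.
  rewrite Tr2_sw; apply: tcon_ext => w b; rewrite Tr2_sw; apply: tcon_ext => a1 a2.
  by rewrite Tr2_sw.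
(* The coproduct of S^-1(d) reverses the components of d, so S cancels S^-1 in the slots [q] and
   [s]. *)
rewrite tcon22_T; first last.
- by move=> ? ?; apply: bilinI => ?; apply: lin_Tr2 => ? ?; linb.
- by move=> ? ?; apply: bilinI => ?; apply: lin_Tr2 => ? ?; linb.
apply: tcon_ext => w b; apply: tcon_ext => p q; apply: tcon_ext => r s.
rewrite !cgTK.
pose h x y := \sw3 d1 d2 d3 <- D Y X, d'; \sw x1 x2 <- D X Y x; \sw y1 y2 <- D Y X y;
  braid G Y Y (q * x1) (y2 * S Y X d1)
  (fun u v => ptens (S Y X d3 * (S Y Y (P Y (d2 * x2)) * u) * Ti X Y (Ti Y X p) * c)
                    (v * S Y Y (R Y (y1 * Ti Y X r)))).
have hb : bilin h by rewrite /h; linb.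
(* The factor [s], now rightmost on the second output, is carried to the second input. *)
transitivity (Tr2 (fun x y => tmap \1%VF (amulr s) (h x y))).
  apply: Tr2_ext => x y; rewrite (tcon3_lin (g := tmap _ _)); last by lin.
  apply: tcon3_ext => ? ? ?; rewrite tcon_lfun; apply: tcon_ext => ? ?.
  rewrite tcon_lfun; apply: tcon_ext => ? ?; rewrite braid_lin; last by lin.
  by apply: braid_ext => u v; rewrite tmapE id_lfunE lfunE.
rewrite Tr2_mulr2 //.
transitivity (Tr2 (fun x y => \sw3 e1 e2 e3 <- D Y X, d'; \sw s1 s2 <- D Y X s;
  \sw x1 x2 <- D X Y x; \sw y1 y2 <- D Y Y y;
    braid G Y Y (q * x1) (y2 * (s2 * S Y X e1))
      (fun u' v => ptens (S Y X e3 * (S Y Y (P Y (e2 * x2)) * u') * (Ti X Y (Ti Y X p) * c))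
                         (v * S Y Y (R Y (y1 * (s1 * Ti Y X r))))))); last first.
  rewrite /kupK /tcon3 Tr2_sw; apply: tcon_ext => e1 w'; rewrite Tr2_sw.
  by apply: tcon_ext => e2 e3; rewrite Tr2_sw.
apply: Tr2_ext => x y; rewrite /h.
apply: tcon3_ext => e1 e2 e3; rewrite [RHS]tcon_exch; apply: tcon_ext => x1 x2.
rewrite (@cg_copM k A T G Y Y X); last by linb.
rewrite [RHS]tcon_exch; apply: tcon_ext => y1 y2; apply: tcon_ext => s1 s2.
by rewrite (mulrA y2); apply: braid_ext => u v; rewrite !mulrA.
Qed.

End Kernel.

(** Carrying d to the first input, expanding through Y and cancelling leaves d_1 on the output as
    S^-2(d_1), while the rest acts on the input as z S(u), a counit. *)
Theorem kup_cyclic X Y c d :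
  Tr2 (fun x y => kup G m n X x y (fun u v => ptens (u * (c * d)) v))
  = Tr2 (fun x y => kup G m n Y x y (fun u v => ptens (u * (Ti X Y (Ti Y X d) * c)) v)).
Proof.
transitivity (Tr2 (fun x y => kup G m n X (x * d) y (fun u v => ptens (u * c) v))).
  rewrite -[RHS](@Tr2_mulr1 k A d (fun x y => kup G m n X x y (fun u v => ptens (u * c) v))).
    apply: Tr2_ext => x y; rewrite kup_lin; last by lin.
    by apply: kup_ext => u v; rewrite tmapE id_lfunE lfunE /= mulrA.
  by apply: kup_bilin; lin.
transitivity (\sw d1 d' <- D Y X d;
  Tr2 (fun x y => kup1 G m n X Y x y d' (fun u v => ptens (u * c) (Ti Y X d1 * v)))).
  by rewrite -Tr2_sw; apply: Tr2_ext => x y; rewrite (kup_mulr G m n X Y) //; lin.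
transitivity (\sw p w <- D Y X d; \sw z u <- D Y X w; \sw q t <- D Y X z; kupK X Y c p q 1 1 t u).
  rewrite -(antipodal_collapse X Y d (kupK_bilin1 X Y c) (kupK_bilin2 X Y c) (kupK_bilin3 X Y c)).
 by apply: tcon_ext => d1 d'; rewrite kup1_trace.
pose f (p u v : A) : tens A A := ptens (u * (Ti X Y (Ti Y X p) * c)) v.
pose F (p : A) := Tr2 (fun x y => kup G m n Y x y (f p)).
have fb p : bilin (f p) by rewrite /f; lin.
rewrite -[RHS](counitr_lin G Y X d (f := F)); last first.
  by rewrite /F /f; apply: lin_Tr2 => x y; apply: lin_kupf => u v; lin.
apply: tcon_ext => p w.
transitivity (\sw z u <- D Y X w; Tr2 (fun x y => kup G m n Y (z * S Y X u * x) y (f p)));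
  last first.
  rewrite (antipodal_lin w (f := fun s => Tr2 (fun x y => kup G m n Y (s * x) y (f p))) (anti_Sr G Y X));
    last first.
    apply: lin_Tr2 => x y; apply: (lin_comp (proj1 (kup_bilin G m n Y (fb p)) _)); lin.
  by congr (_ *: _); apply: Tr2_ext => x y; rewrite mul1r.
apply: tcon_ext => z u.
(* In [kupK] the slots [q] and [t] are the two components of [z], so they assemble into the operator
   at Y with input z x; the slot [u] is a left factor of the first output. *)
transitivity (Tr2 (fun x y => tmap (amull (S Y X u)) \1%VF (kup G m n Y (z * x) y (f p)))).
  rewrite /kupK -Tr2_sw; apply: Tr2_ext => x y; rewrite kup_lin; last by lin.
  rewrite /kup (@cg_copM k A T G Y X Y); last by linb.
  apply: tcon_ext => q t; apply: tcon_ext => x1 x2; apply: tcon_ext => y1 y2.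
  rewrite !mulr1; apply: braid_ext => u' v.
  by rewrite /f tmapE id_lfunE lfunE /= !mulrA.
have hb : bilin (fun x y => kup G m n Y (z * x) y (f p)).
  by have [k1 k2] := kup_bilin G m n Y (fb p); apply: bilinI => ?; [apply: (lin_comp (k1 _)) | apply: (lin_comp (k2 _))]; lin.
by rewrite (Tr2_mull1 (S Y X u) hb); apply: Tr2_ext => x y; rewrite mulrA.
Qed.

(** Sum the cyclicity over c (x) d = x_1 (x) S(x_2) for x = 1 in H(X, Y). At X the products c d sum
    to 1; at Y the factor S^-2(d) c is S^-1(x_2) x_1, which also sums to 1. *)
Theorem kup_trace_inv X Y :
  Tr2 (fun x y => kup G m n X x y (@ptens k A A))
  = Tr2 (fun x y => kup G m n Y x y (@ptens k A A)).
Proof.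
pose F Z a := Tr2 (fun x y => kup G m n Z x y (fun u v => ptens (u * a) v)).
have Fl Z : lin (F Z).
  by rewrite /F; apply: lin_Tr2 => x y; apply: lin_kupf => u v; lin.
have F1 Z : Tr2 (fun x y => kup G m n Z x y (@ptens k A A)) = F Z 1.
  by apply: Tr2_ext => x y; apply: kup_ext => u v; rewrite mulr1.
have := antipodal_lin 1 (anti_Sr G X Y) (Fl X).
have := antipodal_lin 1 (anti_Tl G X Y) (Fl Y).
rewrite cg_counit1 !scale1r -!F1 => <- <-.
by apply: tcon_ext => a b; rewrite /F (kup_cyclic X Y) cgSK.
Qed.

End Cyclicity.

(** * Hopf algebras with integrals *)

Lemma tcon_tassoc (k : fieldType) (U V W X : vectType k) (f : U -> V -> W -> X) t :
  trilin f ->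
  tcon (tassoc U V W t) (fun a s => tcon s (f a)) = \sw s c <- t; \sw a b <- s; f a b c.
Proof.
move=> fl; rewrite -[tassoc _ _ _ t]/(\sw s c <- t; \sw a b <- s; ptens a (ptens b c)).
rewrite tcon_tcon; apply: tcon_ext => s c; rewrite tcon_tcon; apply: tcon_ext => a b.
by rewrite !tcon_ptens //; lin.
Qed.

Section HopfAlgebra.
Variables (k : fieldType) (H : hopfAlgebra k).
Implicit Types (x y : H) (U : vectType k).
Local Notation D := (cop H).
Local Notation e x := (counit H x : k).
Local Notation S := (antipode H).

Lemma hopf_coA x U (f : H -> H -> H -> U) : trilin f ->
  (\sw a b <- D x; \sw c d <- D a; f c d b) = (\sw a b <- D x; \sw c d <- D b; f a c d).
Proof.
move=> fl; have := congr1 (fun t => tcon t (fun a s => tcon s (f a))) (copA x).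
rewrite /= tcon_tassoc // !tcon_tmap; [|by lin..] => E.
transitivity (\sw v w <- D x; \sw a b <- D v; f a b ((\1%VF : 'End(H)) w)).
  by do 2!apply: tcon_ext => ? ?; rewrite id_lfunE.
by rewrite E; apply: tcon_ext => a b; rewrite id_lfunE.
Qed.

Lemma hopf_counitl x : (\sw a b <- D x; e a *: b) = x.
Proof.
rewrite -[RHS]cop_counitl -[tunitl _ _]/(tcon _ _) tcon_tmap; last by lin.
by apply: tcon_ext => a b; rewrite id_lfunE.
Qed.

Lemma hopf_counitr x : (\sw a b <- D x; e b *: a) = x.
Proof.
rewrite -[RHS]cop_counitr -[tunitr _ _]/(tcon _ _) tcon_tmap; last by lin.
by apply: tcon_ext => a b; rewrite id_lfunE.
Qed.

Lemma tcon_tmul (A : falgType k) (s t : tens A A) U (f : A -> A -> U) : bilin f ->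
  tcon (tmul s t) f = \sw a b <- s; \sw c d <- t; f (a * c) (b * d).
Proof.
move=> fb; rewrite /tmul -/(tcon s _) tcon_tcon; apply: tcon_ext => a b.
rewrite -/(tcon t _) tcon_tcon; apply: tcon_ext => c d.
by rewrite tcon_ptens.
Qed.

Lemma hopf_copM x y U (f : H -> H -> U) : bilin f ->
  tcon (D (x * y)) f = \sw a b <- D x; \sw c d <- D y; f (a * c) (b * d).
Proof. by move=> fb; rewrite copM tcon_tmul. Qed.

Lemma hopf_antil x : (\sw a b <- D x; S a * b) = e x *: 1.
Proof. exact: antipodel. Qed.

Lemma hopf_antir x : (\sw a b <- D x; a * S b) = e x *: 1.
Proof. exact: antipoder. Qed.

(** Insert S(x_1) x_2 on the first leg; x_2 L_1 (x) x_3 L_2 is the coproduct of a multiple of L. *)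
Lemma left_integral_shift (L : H) x U (f : H -> H -> U) : left_integral L -> bilin f ->
  (\sw a b <- D L; f a (x * b)) = \sw a b <- D L; f (S x * a) b.
Proof.
move=> iL fb; have iLE y : y * L = e y *: L by exact: iL.
transitivity (\sw x1 x' <- D x; \sw x2 x3 <- D x'; \sw a b <- D L;
  f (S x1 * x2 * a) (x3 * b)).
  rewrite -hopf_coA; last by split=> ? ?; lin.
  rewrite -{1}(hopf_counitl x) (tcon_lin (g := fun y => \sw a b <- D L; f a (y * b))); last by lin.
  apply: tcon_ext => y x3.
  rewrite -(tcon_lin (g := fun z => \sw a b <- D L; f (z * a) (x3 * b))); last by lin.
  rewrite hopf_antil (linZ (f := fun z => \sw a b <- D L; f (z * a) (x3 * b))); last by lin.
  rewrite (linZ (f := fun y => \sw a b <- D L; f a (y * b))); last by lin.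
  by congr (_ *: _); apply: tcon_ext => a b; rewrite mul1r.
rewrite -{2}(hopf_counitr x) (tcon_lin (g := fun z => \sw a b <- D L; f (S z * a) b)); last by lin.
apply: tcon_ext => x1 x'.
rewrite (linZ (f := fun z => \sw a b <- D L; f (S z * a) b)); last by lin.
transitivity (tcon (D (x' * L)) (fun p q => f (S x1 * p) q)).
  rewrite hopf_copM; last by lin.
  by do 2!apply: tcon_ext => ? ?; rewrite mulrA.
by rewrite iLE (linZ (f := fun z => tcon (D z) (fun p q => f (S x1 * p) q))) //; lin.
Qed.

(** Contracting the first leg of [left_integral_shift] with lam returns x on one side, while the
    other side depends only on S(x). By finite dimension S is then bijective. *)
Lemma antipode_inj (I : integrals H) : injective S.
Proof.
suff S0 x : S x = 0 -> x = 0.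
  by move=> x y Sxy; apply/subr0_eq/S0; rewrite linearB /= Sxy subrr.
move=> Sx0; have := @left_integral_shift (Lam I) x H (fun a b => (lam I a : k) *: b) (Lam_integral I).
have -> : (\sw a b <- D (Lam I); (lam I a : k) *: (x * b)) = x.
  rewrite -[RHS]mulr1 -[X in _ = x * X](scale1r 1) -[X in X *: 1](lam_Lam I).
  rewrite -(lam_integral I) -/(tcon _ _) (tcon_lin (g := fun z => x * z)); last by lin.
  by apply: tcon_ext => a b; rewrite scalerAr.
move=> ->; last by lin.
rewrite Sx0.
transitivity (\sw a b <- D (Lam I); (0 : H)).
  by apply: tcon_ext => a b; rewrite mul0r linear0 scale0r.
by rewrite tconS !big1 // => i _; rewrite big1 // => j _; rewrite scaler0.
Qed.

Definition antipode_inv : 'End(H) := (S^-1)%VF.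

Variable I : integrals H.

Lemma antipodeK x : antipode_inv (S x) = x.
Proof. by apply: lker0_lfunK; apply/lker0P; apply: antipode_inj I. Qed.

Lemma antipode_invK x : S (antipode_inv x) = x.
Proof. by apply: lker0_lfunVK; apply/lker0P; apply: antipode_inj I. Qed.

Definition hopf_cogroupoid : cogroupoid H unit :=
  @Cogroupoid k H unit (fun _ _ => D) (counit H) (fun _ _ => S) (fun _ _ => antipode_inv)
   (fun _ _ => hopf_coA) (fun _ _ => hopf_counitl) (fun _ _ => hopf_counitr)
   (fun _ _ _ => hopf_copM) (fun _ => cop1 H) (counit1 H) (@counitM k H)
   (fun _ _ => hopf_antil) (fun _ _ => hopf_antir)
   (fun _ _ => antipode_invK) (fun _ _ => antipodeK).

Local Notation G := hopf_cogroupoid.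
Local Notation Ti := antipode_inv.
Local Notation L := (Lam I).
Local Notation l x := (lam I x : k).

Lemma antiM x y : S (x * y) = S y * S x.
Proof. exact: (cgSM G tt tt tt). Qed.

Lemma antiinvM x y : Ti (x * y) = Ti y * Ti x.
Proof. exact: (cgTM G tt tt tt). Qed.

Lemma antipode1 : S 1 = 1.
Proof. exact: (cgS1 G tt). Qed.

Lemma antipode_inv1 : Ti 1 = 1.
Proof. exact: (cgT1 G tt). Qed.

Lemma counit_antipode x : e (S x) = e x.
Proof. exact: (counitS G tt tt). Qed.

Lemma cop_antipode x U (f : H -> H -> U) : bilin f ->
  tcon (D (S x)) f = \sw a b <- D x; f (S b) (S a).
Proof. exact: (@copS _ _ _ G tt tt). Qed.

Lemma lam_integralE h : (\sw a b <- D h; l a *: b) = l h *: 1.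
Proof. exact: lam_integral. Qed.

Lemma glE h : (\sw a b <- D h; l b *: a) = l h *: gl I.
Proof. exact: glP. Qed.

Lemma Lam_integralE h : h * L = e h *: L.
Proof. exact: Lam_integral. Qed.

Lemma Lam_shift x U (f : H -> H -> U) : bilin f ->
  (\sw a b <- D L; f (x * a) b) = \sw a b <- D L; f a (Ti x * b).
Proof.
move=> fb; rewrite left_integral_shift //; last exact: Lam_integral.
by rewrite antipode_invK.
Qed.

(** Shift x to the first leg; what remains is the definition of the distinguished grouplike
    evaluated at L. *)
Lemma Lam_lam2 x : (\sw a b <- D L; l (x * b) *: a) = S x * gl I.
Proof.
have := @Lam_shift (S x) H (fun a b => l b *: a); rewrite antipodeK => <-; last by lin.
rewrite -[gl I in RHS]scale1r -(lam_Lam I) -glE.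
rewrite (tcon_lin (g := fun z => S x * z)); last by lin.
by apply: tcon_ext => a b; rewrite scalerAr.
Qed.

Lemma Lam_antipode h U (f : H -> H -> U) : bilin f ->
  (\sw a b <- D L; f (h * a) (S b)) = \sw a b <- D L; f a (S b * h).
Proof.
move=> fb; rewrite (@Lam_shift h U (fun a b => f a (S b))); last by lin.
by apply: tcon_ext => a b; rewrite antiM antipode_invK.
Qed.

Lemma lamS_integral h : (\sw a b <- D h; l (S b) *: a) = l (S h) *: 1.
Proof.
have := congr1 Ti (lam_integralE (S h)); rewrite cop_antipode; last by lin.
rewrite tcon_lfun lfunZ antipode_inv1 => <-.
by apply: tcon_ext => a b; rewrite lfunZ antipodeK.
Qed.

(** The map sending x to L_1 lam(S(L_2) x) is multiplication by the scalar lam(S L), and it fixes L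
    because S(L_2) L = e(L_2) L. *)
Lemma lamS_Lam : l (S L) = 1.
Proof.
have E x : (\sw a b <- D L; l (S b * x) *: a) = l (S L) *: x.
  rewrite -(@Lam_antipode x H (fun a b => l b *: a)); last by lin.
  rewrite -[x in RHS]mulr1 scalerAr -lamS_integral.
  rewrite (tcon_lin (g := fun z => x * z)); last by lin.
  by apply: tcon_ext => a b; rewrite scalerAr.
have EL : (\sw a b <- D L; l (S b * L) *: a) = L.
  rewrite -[RHS](hopf_counitr L); apply: tcon_ext => a b.
  by rewrite Lam_integralE counit_antipode functZ lam_Lam mulr1.
by have := congr1 (lam I) (E L); rewrite EL functZ lam_Lam mulr1.
Qed.

(** L_1 and lam(S(L_2) -) are dual bases of H; every later computation with integrals rests on
    this. *)
Lemma Frobenius x : (\sw a b <- D L; l (S b * x) *: a) = x.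
Proof.
rewrite -(@Lam_antipode x H (fun a b => l b *: a)); last by lin.
rewrite -[x in RHS]mulr1 -[1 in RHS]scale1r -lamS_Lam -lamS_integral.
rewrite (tcon_lin (g := fun z => x * z)); last by lin.
by apply: tcon_ext => a b; rewrite scalerAr.
Qed.

(** Expand L_2 in the dual bases of a second copy of L; the first copy is then contracted by
    [Lam_lam2]. *)
Lemma Lam_rotate U (f : H -> H -> U) : bilin f ->
  (\sw a b <- D L; f b a) = \sw c d <- D L; f c (S (S d) * gl I).
Proof.
move=> fb.
transitivity (\sw a b <- D L; \sw c d <- D L; l (S d * b) *: f c a).
  apply: tcon_ext => a b; rewrite -{1}(Frobenius b) (tcon_lin (g := fun z => f z a)); last by lin.
  by apply: tcon_ext => c d; rewrite (linZ (f := fun z => f z a)) //; lin.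
rewrite tcon_exch; apply: tcon_ext => c d.
rewrite -Lam_lam2 (tcon_lin (g := f c)); last by lin.
by apply: tcon_ext => a b; rewrite (linZ (f := f c)) //; lin.
Qed.

Lemma left_integral_uniq M : left_integral M -> M = l M *: L.
Proof.
move=> iM; have iME h : h * M = e h *: M by exact: iM.
rewrite -[LHS](Frobenius M) -[in RHS](hopf_counitr L).
rewrite (tcon_lin (g := fun z => l M *: z)); last by lin.
apply: tcon_ext => a b.
by rewrite iME functZ counit_antipode scalerA mulrC.
Qed.

(** The shift gives mu(x L_1) L_2 = mu(L) S^-1(x); applying lam after S and recognising the dual
    basis expansion of 1 gives the claim. *)
Lemma right_integral_uniq (mu : 'Hom(H, k^o)) x :
  right_integral mu -> mu x = (mu L : k) * l x :> k.
Proof.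
move=> imu; have muE h : (\sw a b <- D h; (mu a : k) *: b) = (mu h : k) *: 1 by exact: imu.
have E : (\sw a b <- D L; (mu (x * a) : k) *: b) = (mu L : k) *: Ti x.
  rewrite (@Lam_shift x H (fun a b => (mu a : k) *: b)); last by lin.
  rewrite -[Ti x in RHS]mulr1 scalerAr -muE (tcon_lin (g := fun z => Ti x * z)); last by lin.
  by apply: tcon_ext => a b; rewrite scalerAr.
rewrite -[X in mu X](mulr1 x) -(Frobenius 1) (tcon_lin (g := fun z => mu (x * z))); last by lin.
transitivity ((mu L : k) * l (S (Ti x))); last by rewrite antipode_invK.
rewrite -functZ -lfunZ -E 2!tcon_lfun.
apply: (@tcon_ext k H H k^o) => a b.
by rewrite falg_scaler !(functZ, lfunZ) mulr1 mulrC.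
Qed.

Local Notation g := (gl I).

Lemma glL : (\sw a b <- D L; l b *: a) = g.
Proof. by rewrite glE lam_Lam scale1r. Qed.

Lemma counit_gl : e g = 1.
Proof.
rewrite -glL tcon_lfun -[RHS](lam_Lam I) -[in RHS](hopf_counitl L) tcon_lfun.
by apply: (@tcon_ext k H H k^o) => a b; rewrite !functZ mulrC.
Qed.

Lemma cop_gl U (f : H -> H -> U) : bilin f -> tcon (D g) f = f g g.
Proof.
move=> fb; rewrite -{1}glL (tcon_lin (g := fun z => tcon (D z) f)); last by lin.
transitivity (\sw a b <- D L; \sw c d <- D a; l b *: f c d).
  apply: tcon_ext => a b; rewrite (linZ (f := fun z => tcon (D z) f)); last by lin.
  by rewrite (tcon_lin (g := fun z => _ *: z)) //; lin.
rewrite hopf_coA; last by lin.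
transitivity (f (\sw a b <- D L; l b *: a) g); last by rewrite glL.
rewrite (tcon_lin (g := fun z => f z g)); last by lin.
apply: tcon_ext => a b; rewrite (linZ (f := fun z => f z g)); last by lin.
transitivity (f a (\sw c d <- D b; l d *: c)); last first.
  by rewrite glE (linZ (f := f a)) //; lin.
rewrite (tcon_lin (g := f a)); last by lin.
by apply: tcon_ext => c d; rewrite (linZ (f := f a)) //; lin.
Qed.

Lemma glS : g * S g = 1.
Proof.
have := hopf_antir g; rewrite cop_gl; last by lin.
by rewrite counit_gl scale1r.
Qed.

Lemma counit_antipode_inv x : e (Ti x) = e x.
Proof. by rewrite -[in RHS](antipode_invK x) counit_antipode. Qed.

(** The left side is a right integral in z and takes the value 1 at L, so uniqueness applies. *)
Lemma lam_antipode_gl z : l (S z * g) = l z.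
Proof.
pose mu : 'Hom(H, k^o) := linfun (fun z => lam I (S z * g) : k^o).
have muE x : mu x = lam I (S x * g) by rewrite linfE //; lin.
have mui : right_integral mu.
  move=> h; change ((\sw a b <- D h; (mu a : k) *: b) = (mu h : k) *: 1).
  apply: (antipode_inj I); rewrite lfunZ antipode1.
  rewrite -[LHS]mulr1 -glS mulrA -[RHS]mul1r.
  have -> : S (\sw a b <- D h; (mu a : k) *: b) * g = (mu h : k) *: g.
    rewrite muE -glE hopf_copM; last by lin.
    rewrite cop_antipode; last by lin.
    rewrite tcon_lfun (tcon_lin (g := fun z => z * g)); last by lin.
    apply: tcon_ext => a b; rewrite cop_gl; last by lin.
    by rewrite lfunZ falg_scalel muE.
  by rewrite falg_scalel glS mul1r.
rewrite -muE (right_integral_uniq _ mui) muE.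
suff -> : S L * g = S L by rewrite lamS_Lam mul1r.
rewrite -{1}(antipode_invK g) -antiM Lam_integralE counit_antipode_inv counit_gl.
by rewrite scale1r.
Qed.

Lemma lamh1E W : lam_half I 1 W = l (Ti W).
Proof.
rewrite /lam_half -[gl I ^ 1]/(gl I) -[in LHS](antipode_invK W).
exact: lam_antipode_gl.
Qed.

Local Notation al x := (alpha I x : k).

Lemma alphaE h : L * h = al h *: L.
Proof. exact: alphaP. Qed.

Lemma alphaM x y : al (x * y) = al x * al y.
Proof.
have E h : al h = l (L * h) by rewrite alphaE functZ lam_Lam mulr1.
by rewrite [in LHS]E mulrA alphaE falg_scalel functZ -E.
Qed.

Lemma alpha1 : al 1 = 1.
Proof. by have := congr1 (lam I) (alphaE 1); rewrite mulr1 functZ lam_Lam mulr1. Qed.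

(** Both sides are convolution inverses of the character alpha. *)
Lemma alpha_antipode x : al (S x) = al (Ti x).
Proof.
transitivity (\sw a b <- D x; \sw c d <- D b; (al (S a * c) * al (Ti d) : k^o)).
  transitivity (\sw a b <- D x; \sw c d <- D b; (al (S a) * al (Ti d * c) : k^o)).
    rewrite (@antipodal_23 _ _ _ G tt tt (fun c d => Ti d * c) x k^o (fun a b => al (S a) * al b)) ?alpha1 ?mulr1 //.
      exact: (anti_Tl G tt tt).
    by lin.
  by do 2!apply: (@tcon_ext k H H k^o) => ? ?; rewrite !alphaM -mulrA [al _ * al (Ti _)]mulrC.
rewrite (@antipodal_12 _ _ _ G tt tt (fun c d => S c * d) x k^o (fun a b => al a * al (Ti b))) ?alpha1 ?mul1r //.
  exact: (anti_Sl G tt tt).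
by lin.
Qed.

Lemma conv_expzN1 x : conv_expz (alpha I) (-1) x = al (S x).
Proof.
rewrite -[LHS]/(conv (alpha I \o antipode H) (counit H) x).
rewrite -[RHS](counitr_lin G tt tt x (U := k^o) (f := fun a => alpha I (S a))); last by lin.
by apply: (@tcon_ext k H H k^o) => a b; rewrite mulrC.
Qed.

(** Twisting S(L) by the inverse of alpha gives a left integral on which lam is 1, hence L. *)
Lemma Lamh1E : Lam_half I 1 = L.
Proof.
have -> : Lam_half I 1 = \sw a b <- D (S L); al (S b) *: a.
  rewrite /Lam_half /hitl -/(tcon _ _); apply: tcon_ext => a b.
  by rewrite -[(- 1)%R]/(-1) conv_expzN1.
set L' := \sw a b <- _; _.
have lL' : l L' = 1.
  rewrite tcon_lfun.
  transitivity (al (S (\sw a b <- D (S L); l a *: b))).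
    rewrite !tcon_lfun; apply: (@tcon_ext k H H k^o) => a b.
    by rewrite functZ lfunZ functZ mulrC.
  by rewrite lam_integralE lfunZ functZ antipode1 alpha1 lamS_Lam mulr1.
suff iL' : left_integral L' by rewrite (left_integral_uniq iL') lL' scale1r.
(* S(L) is only an eigenvector for left multiplication; the twist by alpha composed with S
   compensates its character. *)
have hR h : h * S L = al (Ti h) *: S L.
  by rewrite -{1}(antipode_invK h) -antiM alphaE lfunZ.
move=> h; rewrite -[RHS]/(e h *: L').
transitivity (\sw h1 h' <- D h; \sw h2 h3 <- D h'; \sw a b <- D (S L);
  (al (S (h2 * b)) * al h3) *: (h1 * a)).
  transitivity (\sw h1 h' <- D h; \sw h2 h3 <- D h'; \sw a b <- D (S L);
    (al (S h2 * h3) * al (S b)) *: (h1 * a)); last first.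
    do 3!apply: tcon_ext => ? ?; rewrite antiM !alphaM; congr (_ *: _).
    by rewrite [LHS]mulrC mulrA.
  rewrite (@antipodal_23 _ _ _ G tt tt (fun c d => S c * d) h H (fun u v => \sw a b <- D (S L);
    (al v * al (S b)) *: (u * a)) (anti_Sl G tt tt)); last by lin.
  rewrite (tcon_lin (g := fun z => h * z)); last by lin.
  by apply: tcon_ext => a b; rewrite alpha1 mul1r falg_scaler.
transitivity (\sw z h3 <- D h; (al (S z) * al h3) *: L').
  transitivity (\sw z h3 <- D h; tcon (D (z * S L)) (fun p q => (al (S q) * al h3) *: p));
    last first.
    apply: tcon_ext => z h3; rewrite hR.
    rewrite (linZ (f := fun v => tcon (D v) (fun p q => (al (S q) * al h3) *: p))); last by lin.
    rewrite alpha_antipode -scalerA; congr (_ *: _).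
    rewrite /L' (tcon_lin (g := fun v => al h3 *: v)); last by lin.
    by apply: tcon_ext => p q; rewrite scalerA mulrC.
  transitivity (\sw z h3 <- D h; \sw h1 h2 <- D z; \sw a b <- D (S L);
     (al (S (h2 * b)) * al h3) *: (h1 * a)); last first.
    by apply: tcon_ext => z h3; rewrite hopf_copM //; lin.
  by rewrite hopf_coA //; lin.
transitivity (\sw z h3 <- D h; al (S z * h3) *: L').
  by apply: tcon_ext => z h3; rewrite alphaM.
rewrite (@antipodal_lin _ _ _ G tt tt (fun c d => S c * d) h H (fun u => al u *: L') (anti_Sl G tt tt)).
  by rewrite alpha1 scale1r.
by lin.
Qed.

(** Expanding both inputs in the dual bases of [Frobenius] writes f as a sum of rank one maps. *)
Lemma tr_Lam (f : 'End(tens H H)) :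
  tr_lfun f = \sw a a' <- D L; \sw b b' <- D L;
    @tcon k H H k^o (f (ptens a b)) (fun u v => l (S a' * u) * l (S b' * v)).
Proof.
pose phi (a' b' : H) : 'Hom(tens H H, k^o) := @tlift k H H k^o (fun u v => l (S a' * u) * l (S b' * v)).
pose r (a a' b b' : H) : 'End(tens H H) := linfun (fun t => (phi a' b' t : k) *: f (ptens a b)).
have rE a a' b b' t : r a a' b b' t = (phi a' b' t : k) *: f (ptens a b).
  by rewrite linfE //; lin.
have fE : f = \sw a a' <- D L; \sw b b' <- D L; r a a' b b'.
  apply: tens_ext => x y.
  rewrite (tcon_lin (g := fun F : 'End(tens H H) => F (ptens x y))); last by lin.
  transitivity (\sw a a' <- D L; \sw b b' <- D L; (l (S a' * x) * l (S b' * y)) *: f (ptens a b));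
    last first.
    apply: tcon_ext => a a'.
    rewrite (tcon_lin (g := fun F : 'End(tens H H) => F (ptens x y))); last by lin.
    apply: tcon_ext => b b'; rewrite rE /phi -/(tcon _ _) tcon_ptens //.
    by lin.
  rewrite -{1}(Frobenius x) (tcon_lin (g := fun z => f (ptens z y))); last by lin.
  apply: tcon_ext => a a'.
  rewrite -{1}(Frobenius y) (tcon_lin (g := fun z => f (ptens _ z))); last by lin.
  apply: tcon_ext => b b'; rewrite (linZ (f := fun z => f (ptens _ z))); last by lin.
  rewrite (linZ (f := fun z => f (ptens z _))); last by lin.
  by rewrite scalerA mulrC.
rewrite [in LHS]fE (@tcon_lin k _ _ _ k^o (@tr_lfun k _)); last exact: lin_tr.
apply: (@tcon_ext k H H k^o) => a a'.
rewrite (@tcon_lin k _ _ _ k^o (@tr_lfun k _)); last exact: lin_tr.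
apply: (@tcon_ext k H H k^o) => b b'.
exact: (tr_rank1 (phi a' b') (f (ptens a b))).
Qed.

End HopfAlgebra.

(** * The trace and the integral formula as one Sweedler sum *)

Section Formulas.
Variables (k : fieldType) (H : hopfAlgebra k) (I : integrals H).
Implicit Types (x y : H) (U : vectType k).
Local Notation D := (cop H).
Local Notation e x := (counit H x : k).
Local Notation S := (antipode H).
Local Notation G := (hopf_cogroupoid I).
Local Notation Ti := (antipode_inv H).
Local Notation L := (Lam I).
Local Notation l x := (lam I x : k).
Local Notation P := (cgP G tt).

Lemma sweedlerSS U n x (f : seq H -> U) :
  sweedler n.+2 x f = \sw a b <- D x; sweedler n.+1 b (fun s => f (a :: s)).
Proof. by []. Qed.

Lemma sweedler1E U x (f : seq H -> U) : sweedler 1 x f = f [:: x].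
Proof. by []. Qed.

Lemma sweedler_ext U n x (f g : seq H -> U) : (forall s, size s = n -> f s = g s) ->
  sweedler n x f = sweedler n x g.
Proof.
case: n => [|n] in x f g *; first by move=> fg; rewrite /= fg.
elim: n => [|n IHn] in x f g * => fg; first by rewrite /= fg.
rewrite !sweedlerSS; apply: tcon_ext => a b.
by apply: IHn => s sz; apply: fg; rewrite /= sz.
Qed.

Lemma sweedler_lin U (V : vectType k) (g : U -> V) n x (f : seq H -> U) : lin g ->
  g (sweedler n x f) = sweedler n x (fun s => g (f s)).
Proof.
move=> gl; case: n => [|n] in x f *; first by rewrite /= (linZ gl).
elim: n => [|n IHn] in x f * => //.
by rewrite !sweedlerSS (tcon_lin _ _ gl); apply: tcon_ext => a b; rewrite IHn.
Qed.

Lemma spowE n x : spow n x = P n x.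
Proof.
elim: n => [|n IHn] in x *; first by rewrite cgP0E /spow /= big_nil.
rewrite cgPSE; case: n IHn => [|n] IHn.
  have -> : spow 1 x = x by rewrite /spow /= big_seq1.
  rewrite -[LHS](counitr_lin G tt tt x (f := fun a => a)); last by lin.
  by apply: tcon_ext => a b; rewrite cgP0E falg_scaler mulr1.
rewrite /spow sweedlerSS; apply: tcon_ext => a b.
rewrite -IHn (sweedler_lin (g := fun z => a * z)); last by lin.
by apply: sweedler_ext => s _; rewrite big_cons.
Qed.

Lemma cgPSr n x U (f : H -> U) : lin f ->
  f (P n.+1 x) = \sw a b <- D x; f (P n a * b).
Proof.
move=> fl; have := cgP_equiv G tt tt n x 1 fl; rewrite /= => E.
rewrite cgPSE (tcon_lin _ _ fl).
transitivity (\sw a b <- D x; f (P n (a * 1) * b)).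
  by rewrite -E; apply: tcon_ext => a b; rewrite mul1r.
by apply: tcon_ext => a b; rewrite mulr1.
Qed.

(* The comultiplication of x into five factors, bracketed as (1 2 3 4) 5. *)
Definition comb5 x U (f : H -> H -> H -> H -> H -> U) : U :=
  \sw a a5 <- D x; \sw a1 r <- D a; \sw a2 r' <- D r; \sw a3 a4 <- D r'; f a1 a2 a3 a4 a5.

Lemma comb5_tcon (V W : vectType k) (t : tens V W) x U
    (f : V -> W -> H -> H -> H -> H -> H -> U) :
  (\sw p q <- t; comb5 x (f p q))
  = comb5 x (fun a b c d z => \sw p q <- t; f p q a b c d z).
Proof.
by rewrite /comb5; do 4!(rewrite tcon_exch; apply: tcon_ext => ? ?).
Qed.

Lemma comb5R x U (f : H -> H -> H -> H -> H -> U) :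
  (forall a b c, bilin (f a b c)) -> (forall c d z, bilin (fun a b => f a b c d z)) ->
  (forall a b d z, lin (fun c => f a b c d z)) ->
  comb5 x f = \sw a1 r <- D x; \sw a2 r' <- D r; \sw a3 r'' <- D r'; \sw a4 a5 <- D r''; f a1 a2 a3 a4 a5.
Proof.
move=> f1 f2 f3; rewrite /comb5 (@hopf_coA k H x U (fun a1 r a5 =>
  \sw a2 r' <- D r; \sw a3 a4 <- D r'; f a1 a2 a3 a4 a5)); last by split=> ? ?; lin.
apply: tcon_ext => a1 r; rewrite (@hopf_coA k H r U (fun a2 r' a5 =>
  \sw a3 a4 <- D r'; f a1 a2 a3 a4 a5)); last by split=> ? ?; lin.
by apply: tcon_ext => a2 r'; rewrite (@hopf_coA k H r' U (fun a3 a4 a5 => f a1 a2 a3 a4 a5)) //; split=> ? ?; lin.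
Qed.

Variables m n : nat.

(** Summand of [kupE]. The Sweedler power of index m+1 in the integral formula appears here cut into
    P^m(a4) and a5. *)
Definition kupQ (a1 a2 a3 a4 a5 b1 b2 b3 b4 b5 : H) : k^o :=
  l (S (Ti (Ti b4) * Ti a2 * b2 * P m a4 * a5))
  * l (S (P n b1 * a3 * Ti b3 * Ti (Ti a1) * b5)).

Definition kupE : k^o := comb5 L (fun a1 a2 a3 a4 a5 =>
  comb5 L (fun b1 b2 b3 b4 b5 => kupQ a1 a2 a3 a4 a5 b1 b2 b3 b4 b5)).

Lemma integral_formulaE : integral_formula I m.+1 n.+1 = kupE.
Proof.
rewrite /kupE comb5R; first last.
- by move=> *; rewrite /comb5 /kupQ; lin.
- by move=> *; rewrite /comb5 /kupQ; lin.
- by move=> *; rewrite /comb5 /kupQ; lin.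
rewrite /integral_formula sweedlerSS; apply: (@tcon_ext k H H k^o) => a1 r.
rewrite sweedlerSS; apply: (@tcon_ext k H H k^o) => a2 r'.
rewrite sweedlerSS; apply: (@tcon_ext k H H k^o) => a3 a4.
transitivity (\sw b1 v <- D L; \sw b2 v' <- D v; \sw b3 v'' <- D v'; \sw b4 b5 <- D v'';
  \sw p q <- D a4; kupQ a1 a2 a3 p q b1 b2 b3 b4 b5).
  rewrite sweedler1E.
  rewrite sweedlerSS; apply: (@tcon_ext k H H k^o) => b1 v.
  rewrite sweedlerSS; apply: (@tcon_ext k H H k^o) => b2 v'.
  rewrite sweedlerSS; apply: (@tcon_ext k H H k^o) => b3 v''.
  rewrite sweedlerSS; apply: (@tcon_ext k H H k^o) => b4 b5; rewrite sweedler1E.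
  transitivity (l (S (Ti (Ti b4) * Ti a2 * b2 * spow m.+1 a4))
    * l (S (spow n b1 * a3 * Ti b3 * Ti (Ti a1) * b5))).
    by rewrite subn1.
  rewrite !spowE.
  rewrite /kupQ -(@tcon_lin k _ _ _ k^o (fun z : k^o => z * _ : k^o)); last by lin.
  congr (_ * _).
  rewrite (@cgPSr m a4 k^o (fun z => lam I (S (Ti (Ti b4) * Ti a2 * b2 * z)))); last by lin.
  by apply: (@tcon_ext k H H k^o) => p q; rewrite !mulrA.
rewrite comb5_tcon comb5R //; by move=> *; rewrite /kupQ; lin.
Qed.

Lemma Psi_kup x y :
  tmap S S (Psi H m.+1 n.+1 (ptens x y)) = kup G m n tt x y (@ptens k H H).
Proof.
pose body (x y : H) : tens H H := \sw a1 r <- D x; \sw a2 r' <- D r; \sw a3 a4 <- D r';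
  \sw b1 v <- D y; \sw b2 v' <- D v; \sw b3 b4 <- D v';
  ptens (Ti (Ti b4) * Ti a2 * b2 * P m a4) (P n b1 * a3 * Ti b3 * Ti (Ti a1)).
have -> : Psi H m.+1 n.+1 = tlift body.
  apply/lfunP => t; apply: tcon_ext => x' y'; rewrite /body.
  rewrite sweedlerSS; apply: tcon_ext => a1 r.
  rewrite sweedlerSS; apply: tcon_ext => a2 r'.
  rewrite sweedlerSS; apply: tcon_ext => a3 a4; rewrite sweedler1E.
  rewrite sweedlerSS; apply: tcon_ext => b1 v.
  rewrite sweedlerSS; apply: tcon_ext => b2 v'.
  rewrite sweedlerSS; apply: tcon_ext => b3 b4; rewrite sweedler1E.
  by rewrite !subn1 /= !spowE.
rewrite tliftE; last by rewrite /body; lin.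
rewrite tcon_lfun /kup.
transitivity (\sw x1 x2 <- D x; \sw a1 r <- D x1; \sw a2 a3 <- D r; \sw b1 v <- D y;
  \sw b2 v' <- D v; \sw b3 b4 <- D v';
  ptens (S (P m x2) * (S b2 * a2 * Ti b4)) (Ti a1 * b3 * S a3 * S (P n b1))); last first.
  apply: tcon_ext => x1 x2; rewrite [RHS]tcon_exch; apply: tcon_ext => a1 r.
  rewrite [RHS]tcon_exch; apply: tcon_ext => a2 a3.
  by do 3!apply: tcon_ext => ? ?.
rewrite (@hopf_coA k H x _ (fun a1 r x2 => \sw a2 a3 <- D r; \sw b1 v <- D y;
  \sw b2 v' <- D v; \sw b3 b4 <- D v';
  ptens (S (P m x2) * (S b2 * a2 * Ti b4)) (Ti a1 * b3 * S a3 * S (P n b1))));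
    last by split=> ? ?; lin.
apply: tcon_ext => a1 r; rewrite tcon_lfun.
rewrite (@hopf_coA k H r _ (fun a2 a3 x2 => \sw b1 v <- D y;
  \sw b2 v' <- D v; \sw b3 b4 <- D v';
  ptens (S (P m x2) * (S b2 * a2 * Ti b4)) (Ti a1 * b3 * S a3 * S (P n b1))));
    last by split=> ? ?; lin.
apply: tcon_ext => a2 r'; rewrite tcon_lfun; apply: tcon_ext => a3 a4.
do 3!(rewrite tcon_lfun; apply: tcon_ext => ? ?).
by rewrite tmapE !(antiM I) !(antipode_invK I) !mulrA.
Qed.

Lemma tr_Psi : tr_lfun (tmap S S \o Psi H m.+1 n.+1)%VF
  = Tr2 (fun x y => kup G m n tt x y (@ptens k H H)).
Proof.
congr tr_lfun; apply: tens_ext => x y; rewrite comp_lfunE Psi_kup tliftE //.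
by apply: kup_bilin; lin.
Qed.

(** [tr_Lam] multiplies the outputs on the left by S(a5) and S(b5). As the outputs are values of S,
    these become the last factors inside S, and coassociativity matches the brackets. *)
Lemma kup_kupE : Tr2 (fun x y => kup G m n tt x y (@ptens k H H)) = kupE.
Proof.
rewrite -tr_Psi (tr_Lam I).
transitivity (\sw a a5 <- D L; \sw b b5 <- D L; kup G m n tt a b (U := k^o) (fun u v =>
  l (S a5 * u) * l (S b5 * v))).
  do 2!apply: (@tcon_ext k H H k^o) => ? ?; rewrite comp_lfunE Psi_kup.
  rewrite (@kup_lin _ _ _ _ _ _ _ _ _ _ k^o (fun t => tcon t _)); last by lin.
  by apply: kup_ext => u v; rewrite tcon_ptens //; lin.
apply: (@tcon_ext k H H k^o) => a a5.
transitivity (\sw x1 a4 <- D a; \sw a1 r <- D x1; \sw a2 a3 <- D r;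
  comb5 L (fun b1 b2 b3 b4 b5 => kupQ a1 a2 a3 a4 a5 b1 b2 b3 b4 b5)).
  rewrite /kup tcon_exch; apply: (@tcon_ext k H H k^o) => x1 a4.
  transitivity (\sw b b5 <- D L; \sw a1 r <- D x1; \sw a2 a3 <- D r; \sw b1 v <- D b;
     \sw b2 v' <- D v; \sw b3 b4 <- D v'; kupQ a1 a2 a3 a4 a5 b1 b2 b3 b4 b5).
    apply: (@tcon_ext k H H k^o) => b b5; rewrite tcon_exch.
    apply: (@tcon_ext k H H k^o) => a1 r; rewrite tcon_exch.
    apply: (@tcon_ext k H H k^o) => a2 a3; do 3!apply: (@tcon_ext k H H k^o) => ? ?.
    by rewrite /kupQ !(antiM I) !(antipode_invK I) !mulrA.
  rewrite tcon_exch; apply: (@tcon_ext k H H k^o) => a1 r.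
  by rewrite tcon_exch; apply: (@tcon_ext k H H k^o) => a2 a3.
rewrite (@hopf_coA k H a _ (fun a1 r x2 => \sw a2 a3 <- D r;
  comb5 L (fun b1 b2 b3 b4 b5 => kupQ a1 a2 a3 x2 a5 b1 b2 b3 b4 b5))); last first.
  by split=> ? ?; rewrite /comb5 /kupQ; lin.
apply: (@tcon_ext k H H k^o) => a1 r.
by rewrite (@hopf_coA k H r _ (fun a2 a3 x2 => comb5 L (fun b1 b2 b3 b4 b5 =>
  kupQ a1 a2 a3 x2 a5 b1 b2 b3 b4 b5))) //; split=> ? ?; rewrite /comb5 /kupQ; lin.
Qed.

(** For summands that see all components after the first only through their product. With no such
    component the empty product is supplied by the counit. *)
Lemma sweedler_head U n' x (f : seq H -> U) (g : H -> H -> U) : bilin g ->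
  (forall a s, size s = n' -> f (a :: s) = g a (\prod_(y <- s) y)) ->
  sweedler n'.+1 x f = \sw a b <- D x; g a (P n' b).
Proof.
move=> gb fg; case: n' fg => [|n'] fg.
  rewrite sweedler1E fg // big_nil.
  rewrite -(counitr_lin G tt tt x (f := fun a => g a 1)); last by lin.
  by apply: tcon_ext => a b; rewrite cgP0E (linZ (f := g a)) //; lin.
rewrite sweedlerSS; apply: tcon_ext => a b.
rewrite -spowE /spow (sweedler_lin (g := g a)); last by lin.
by apply: sweedler_ext => s sz; rewrite fg.
Qed.

(** For summands that see all but the last three components only through their product. *)
Lemma sweedler_mid U n' x (f : seq H -> U) (g : H -> H -> H -> H -> U) :
  (forall a b, bilin (g a b)) -> (forall c d, bilin (fun a b => g a b c d)) ->
  (forall s a b c, size s = n' -> f (s ++ [:: a; b; c]) = g (\prod_(y <- s) y) a b c) ->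
  sweedler (n' + 3) x f = \sw u v <- D x; \sw3 a b c <- D, v; g (P n' u) a b c.
Proof.
elim: n' => [|n' IHn] in x f g * => g1 g2 fg.
  rewrite -[LHS](counitl_lin G tt tt x (f := fun z => sweedler (0 + 3) z f)); last first.
    exact: (lin_tconl (fun a b => sweedler 2 b (fun s => f (a :: s))) (lin_lfun D (@lin_id _ _))).
  apply: tcon_ext => u v; rewrite cgP0E.
  transitivity (e u *: (\sw3 a b c <- D, v; g 1 a b c)).
    congr (_ *: _); apply: tcon_ext => a r; apply: tcon_ext => b c.
    by rewrite (fg [::]) // big_nil.
  rewrite (tcon3_lin (g := fun z => _ *: z)); last by lin.
  by apply: tcon3_ext => a b c; rewrite (linZ (f := fun z => g z a b c)) //; lin.
rewrite addSn -[(n' + 3)%N]/((n' + 3)%N) addn3 sweedlerSS -addn3.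
transitivity (\sw a b <- D x; \sw u v <- D b; \sw3 p q r <- D, v; g (a * P n' u) p q r).
  apply: tcon_ext => a b.
  apply: (IHn b (fun s => f (a :: s)) (fun z => g (a * z))) => [p q|p q|s p q r sz]; [by lin..|].
  by rewrite (fg (a :: s)) ?big_cons //= sz.
rewrite -(@hopf_coA k H x _ (fun a u v => \sw3 p q r <- D, v; g (a * P n' u) p q r));
  last by split=> ? ?; lin.
apply: tcon_ext => z v; rewrite cgPSE.
by rewrite (tcon_lin (g := fun z => \sw3 p q r <- D, v; g z p q r)) //; lin.
Qed.

End Formulas.

(** * Evaluation of the Heegaard diagram *)

Section Diagram.
Variables (k : fieldType) (H : hopfAlgebra k) (I : integrals H).
Implicit Types (x y : H) (U : vectType k).
Local Notation D := (cop H).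
Local Notation S := (antipode H).
Local Notation G := (hopf_cogroupoid I).
Local Notation Ti := (antipode_inv H).
Local Notation L := (Lam I).
Local Notation l x := (lam I x : k).
Local Notation P := (cgP G tt).

Lemma nth_iota_cat (pre r post : seq H) :
  [seq (pre ++ r ++ post)`_j.-1 | j <- iota (size pre).+1 (size r)] = r.
Proof.
apply: (@eq_from_nth _ 0) => [|i]; rewrite size_map size_iota // => ir.
rewrite (nth_map 0%N) ?size_iota // nth_iota // addSn /= nth_cat.
by rewrite ltnNge leq_addr /= addKn nth_cat ir.
Qed.

Lemma anti_prod (f : H -> H) (r : seq H) :
  f 1 = 1 -> (forall x y, f (x * y) = f y * f x) ->
  f (\prod_(y <- r) y) = \prod_(y <- rev r) f y.
Proof.
move=> f1 fM; elim: r => [|x r IHr]; first by rewrite !big_nil.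
by rewrite big_cons fM IHr rev_cons -cats1 big_cat big_seq1.
Qed.

Lemma anti3_prod (r : seq H) : S (S (S (\prod_(y <- r) y))) = \prod_(y <- rev r) S (S (S y)).
Proof.
apply: (@anti_prod (fun y => S (S (S y)))); first by rewrite !(antipode1 I).
by move=> x y; rewrite !(antiM I).
Qed.

(** Equal twist counts make the exponent of T zero, so only the power of S remains. *)
Lemma point_labelE (C : diagram) (F : 'I_(genus C) -> seq H) v z :
  (lower_mark v.1).2 = v.2.2 -> s_exp v = z%:~R ->
  point_label I F v = Sz z (leg (F v.1.1) v.1.2).
Proof.
move=> tv sv; rewrite /point_label sv Num.Theory.intrKfloor /t_exp tv subrr.
by [].
Qed.

Variables m n : nat.
Local Notation C := (diagram_mn m.+1 n.+1).

Lemma lower_mark_next (i : 'I_2) j : (1 < j)%N ->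
  (j <= if i == ord0 then m + 4 else n + 4)%N -> @lower_mark C (i, j) = (1 / 2, 0).
Proof.
case: j => [//|[//|j]] _ hx; rewrite /lower_mark /= nth_nseq.
by case: eqP hx => _ hx; rewrite ifT //; lia.
Qed.

Lemma half_index_half : half_index (1 / 2) = 1.
Proof.
by rewrite /half_index (_ : 1 / 2 + 1 / 2 = 1%:~R) // Num.Theory.intrKfloor.
Qed.

(** The exponents s(p) are 1 at [s1] and [w3], 2 at [s3], and 3 at [w1] and along [r]. The points of
    [r] are met in reverse order, and S^3 reverses products, so their labels multiply to S^3 of the
    product in lower order. *)
Lemma upper_word0 (F : 'I_2 -> seq H) s1 s2 s3 s4 r t1 w w1 w2 w3 :
  size r = m -> size w = n ->
  F ord0 = [:: s1, s2, s3, s4 & r] -> F ord_max = t1 :: w ++ [:: w1; w2; w3] ->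
  @upper_word C k H I F ord0
  = S s1 * (S (S (S (\prod_(y <- r) y))) * (S (S (S w1)) * (S (S s3) * S w3))).
Proof.
move=> sr sw Fs Ft; rewrite /upper_word /= subn1 /= big_cons big_cat /= !big_cons big_nil mulr1.
congr (_ * (_ * (_ * (_ * _)))).
- by rewrite (@point_labelE _ _ _ 1) //= Fs.
- rewrite big_map anti3_prod -{1}(nth_iota_cat [:: s1; s2; s3; s4] r [::]) cats0.
  rewrite -map_rev big_map sr big_seq [RHS]big_seq; apply: eq_bigr => j.
  rewrite mem_rev mem_iota => hx.
  rewrite (@point_labelE _ _ _ 3) /= ?Fs // /s_exp lower_mark_next //=; lia.
- rewrite (@point_labelE _ _ _ 3) /= ?Ft // /s_exp ?lower_mark_next //=; try lia.
  by rewrite /leg addn1 /= nth_cat sw ltnn subnn.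
- by rewrite (@point_labelE _ _ _ 2) /= ?Fs // /s_exp lower_mark_next //=; lia.
rewrite (@point_labelE _ _ _ 1) /= ?Ft // /s_exp ?lower_mark_next //=; try lia.
rewrite /leg addn3 /= nth_cat sw.
have -> : (n.+2 < n)%N = false by lia.
by have -> : (n.+2 - n = 2)%N by lia.
Qed.

Lemma upper_word1 (F : 'I_2 -> seq H) s1 s2 s3 s4 r t1 w w1 w2 w3 :
  size r = m -> size w = n ->
  F ord0 = [:: s1, s2, s3, s4 & r] -> F ord_max = t1 :: w ++ [:: w1; w2; w3] ->
  @upper_word C k H I F ord_max
  = S t1 * (S s2 * (S (S w2) * (S (S (S s4)) * S (S (S (\prod_(y <- w) y)))))).
Proof.
move=> sr sw Fs Ft; rewrite /upper_word /= subn1 /= !big_cons.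
congr (_ * (_ * (_ * (_ * _)))).
- by rewrite (@point_labelE _ _ _ 1) //= Ft.
- by rewrite (@point_labelE _ _ _ 1) /= ?Fs // /s_exp lower_mark_next //=; lia.
- rewrite (@point_labelE _ _ _ 2) /= ?Ft // /s_exp ?lower_mark_next //=; try lia.
  rewrite /leg addn2 /= nth_cat sw.
  have -> : (n.+1 < n)%N = false by lia.
  by have -> : (n.+1 - n = 1)%N by lia.
- by rewrite (@point_labelE _ _ _ 3) /= ?Fs // /s_exp lower_mark_next //=; lia.
rewrite big_map anti3_prod -{1}(nth_iota_cat [:: t1] w [:: w1; w2; w3]).
rewrite -map_rev big_map sw big_seq [RHS]big_seq; apply: eq_bigr => j.
rewrite mem_rev mem_iota => hx.
by rewrite (@point_labelE _ _ _ 3) /= ?Ft // /s_exp lower_mark_next //=; lia.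
Qed.

(** On each lower curve the first point is separated from the others in the words; rotating its
    component to the end produces exactly the factors a5 and b5 of [kupQ], each followed by the
    grouplike. *)
Lemma kuperberg_kupE : kuperberg C I = kupE I m n.
Proof.
have E2 : enum 'I_2 = [:: ord0; ord_max].
  by apply: (inj_map val_inj); rewrite val_enum_ord.
(* The values of the two words after lam of index 1/2 has stripped one antipode from each label and
   reversed the order; [s5] and [u] stand for the products along the two long runs. *)
pose g s1 s2 s3 s4 s5 t1 u w1 w2 w3 : k^o :=
  l (w3 * S s3 * S (S w1) * S (S s5) * s1) * l (S (S u) * S (S s4) * S w2 * s2 * t1).
pose Fst (s t : seq H) (j : 'I_2) := if j == ord_max then t else if j == ord0 then s else [::].
transitivity (sweedler m.+4 L (fun s => sweedler (n + 3).+1 L (U := k^o) (fun t =>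
  lam_half I 1 (@upper_word C k H I (Fst s t) ord0)
  * lam_half I 1 (@upper_word C k H I (Fst s t) ord_max)))).
  have sz0 : size (@lower C ord0) = m.+4 by rewrite /= size_nseq; lia.
  have sz1 : size (@lower C ord_max) = (n + 3).+1 by rewrite /= size_nseq; lia.
  rewrite /kuperberg -[enum 'I_(genus C)]/(enum 'I_2) E2 -sz0 -sz1.
  have half1 : half_index (- - (1 / 2)) = 1 by rewrite opprK half_index_half.
  transitivity (sweedler (size (@lower C ord0)) (Lam_half I (half_index (1 / 2))) (fun s =>
    sweedler (size (@lower C ord_max)) (Lam_half I (half_index (1 / 2))) (U := k^o) (fun t =>
      \prod_(j < 2) lam_half I (half_index (- - (1 / 2))) (@upper_word C k H I (Fst s t) j)))).
    by [].
  have -> : Lam_half I (half_index (1 / 2)) = L by rewrite half_index_half Lamh1E.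
  apply: (@sweedler_ext k H k^o) => s _; apply: (@sweedler_ext k H k^o) => t _.
  rewrite half1 !big_ord_recl big_ord0 mulr1; congr (_ * lam_half I 1 (upper_word I _ _)).
  exact: val_inj.
transitivity (\sw s1 r1 <- D L; \sw s2 r2 <- D r1; \sw s3 r3 <- D r2; \sw s4 s5 <- D r3;
  \sw t1 y <- D L; \sw u v <- D y; \sw3 w1 w2 w3 <- D, v; g s1 s2 s3 s4 (P m s5) t1 (P n u) w1 w2 w3).
  rewrite sweedlerSS; apply: (@tcon_ext k H H k^o) => s1 r1.
  rewrite sweedlerSS; apply: (@tcon_ext k H H k^o) => s2 r2.
  rewrite sweedlerSS; apply: (@tcon_ext k H H k^o) => s3 r3.
  apply: (@sweedler_head k H I k^o m r3 _ (fun s4 z => \sw t1 y <- D L; \sw u v <- D y;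
    \sw3 w1 w2 w3 <- D, v; g s1 s2 s3 s4 z t1 (P n u) w1 w2 w3)) => [|s4 r sr].
    by rewrite /g; lin.
  rewrite {1}addn3 sweedlerSS -addn3; apply: (@tcon_ext k H H k^o) => t1 y.
  apply: (@sweedler_mid k H I k^o n y _ (fun u w1 w2 w3 =>
    g s1 s2 s3 s4 (\prod_(y <- r) y) t1 u w1 w2 w3)) => [||w w1 w2 w3 sw].
  - by rewrite /g; lin.
  - by rewrite /g; lin.
  rewrite (@upper_word0 _ s1 s2 s3 s4 r t1 w w1 w2 w3) //.
  rewrite (@upper_word1 _ s1 s2 s3 s4 r t1 w w1 w2 w3) //.
  by rewrite !(lamh1E I) !(antiinvM I) !(antipodeK I).
(* The component [s1] becomes S^2(a5) times the grouplike, and the remaining four are renamed a1,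
   ..., a4. *)
rewrite (@Lam_rotate k H I k^o (fun r1 s1 => \sw s2 r2 <- D r1; \sw s3 r3 <- D r2; \sw s4 s5 <- D r3;
  \sw t1 y <- D L; \sw u v <- D y; \sw3 w1 w2 w3 <- D, v; g s1 s2 s3 s4 (P m s5) t1 (P n u) w1 w2 w3));
    last first.
  by rewrite /g; lin.
apply: (@tcon_ext k H H k^o) => a a5; apply: (@tcon_ext k H H k^o) => a1 r.
apply: (@tcon_ext k H H k^o) => a2 r'; apply: (@tcon_ext k H H k^o) => a3 a4.
rewrite (@Lam_rotate k H I k^o (fun y t1 => \sw u v <- D y; \sw3 w1 w2 w3 <- D, v;
  g (S (S a5) * gl I) a1 a2 a3 (P m a4) t1 (P n u) w1 w2 w3)); last first.
  by rewrite /g; lin.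
apply: (@tcon_ext k H H k^o) => b b5; apply: (@tcon_ext k H H k^o) => b1 v.
apply: (@tcon_ext k H H k^o) => b2 v'; apply: (@tcon_ext k H H k^o) => b3 b4.
(* Each word is now S(z) times the grouplike, on which lam agrees with lam(z). *)
rewrite /g /kupQ !mulrA -(lam_antipode_gl I (S _)) -[in RHS](lam_antipode_gl I (S (_ * b5))).
by rewrite !(antiM I) !(antipode_invK I).
Qed.

End Diagram.

(** * Twisting by a 2-cocycle *)

(** Left multiplication by y is injective, hence onto in finite dimension; the right inverse of y so
    obtained must equal x. *)
Lemma falg_mul1C (k : fieldType) (A : falgType k) (x y : A) : x * y = 1 -> y * x = 1.
Proof.
move=> xy.
have yI : lker (amull y) == 0%VS.
  apply/lker0P => z w; rewrite !lfunE /= => yzw.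
  by move: (congr1 (fun v => x * v) yzw); rewrite !mulrA xy !mul1r.
have yw : y * ((amull y)^-1)%VF 1 = 1.
  by have := lker0_lfunVK yI 1; rewrite lfunE.
suff -> : x = ((amull y)^-1)%VF 1 by [].
by rewrite -[LHS]mulr1 -[X in x * X = _]yw mulrA xy mul1r.
Qed.

Section Twist.
Variables (k : fieldType) (H : hopfAlgebra k) (I : integrals H).
Implicit Types (x y : H) (U : vectType k).
Local Notation D := (cop H).
Local Notation e x := (counit H x : k).
Local Notation S := (antipode H).
Local Notation G := (hopf_cogroupoid I).
Local Notation Ti := (antipode_inv H).

(* The pair (t, s) consists of the inverse t of a Drinfeld twist s. *)
Record is_twist (t s : tens H H) : Prop := IsTwist {
  twK : forall U (f : H -> H -> U), bilin f ->
    (\sw a b <- t; \sw p q <- s; f (a * p) (b * q)) = f 1 1;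
  twVK : forall U (f : H -> H -> U), bilin f ->
    (\sw p q <- s; \sw a b <- t; f (p * a) (q * b)) = f 1 1;
  tw_counitl : (\sw a b <- t; e a *: b) = 1;
  tw_counitr : (\sw a b <- t; e b *: a) = 1;
  tw_cocycle : forall U (f : H -> H -> H -> U), trilin f ->
    (\sw a b <- t; \sw a1 a2 <- D a; \sw c d <- t; f (a1 * c) (a2 * d) b)
    = \sw a b <- t; \sw b1 b2 <- D b; \sw c d <- t; f a (b1 * c) (b2 * d)
}.

Lemma is_twist1 : is_twist (ptens 1 1) (ptens 1 1).
Proof.
split.
- by move=> U f fb; rewrite !tcon_ptens ?mul1r //; lin.
- by move=> U f fb; rewrite !tcon_ptens ?mul1r //; lin.
- by rewrite tcon_ptens ?counit1 ?scale1r //; lin.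
- by rewrite tcon_ptens ?counit1 ?scale1r //; lin.
move=> U f fl; rewrite !tcon_ptens ?cop1; [|by lin..].
rewrite !tcon_ptens; [|by lin..].
by rewrite ?mul1r.
Qed.

Section OneTwist.
Variables t s : tens H H.
Hypothesis ts : is_twist t s.

(** The cocycle identity with one inverse moved across each side: (1 (x) Delta)(s) (Delta (x) 1)(t)
    = (1 (x) t)(s (x) 1). *)
Lemma tw_mix U (f : H -> H -> H -> U) : trilin f ->
  (\sw p q <- s; \sw q1 q2 <- D q; \sw a b <- t; \sw a1 a2 <- D a;
     f (p * a1) (q1 * a2) (q2 * b))
  = \sw p q <- s; \sw a b <- t; f p (a * q) b.
Proof.
move=> fl.
transitivity (\sw r z <- s; \sw z1 z2 <- D z; \sw g h <- t; \sw h1 h2 <- D h; \sw a b <- t;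
  \sw p q <- s; f (r * g * p) (z1 * (h1 * a) * q) (z2 * (h2 * b))).
  apply: tcon_ext => r z; apply: tcon_ext => z1 z2.
  rewrite -(tw_cocycle ts (f := fun g h1 h2 => \sw p q <- s; f (r * g * p) (z1 * h1 * q) (z2 * h2)));
    last by split=> ? ?; lin.
  apply: tcon_ext => a b; apply: tcon_ext => a1 a2.
  transitivity (f (r * (a1 * 1)) (z1 * (a2 * 1)) (z2 * b)); first by rewrite !mulr1.
  rewrite -(twK ts (f := fun x y => f (r * (a1 * x)) (z1 * (a2 * y)) (z2 * b))); last by lin.
  by do 2!apply: tcon_ext => ? ?; rewrite !mulrA.
transitivity (\sw r z <- s; \sw g h <- t; \sw z1 z2 <- D z; \sw h1 h2 <- D h; \sw a b <- t;
  \sw p q <- s; f (r * g * p) (z1 * h1 * (a * q)) (z2 * h2 * b)).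
  apply: tcon_ext => r z; rewrite tcon_exch.
  by do 5!apply: tcon_ext => ? ?; rewrite !mulrA.
transitivity (\sw r z <- s; \sw g h <- t; tcon (D (z * h)) (fun x y =>
  \sw a b <- t; \sw p q <- s; f (r * g * p) (x * (a * q)) (y * b))).
  by do 2!apply: tcon_ext => ? ?; rewrite hopf_copM //; lin.
rewrite (twVK ts (f := fun x y => tcon (D y) (fun u v =>
  \sw a b <- t; \sw p q <- s; f (x * p) (u * (a * q)) (v * b)))); last by lin.
rewrite cop1 tcon_ptens; last by lin.
by rewrite tcon_exch; do 2!apply: tcon_ext => ? ?; rewrite !mul1r.
Qed.

(** The inverse of the cocycle identity, obtained by inserting s t = 1, applying [tw_mix] and
    cancelling t s = 1 under Delta. *)
Lemma twV_cocycle U (f : H -> H -> H -> U) : trilin f ->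
  (\sw p q <- s; \sw p1 p2 <- D p; \sw r z <- s; f (r * p1) (z * p2) q)
  = \sw p q <- s; \sw q1 q2 <- D q; \sw r z <- s; f p (r * q1) (z * q2).
Proof.
move=> fl.
transitivity (\sw p q <- s; \sw p1 p2 <- D p; \sw a b <- s;
  \sw r z <- s; \sw c d <- t; f (r * p1) (a * (c * z) * p2) (b * d * q)).
  apply: tcon_ext => p q; apply: tcon_ext => p1 p2.
  rewrite tcon_exch; apply: tcon_ext => r z.
  transitivity (f (r * p1) (1 * z * p2) (1 * q)); first by rewrite !mul1r.
  rewrite -(twVK ts (f := fun x y => f (r * p1) (x * z * p2) (y * q))); last by lin.
  by do 2!apply: tcon_ext => ? ?; rewrite !mulrA.
transitivity (\sw p q <- s; \sw p1 p2 <- D p; \sw a b <- s;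
  \sw r z <- s; \sw z1 z2 <- D z; \sw c d <- t; \sw c1 c2 <- D c;
   f (r * c1 * p1) (a * (z1 * c2) * p2) (b * (z2 * d) * q)).
  do 3!apply: tcon_ext => ? ?.
  rewrite (tw_mix (f := fun x y w => f (x * _) (_ * y * _) (_ * w * _))); last by split=> ? ?; lin.
  by do 2!apply: tcon_ext => ? ?; rewrite !mulrA.
transitivity (\sw r z <- s; \sw z1 z2 <- D z; \sw a b <- s;
  \sw c d <- t; \sw p q <- s; tcon (D (c * p)) (fun x y =>
   f (r * x) (a * z1 * y) (b * z2 * (d * q)))).
  transitivity (\sw p q <- s; \sw r z <- s; \sw z1 z2 <- D z; \sw a b <- s;
    \sw c d <- t;  \sw p1 p2 <- D p; \sw c1 c2 <- D c;
     f (r * c1 * p1) (a * (z1 * c2) * p2) (b * (z2 * d) * q)).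
    apply: tcon_ext => p q; rewrite tcon_exch.
    transitivity (\sw a b <- s; \sw r z <- s; \sw z1 z2 <- D z; \sw c d <- t; \sw p1 p2 <- D p;
        \sw c1 c2 <- D c;  f (r * c1 * p1) (a * (z1 * c2) * p2) (b * (z2 * d) * q)).
      apply: tcon_ext => a b; rewrite tcon_exch; apply: tcon_ext => r z.
      rewrite tcon_exch; apply: tcon_ext => z1 z2.
      by rewrite tcon_exch.
    rewrite tcon_exch; apply: tcon_ext => r z.
    by rewrite tcon_exch.
  rewrite tcon_exch; apply: tcon_ext => r z.
  rewrite tcon_exch; apply: tcon_ext => z1 z2.
  rewrite tcon_exch; apply: tcon_ext => a b.
  rewrite tcon_exch; apply: tcon_ext => c d; apply: tcon_ext => p q.
  rewrite hopf_copM; last by lin.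
  by rewrite tcon_exch; do 2!apply: tcon_ext => ? ?; rewrite !mulrA.
apply: tcon_ext => r z; apply: tcon_ext => z1 z2; apply: tcon_ext => a b.
rewrite (twK ts (f := fun w v => tcon (D w) (fun x y =>
   f (r * x) (a * z1 * y) (b * z2 * v)))); last by lin.
by rewrite cop1 tcon_ptens ?mulr1 //; lin.
Qed.

Lemma twV_counitl : (\sw p q <- s; e p *: q) = 1.
Proof.
have := twK ts (f := fun x y => e x *: y); rewrite counit1 scale1r => <-; last by lin.
rewrite -[LHS]mul1r -(tw_counitl ts) (tcon_lin (g := fun z => z * _)); last by lin.
apply: tcon_ext => a b; rewrite (tcon_lin (g := fun z => _ * z)); last by lin.
by apply: tcon_ext => p q; rewrite falg_scalel falg_scaler scalerA -counitM.
Qed.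

Lemma twV_counitr : (\sw p q <- s; e q *: p) = 1.
Proof.
have := twK ts (f := fun x y => e y *: x); rewrite counit1 scale1r => <-; last by lin.
rewrite -[LHS]mul1r -(tw_counitr ts) (tcon_lin (g := fun z => z * _)); last by lin.
apply: tcon_ext => a b; rewrite (tcon_lin (g := fun z => _ * z)); last by lin.
by apply: tcon_ext => p q; rewrite falg_scalel falg_scaler scalerA -counitM.
Qed.

(** The twisted antipode is u S(-) v, with u = [twu] and v = [twv] mutually inverse when X = Y. *)
Definition twu : H := \sw p q <- s; p * S q.
Definition twv : H := \sw a b <- t; S a * b.

(** The product is p S(a q) b; [tw_mix] turns it into p a_1 S(a_2) S(q_1) q_2 b, where everything
    cancels by the counit normalisations. *)
Lemma twuv : twu * twv = 1.
Proof.
transitivity (\sw p q <- s; \sw a b <- t; p * S (a * q) * b).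
  rewrite /twu (tcon_lin (g := fun z => z * _)); last by lin.
  apply: tcon_ext => p q; rewrite /twv (tcon_lin (g := fun z => _ * z)); last by lin.
  by apply: tcon_ext => a b; rewrite (antiM I) !mulrA.
rewrite -(tw_mix (f := fun x y z => x * S y * z)); last by split=> ? ?; lin.
transitivity (\sw p q <- s; \sw q1 q2 <- D q; \sw a b <- t; e a *: (p * (S q1 * q2) * b)).
  apply: tcon_ext => p q; apply: tcon_ext => q1 q2; apply: tcon_ext => a b.
  transitivity (\sw a1 a2 <- D a; p * (a1 * S a2) * (S q1 * q2 * b)).
    by apply: tcon_ext => a1 a2; rewrite (antiM I) !mulrA.
  rewrite -(tcon_lin (g := fun z => p * z * (S q1 * q2 * b))); last by lin.
  by rewrite hopf_antir falg_scaler falg_scalel mulr1 !mulrA.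
transitivity (\sw p q <- s; e q *: p); last exact: twV_counitr.
apply: tcon_ext => p q.
transitivity (\sw q1 q2 <- D q; p * (S q1 * q2)).
  apply: tcon_ext => q1 q2.
  rewrite -[RHS]mulr1 -(tw_counitl ts) [RHS](tcon_lin (g := fun z => p * (S q1 * q2) * z));
    last by lin.
  by apply: tcon_ext => a b; rewrite falg_scaler.
rewrite -(tcon_lin (g := fun z => p * z)); last by lin.
by rewrite hopf_antil falg_scaler mulr1.
Qed.

Lemma twvu : twv * twu = 1.
Proof. exact: falg_mul1C twuv. Qed.

Lemma tw_uS : (\sw a b <- t; a * twu * S b) = 1.
Proof.
have := twK ts (f := fun x y => x * S y); rewrite (antipode1 I) mulr1 => <-; last by lin.
apply: tcon_ext => a b; rewrite /twu (tcon_lin (g := fun z => a * z * _)); last by lin.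
by apply: tcon_ext => p q; rewrite (antiM I) !mulrA.
Qed.

Lemma tw_Sv : (\sw p q <- s; S p * twv * q) = 1.
Proof.
have := twK ts (f := fun x y => S x * y); rewrite (antipode1 I) mulr1 => <-; last by lin.
rewrite tcon_exch; apply: tcon_ext => p q; rewrite /twv (tcon_lin (g := fun z => _ * z * _));
  last by lin.
by apply: tcon_ext => a b; rewrite (antiM I) !mulrA.
Qed.

End OneTwist.

Section TwistFamily.
Variables (T : Type) (t s : T -> tens H H).
Hypothesis ts : forall X, is_twist (t X) (s X).
Implicit Types X Y Z : T.

(** The coproduct s_X Delta(x) t_Y: on the diagonal it is the twisted coproduct, off the diagonal it
    links two twists. *)
Definition tw_cop X Y : 'Hom(H, tens H H) := linfun (fun x =>
  \sw p q <- s X; \sw a b <- D x; \sw c d <- t Y; ptens (p * a * c) (q * b * d)).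

Definition tw_anti X Y : 'End(H) := linfun (fun x => twu (s Y) * S x * twv (t X)).
Definition tw_antiV X Y : 'End(H) := linfun (fun x => Ti (twv (t X) * x * twu (s Y))).

Lemma tw_antiE X Y x : tw_anti X Y x = twu (s Y) * S x * twv (t X).
Proof. by rewrite linfE //; lin. Qed.

Lemma tw_antiVE X Y x : tw_antiV X Y x = Ti (twv (t X) * x * twu (s Y)).
Proof. by rewrite linfE //; lin. Qed.

Lemma tw_copE X Y x U (f : H -> H -> U) : bilin f ->
  tcon (tw_cop X Y x) f
  = \sw p q <- s X; \sw a b <- D x; \sw c d <- t Y; f (p * a * c) (q * b * d).
Proof.
move=> fb; rewrite linfE; last by lin.
rewrite tcon_tcon; apply: tcon_ext => p q; rewrite tcon_tcon; apply: tcon_ext => a b.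
by rewrite tcon_tcon; apply: tcon_ext => c d; rewrite tcon_ptens.
Qed.

(** Coassociativity of Delta in the middle, the cocycle identity of t_Y on the right and the inverse
    one of s_X on the left. *)
Lemma tw_coA X Y x U (f : H -> H -> H -> U) : trilin f ->
  (\sw a b <- tw_cop X Y x; \sw c d <- tw_cop X Y a; f c d b)
  = (\sw a b <- tw_cop X Y x; \sw c d <- tw_cop X Y b; f a c d).
Proof.
move=> fl; rewrite !tw_copE; [|by lin..].
transitivity (\sw p q <- s X; \sw p1 p2 <- D p; \sw p' q' <- s X; \sw a b <- D x; \sw a1 a2 <- D a;
  \sw c d <- t Y; \sw c1 c2 <- D c; \sw c' d' <- t Y;
  f (p' * p1 * a1 * (c1 * c')) (q' * p2 * a2 * (c2 * d')) (q * b * d)).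
  apply: tcon_ext => p q.
  transitivity (\sw p1 p2 <- D p; \sw a b <- D x; \sw p' q' <- s X; \sw a1 a2 <- D a;
    \sw c d <- t Y; \sw c1 c2 <- D c; \sw c' d' <- t Y;
    f (p' * p1 * a1 * (c1 * c')) (q' * p2 * a2 * (c2 * d')) (q * b * d)); last first.
    by apply: tcon_ext => p1 p2; rewrite tcon_exch.
  rewrite [RHS]tcon_exch; apply: tcon_ext => a b.
  transitivity (\sw c d <- t Y; \sw p' q' <- s X; \sw p1 p2 <- D p; \sw a1 a2 <- D a;
    \sw c1 c2 <- D c; \sw c' d' <- t Y;
    f (p' * p1 * a1 * (c1 * c')) (q' * p2 * a2 * (c2 * d')) (q * b * d)).
    apply: tcon_ext => c d; rewrite tw_copE; last by lin.
    apply: tcon_ext => p' q'; rewrite hopf_copM; last by lin.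
    rewrite hopf_copM; last by lin.
    do 3!apply: tcon_ext => ? ?.
    by apply: tcon_ext => ? ?; rewrite !mulrA.
  rewrite [RHS]tcon_exch [LHS]tcon_exch; apply: tcon_ext => p' q'.
  rewrite tcon_exch; apply: tcon_ext => p1 p2.
  by rewrite tcon_exch.
transitivity (\sw p q <- s X; \sw q1 q2 <- D q; \sw p' q' <- s X; \sw a b <- D x; \sw b1 b2 <- D b;
  \sw c d <- t Y; \sw d1 d2 <- D d; \sw c' d' <- t Y;
  f (p * a * c) (p' * q1 * b1 * (d1 * c')) (q' * q2 * b2 * (d2 * d'))).
  rewrite (twV_cocycle (ts X) (f := fun u v w => \sw a b <- D x; \sw a1 a2 <- D a;
    \sw c d <- t Y; \sw c1 c2 <- D c; \sw c' d' <- t Y;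
    f (u * a1 * (c1 * c')) (v * a2 * (c2 * d')) (w * b * d))); last by split=> ? ?; lin.
  apply: tcon_ext => p q; apply: tcon_ext => q1 q2; apply: tcon_ext => p' q'.
  rewrite (@hopf_coA k H x U (fun a1 a2 b => \sw c d <- t Y; \sw c1 c2 <- D c; \sw c' d' <- t Y;
    f (p * a1 * (c1 * c')) (p' * q1 * a2 * (c2 * d')) (q' * q2 * b * d))); last by split=> ? ?; lin.
  apply: tcon_ext => a b; apply: tcon_ext => b1 b2.
  by rewrite (tw_cocycle (ts Y) (f := fun x y z => f (p * a * x) (p' * q1 * b1 * y) (q' * q2 * b2 * z))) //; split=> ? ?; lin.
apply: tcon_ext => p q.
transitivity (\sw q1 q2 <- D q; \sw a b <- D x; \sw p' q' <- s X; \sw b1 b2 <- D b;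
  \sw c d <- t Y; \sw d1 d2 <- D d; \sw c' d' <- t Y;
  f (p * a * c) (p' * q1 * b1 * (d1 * c')) (q' * q2 * b2 * (d2 * d'))).
  by apply: tcon_ext => q1 q2; rewrite tcon_exch.
rewrite tcon_exch; apply: tcon_ext => a b.
transitivity (\sw c d <- t Y; \sw p' q' <- s X; \sw q1 q2 <- D q; \sw b1 b2 <- D b;
    \sw d1 d2 <- D d; \sw c' d' <- t Y;
    f (p * a * c) (p' * q1 * b1 * (d1 * c')) (q' * q2 * b2 * (d2 * d'))); last first.
  apply: tcon_ext => c d; rewrite tw_copE; last by lin.
  apply: tcon_ext => p' q'; rewrite hopf_copM; last by lin.
  rewrite hopf_copM; last by lin.
  do 3!apply: tcon_ext => ? ?.
  by apply: tcon_ext => ? ?; rewrite !mulrA.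
rewrite [LHS]tcon_exch [RHS]tcon_exch; apply: tcon_ext => p' q'.
rewrite [RHS]tcon_exch; apply: tcon_ext => q1 q2.
by rewrite [RHS]tcon_exch.
Qed.

(** Between the two factors t_Y meets s_Y and cancels, whatever X and Z are. *)
Lemma tw_copM X Y Z x y U (f : H -> H -> U) : bilin f ->
  tcon (tw_cop X Z (x * y)) f
  = \sw a b <- tw_cop X Y x; \sw c d <- tw_cop Y Z y; f (a * c) (b * d).
Proof.
move=> fb; rewrite !tw_copE; [|by lin..]; apply: tcon_ext => p q.
rewrite hopf_copM; last by lin.
apply: tcon_ext => a b.
transitivity (\sw c d <- t Y; \sw p' q' <- s Y; \sw a' b' <- D y; \sw c' d' <- t Z;
  f (p * a * (c * p') * a' * c') (q * b * (d * q') * b' * d')); last first.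
  apply: tcon_ext => c d; rewrite tw_copE; last by lin.
  by do 3!apply: tcon_ext => ? ?; rewrite !mulrA.
rewrite (twK (ts Y) (f := fun u v => \sw a' b' <- D y; \sw c' d' <- t Z;
  f (p * a * u * a' * c') (q * b * v * b' * d'))); last by lin.
by do 2!apply: tcon_ext => ? ?; rewrite !mulr1 !mulrA.
Qed.

Lemma tw_cop1 X : tw_cop X X 1 = ptens 1 1.
Proof.
apply: tcon_inj => U f fb; rewrite tw_copE // tcon_ptens //.
rewrite -(twVK (ts X) fb); apply: tcon_ext => p q.
by rewrite cop1 tcon_ptens ?mulr1 //; lin.
Qed.

Lemma tw_counit_l X Y x : (\sw a b <- tw_cop X Y x; e a *: b) = x.
Proof.
rewrite tw_copE; last by lin.
transitivity ((\sw p q <- s X; e p *: q) * (\sw a b <- D x; e a *: b) * (\sw c d <- t Y; e c *: d)).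
  rewrite (tcon_lin (g := fun z => z * _ * _)); last by lin.
  apply: tcon_ext => p q; rewrite (tcon_lin (g := fun z => _ * z * _)); last by lin.
  apply: tcon_ext => a b; rewrite (tcon_lin (g := fun z => _ * z)); last by lin.
  apply: tcon_ext => c d; rewrite !(falg_scalel, falg_scaler, scalerA) !counitM.
  by rewrite mulrC mulrA.
by rewrite (twV_counitl (ts X)) hopf_counitl (tw_counitl (ts Y)) mul1r mulr1.
Qed.

Lemma tw_counit_r X Y x : (\sw a b <- tw_cop X Y x; e b *: a) = x.
Proof.
rewrite tw_copE; last by lin.
transitivity ((\sw p q <- s X; e q *: p) * (\sw a b <- D x; e b *: a) * (\sw c d <- t Y; e d *: c)).
  rewrite (tcon_lin (g := fun z => z * _ * _)); last by lin.
  apply: tcon_ext => p q; rewrite (tcon_lin (g := fun z => _ * z * _)); last by lin.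
  apply: tcon_ext => a b; rewrite (tcon_lin (g := fun z => _ * z)); last by lin.
  apply: tcon_ext => c d; rewrite !(falg_scalel, falg_scaler, scalerA) !counitM.
  by rewrite mulrC mulrA.
by rewrite (twV_counitr (ts X)) hopf_counitr (tw_counitr (ts Y)) mul1r mulr1.
Qed.

Lemma tw_antil X Y x : (\sw a b <- tw_cop X Y x; tw_anti X Y a * b) = e x *: 1.
Proof.
rewrite tw_copE; last by lin.
transitivity (\sw a b <- D x; \sw c d <- t Y; twu (s Y) * S c * (S a * b) * d).
  transitivity (\sw a b <- D x; \sw c d <- t Y; \sw p q <- s X;
    twu (s Y) * S c * S a * (S p * twv (t X) * q) * b * d).
    rewrite tcon_exch; apply: tcon_ext => a b; rewrite tcon_exch; apply: tcon_ext => c d.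
    by apply: tcon_ext => p q; rewrite tw_antiE !(antiM I) !mulrA.
  do 2!apply: tcon_ext => ? ?.
  rewrite -(tcon_lin (g := fun z => _ * z * _ * _)); last by lin.
  by rewrite (tw_Sv (ts X)) mulr1 !mulrA.
rewrite tcon_exch -(twuv (ts Y)) [X in _ *: (_ * X)]/twv.
rewrite (tcon_lin (g := fun z => _ *: (_ * z))); last by lin.
apply: tcon_ext => c d; rewrite -(tcon_lin (g := fun z => twu (s Y) * S c * z * d)); last by lin.
by rewrite hopf_antil falg_scaler falg_scalel mulr1 mulrA.
Qed.

Lemma tw_antir X Y x : (\sw a b <- tw_cop X Y x; a * tw_anti X Y b) = e x *: 1.
Proof.
rewrite tw_copE; last by lin.
transitivity (\sw p q <- s X; \sw a b <- D x; p * (a * S b) * S q * twv (t X)).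
  apply: tcon_ext => p q; apply: tcon_ext => a b.
  transitivity (\sw c d <- t Y; p * a * (c * twu (s Y) * S d) * S b * S q * twv (t X)).
    by apply: tcon_ext => c d; rewrite tw_antiE !(antiM I) !mulrA.
  rewrite -(tcon_lin (g := fun z => _ * z * _ * _ * _)); last by lin.
  by rewrite (tw_uS (ts Y)) mulr1 !mulrA.
rewrite -(twuv (ts X)) [X in _ *: (X * _)]/twu.
rewrite (tcon_lin (g := fun z => _ *: (z * _))); last by lin.
apply: tcon_ext => p q; rewrite -(tcon_lin (g := fun z => p * z * S q * twv (t X))); last by lin.
by rewrite hopf_antir falg_scaler !falg_scalel mulr1.
Qed.

Lemma tw_antiVK X Y x : tw_anti Y X (tw_antiV X Y x) = x.
Proof.
rewrite tw_antiE tw_antiVE (antipode_invK I).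
by rewrite !mulrA (twuv (ts X)) mul1r -mulrA (twuv (ts Y)) mulr1.
Qed.

Lemma tw_antiK X Y x : tw_antiV Y X (tw_anti X Y x) = x.
Proof.
rewrite tw_antiE tw_antiVE.
by rewrite !mulrA (twvu (ts Y)) mul1r -mulrA (twvu (ts X)) mulr1 (antipodeK I).
Qed.

Definition twist_cogroupoid : cogroupoid H T :=
  @Cogroupoid k H T tw_cop (counit H) tw_anti tw_antiV tw_coA
    tw_counit_l tw_counit_r tw_copM tw_cop1 (counit1 H) (@counitM k H)
    tw_antil tw_antir tw_antiVK tw_antiK.

End TwistFamily.

End Twist.

(** * Transport along an isomorphism of Hopf algebras *)

Section Transport.
Variables (k : fieldType) (A A' : falgType k) (T T' : Type).
Variables (G : cogroupoid A T) (G' : cogroupoid A' T') (X : T) (X' : T').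
Variables (s : 'Hom(A, A')) (r : 'Hom(A', A)).
Hypotheses (sK : forall x, r (s x) = x) (rK : forall x, s (r x) = x).
Hypotheses (s1 : s 1 = 1) (sM : forall x y : A, s (x * y) = s x * s y).
Hypothesis s_counit : forall x, cge G' (s x) = cge G x :> k.
Hypothesis s_cop : forall x (U : vectType k) (f : A' -> A' -> U), bilin f ->
  tcon (cgd G' X' X' (s x)) f = \sw a b <- cgd G X X x; f (s a) (s b).
Implicit Types U : vectType k.

(** Convolution inverses are unique, so preservation of the product, unit, coproduct and counit
    forces preservation of S. *)
Lemma transport_S x : cgS G' X' X' (s x) = s (cgS G X X x).
Proof.
have am : antipodal G X X (fun a b => r (cgS G' X' X' (s a) * s b)).
  split=> [|z]; first by lin.
  rewrite -(@s_cop z _ (fun a b => r (cgS G' X' X' a * b))); last by lin.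
  rewrite -(tcon_lin (g := fun z => r z)) ?cg_antil; last by lin.
  by rewrite s_counit lfunZ -s1 sK.
transitivity (s (r (cgS G' X' X' (s x))) * s 1); first by rewrite s1 mulr1 rK.
rewrite -(antipodal_23 x (g := fun a b => s (r (cgS G' X' X' (s a))) * s b) (anti_Sr G X X));
  last by lin.
transitivity (s 1 * s (cgS G X X x)); last by rewrite s1 mul1r.
rewrite -(antipodal_12 x (g := fun a b => s a * s (cgS G X X b)) am); last by lin.
by do 2!apply: tcon_ext => ? ?; rewrite !rK sM mulrA.
Qed.

Lemma transport_T x : cgT G' X' X' (s x) = s (cgT G X X x).
Proof. by apply: (@cgS_inj _ _ _ G' X' X'); rewrite cgTK transport_S cgTK. Qed.

Lemma transport_P n x : cgP G' X' n (s x) = s (cgP G X n x).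
Proof.
elim: n => [|n IHn] in x *; first by rewrite !cgP0E s_counit lfunZ s1.
rewrite !cgPSE s_cop; last by lin.
by rewrite (tcon_lfun s); apply: tcon_ext => a b; rewrite IHn sM.
Qed.

Lemma transport_braid x y U (f : A' -> A' -> U) : bilin f ->
  braid G' X' X' (s x) (s y) f = braid G X X x y (fun u v => f (s u) (s v)).
Proof.
move=> fb; rewrite /braid /tcon3 s_cop; last by lin.
apply: tcon_ext => a z; rewrite s_cop; last by lin.
apply: tcon_ext => b c; rewrite s_cop; last by lin.
apply: tcon_ext => p w; rewrite s_cop; last by lin.
by apply: tcon_ext => q t; rewrite !transport_S !transport_T -!sM.
Qed.

Lemma transport_kup m n x y U (f : A' -> A' -> U) : bilin f ->
  kup G' m n X' (s x) (s y) f = kup G m n X x y (fun u v => f (s u) (s v)).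
Proof.
move=> fb; rewrite /kup s_cop; last by linb.
apply: tcon_ext => x1 x2; rewrite s_cop; last by linb.
apply: tcon_ext => y1 y2; rewrite transport_braid; last by lin.
by apply: braid_ext => u v; rewrite !transport_P !transport_S -!sM.
Qed.

Lemma transport_trace m n :
  Tr2 (fun x y => kup G' m n X' x y (@ptens k A' A'))
  = Tr2 (fun x y => kup G m n X x y (@ptens k A A)).
Proof.
rewrite /Tr2; set h' := tlift _; set h := tlift _.
have hs : (h' \o tmap s s = tmap s s \o h)%VF.
  apply: tens_ext => x y; rewrite !comp_lfunE tmapE.
  rewrite /h' /h !tliftE; [|by apply: kup_bilin; lin..].
  rewrite transport_kup; last by lin.
  rewrite (kup_lin _ _ _ _ _ _ (g := fun z => tmap s s z)); last by lin.
  by apply: kup_ext => u v; rewrite tmapE.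
have -> : h' = (tmap s s \o (h \o tmap r r))%VF.
  rewrite comp_lfunA -hs -comp_lfunA; apply: tens_ext => x y.
  by rewrite !comp_lfunE !tmapE !rK.
rewrite tr_lfunC -comp_lfunA; congr (tr_lfun _); apply: tens_ext => x y.
by rewrite !comp_lfunE !tmapE !sK.
Qed.

End Transport.

(** * Modules *)

Lemma dim_tens (k : fieldType) (V W : vectType k) : dim (tens V W) = (dim V * dim W)%N.
Proof. by []. Qed.

Section Dimension.
Variables (k : fieldType) (V V' : vectType k) (U : {vspace V}) (U' : {vspace V'}).
Variable f : V -> V'.
Hypotheses (fl : forall a x y, x \in U -> y \in U -> f (a *: x + y) = a *: f x + f y).
Hypotheses (fU : forall x, x \in U -> f x \in U').
Hypotheses (fi : forall x, x \in U -> f x = 0 -> x = 0).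

Let g : 'Hom(V, V') := linfun (fun x => f (projv U x)).

Let gE x : x \in U -> g x = f x.
Proof.
move=> xU; rewrite linfE ?projv_id // => a u v.
by rewrite linearP fl ?memv_proj.
Qed.

Let gU : (g @: U <= U')%VS.
Proof. by apply/subvP=> y /memv_imgP[x xU ->]; rewrite gE ?fU. Qed.

Let gdim : \dim (g @: U) = \dim U.
Proof.
apply: limg_dim_eq; apply/eqP; rewrite -subv0; apply/subvP=> x.
by rewrite memv_cap memv_ker memv0 => /andP[xU]; rewrite gE // => /eqP/(fi xU)->.
Qed.

Lemma dim_inj : (\dim U <= \dim U')%N.
Proof. by rewrite -gdim dimvS. Qed.

Lemma dim_onto : (forall y, y \in U' -> exists2 x, x \in U & f x = y) ->
  (\dim U' <= \dim U)%N.
Proof.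
move=> fS; have sub : (U' <= g @: U)%VS.
  apply/subvP=> y /fS[x xU <-]; apply/memv_imgP; exists x; rewrite ?gE //.
by rewrite -(limg_ker_dim g U) (leq_trans (dimvS sub)) // leq_addl.
Qed.

Lemma dim_inj_onto y : (\dim U' <= \dim U)%N -> y \in U' -> exists2 x, x \in U & f x = y.
Proof.
move=> dU; have /eqP-> : U' == (g @: U)%VS.
  by rewrite eq_sym -(geq_leqif (dimv_leqif_eq gU)) gdim.
by case/memv_imgP=> x xU ->; exists x; rewrite ?gE.
Qed.

End Dimension.

Lemma dim_iso (k : fieldType) (V W : vectType k) (f : 'Hom(V, W)) (g : 'Hom(W, V)) :
  cancel f g -> cancel g f -> dim V = dim W.
Proof.
move=> fK gK; rewrite -[LHS]dimvf -[RHS]dimvf; apply/eqP; rewrite eqn_leq; apply/andP; split.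
  apply: (dim_inj (f := f)) => [a x y _ _|x _|x _ fx]; rewrite ?linearP ?memvf //.
  by rewrite -(fK x) fx linear0.
apply: (dim_inj (f := g)) => [a x y _ _|x _|x _ fx]; rewrite ?linearP ?memvf //.
by rewrite -(gK x) fx linear0.
Qed.

(* The maps m_j and n_j identify X with the direct sum of dim V copies of Y. *)
Lemma dim_copies (k : fieldType) (V X Y : vectType k)
    (m : 'I_(dim V) -> 'Hom(Y, X)) (n : 'I_(dim V) -> 'Hom(X, Y)) :
  (forall i j y, n i (m j y) = (i == j)%:R *: y) ->
  (forall x, \sum_j m j (n j x) = x) -> dim X = (dim V * dim Y)%N.
Proof.
move=> nm mn.
have nS i (y : 'I_(dim V) -> Y) : n i (\sum_j m j (y j)) = y i.
  rewrite linear_sum (bigD1 i) //= nm eqxx scale1r big1 ?addr0 // => j ji.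
  by rewrite nm eq_sym (negPf ji) scale0r.
pose f := linfun (fun x => \sum_j ptens (@tbase k V j) (n j x)).
have fE x : f x = \sum_j ptens (@tbase k V j) (n j x).
  by rewrite linfE //; apply: lin_sumr => j; lin.
have cl i : lin (fun v : V => v2r v 0 i : k^o) by move=> a x y; rewrite linearP !mxE.
have gb : bilin (fun (v : V) y => \sum_j v2r v 0 j *: m j y).
  by apply: bilinI => ?; apply: lin_sumr => j; [apply: lin_scalel|lin].
pose g : 'Hom(tens V Y, X) := linfun (fun t => tcon t (fun v y => \sum_j v2r v 0 j *: m j y)).
have gE v y : g (ptens v y) = \sum_j v2r v 0 j *: m j y.
  by rewrite linfE ?tcon_ptens //; apply: lin_tconl; apply: lin_id.
rewrite -[RHS](dim_tens V Y); apply: (@dim_iso _ _ _ f g) => [x|t].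
  rewrite fE linear_sum -[RHS]mn; apply: eq_bigr => j _; rewrite /= gE (bigD1 j) //=.
  rewrite big1 ?addr0 => [|i ij]; rewrite /tbase r2vK !mxE ?eqxx ?scale1r //.
  by rewrite /= (negPf ij) scale0r.
rewrite -comp_lfunE -[RHS]id_lfunE; congr (fun_of_lfun _ t); apply: tens_ext => v y.
rewrite comp_lfunE id_lfunE gE fE [in RHS](tbase_sum v) (lin_sum (f := fun v => ptens v y));
  last by lin.
apply: eq_bigr => i _; rewrite (linZ (f := fun v => ptens v y)); last by lin.
transitivity (ptens (@tbase k V i) (v2r v 0 i *: y)); last by rewrite (linZ (f := ptens _)) //; lin.
by congr ptens; rewrite -(nS i (fun j => v2r v 0 j *: y)); congr (n i _); apply: eq_bigr => j _; rewrite lfunZ.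
Qed.

Section Hmod.
Variables (k : fieldType) (H : hopfAlgebra k).
Implicit Types U V W : hmod H.

Lemma hlin_id V : hlin (\1%VF : 'Hom(V, V)).
Proof. by move=> x v; rewrite !id_lfunE. Qed.

Lemma hlin0 V W : hlin (0 : 'Hom(V, W)).
Proof. by move=> x v; rewrite !zero_lfunE linear0. Qed.

Lemma hlin_comp U V W (f : 'Hom(V, W)) (g : 'Hom(U, V)) :
  hlin f -> hlin g -> hlin (f \o g)%VF.
Proof. by move=> fh gh x v; rewrite !comp_lfunE gh fh. Qed.

Lemma hlinP V W (a : k) (f g : 'Hom(V, W)) : hlin f -> hlin g -> hlin (a *: f + g).
Proof. by move=> fh gh x v; rewrite !add_lfunE !scale_lfunE fh gh linearP. Qed.

Lemma hlinD V W (f g : 'Hom(V, W)) : hlin f -> hlin g -> hlin (f + g).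
Proof. by move=> fh gh; rewrite -[f]scale1r; apply: hlinP. Qed.

Lemma hlinB V W (f g : 'Hom(V, W)) : hlin f -> hlin g -> hlin (f - g).
Proof. by move=> fh gh; rewrite addrC -scaleN1r; apply: hlinP. Qed.

Lemma hlinZ V W a (f : 'Hom(V, W)) : hlin f -> hlin (a *: f).
Proof. by move=> fh; rewrite -[_ *: _]addr0; apply: hlinP => //; apply: hlin0. Qed.

Lemma hlin_sum V W (J : finType) (f : J -> 'Hom(V, W)) :
  (forall j, hlin (f j)) -> hlin (\sum_j f j).
Proof. by move=> fh; apply: big_ind => //; [apply: hlin0 | apply: hlinD]. Qed.

(** Module maps form a kernel, hence a subspace with a dimension; [locked] keeps conversion from
    unfolding it. *)
Definition homs V W : {vspace 'Hom(V, W)} :=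
  locked (lker (linfun (fun f : 'Hom(V, W) =>
    linfun (fun x => (f \o hact V x)%VF - (hact W x \o f)%VF)))).

Lemma homsP V W (f : 'Hom(V, W)) : reflect (hlin f) (f \in homs V W).
Proof.
rewrite /homs -lock memv_ker linfE; last first.
  move=> a g h; apply/lfunP=> x; rewrite add_lfunE scale_lfunE !linfE; [|by lin..].
  rewrite !comp_lfunDl !comp_lfunDr -comp_lfunZl -comp_lfunZr scalerDr scalerN.
  by rewrite opprD addrACA.
apply: (iffP eqP) => [f0 x v|fh]; last first.
  apply/lfunP=> x; rewrite zero_lfunE linfE; last by lin.
  by apply/lfunP=> v; rewrite add_lfunE opp_lfunE !comp_lfunE fh subrr zero_lfunE.
have := congr1 (fun h : 'Hom(H, 'Hom(V, W)) => h x v) f0.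
rewrite !zero_lfunE linfE; last by lin.
by rewrite add_lfunE opp_lfunE !comp_lfunE => /subr0_eq.
Qed.

Fact reg_act1 (v : H) : linfun (fun x : H => amull x) 1 v = v.
Proof. by rewrite linfE ?lfunE /= ?mul1r // => a x y; rewrite linearP. Qed.

Fact reg_actM (x y v : H) : linfun (fun x : H => amull x) (x * y) v
  = linfun (fun x : H => amull x) x (linfun (fun x : H => amull x) y v).
Proof. by rewrite !linfE ?lfunE /= ?lfunE /= ?mulrA // => a u w; rewrite linearP. Qed.

Definition reg : hmod H := HMod reg_act1 reg_actM.

Lemma reg_actE (x v : H) : hact reg x v = x * v.
Proof. by rewrite /= linfE ?lfunE // => a y z; rewrite linearP. Qed.

Section Submodule.
Variables (V : hmod H) (U : {vspace V}).
Hypothesis Ust : forall x v, v \in U -> hact V x v \in U.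

Let inc : 'Hom(subvs_of U, V) := linfun vsval.
Let prj : 'Hom(V, subvs_of U) := linfun (vsproj U).
Let act : 'Hom(H, 'End(subvs_of U)) := linfun (fun x => (prj \o (hact V x \o inc))%VF).

Let actE x u : vsval (act x u) = hact V x (vsval u).
Proof.
rewrite linfE; last by lin.
by rewrite !comp_lfunE !lfunE /= vsprojK // Ust // subvsP.
Qed.

Fact sub_act1 u : act 1 u = u.
Proof. by apply: subvs_inj; rewrite actE hact1. Qed.

Fact sub_actM x y u : act (x * y) u = act x (act y u).
Proof. by apply: subvs_inj; rewrite !actE hactM. Qed.

Definition submod : hmod H := HMod sub_act1 sub_actM.

Definition sub_inc : 'Hom(submod, V) := inc.

Lemma sub_incE u : sub_inc u = vsval u.
Proof. by rewrite /sub_inc lfunE. Qed.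

Lemma dim_submod : dim submod = \dim U.
Proof. by rewrite -[dim submod]dimvf (dimvf (subvs_of U)). Qed.

Lemma sub_factor (W : hmod H) (f : 'Hom(W, V)) : hlin f -> (forall w, f w \in U) ->
  exists2 f' : 'Hom(W, submod), hlin f' & f = (sub_inc \o f')%VF.
Proof.
move=> fh fU; exists (prj \o f)%VF.
  move=> x w; apply: subvs_inj.
  by rewrite actE !comp_lfunE !lfunE /= !vsprojK ?fU // fh.
by apply/lfunP=> w; rewrite !comp_lfunE sub_incE lfunE /= vsprojK.
Qed.

End Submodule.

Lemma limg_submod V W (f : 'Hom(V, W)) : hlin f ->
  forall x w, w \in limg f -> hact W x w \in limg f.
Proof. by move=> fh x w /memv_imgP[v _ ->]; rewrite -fh memv_img ?memvf. Qed.

Lemma lker_submod V W (f : 'Hom(V, W)) : hlin f ->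
  forall x v, v \in lker f -> hact V x v \in lker f.
Proof. by move=> fh x v; rewrite !memv_ker fh => /eqP->; rewrite linear0. Qed.

End Hmod.

(** Otherwise f would decrease strictly along repeated doublings. Doubling is chosen because a power
    of an endomorphism is later compared with its square. *)
Lemma stationary_double (f : nat -> nat) : exists n, (f n.+1 <= f (n.+1 + n.+1))%N.
Proof.
suff: forall d n, (f n.+1 <= d)%N -> exists n, (f n.+1 <= f (n.+1 + n.+1))%N.
  by move=> /(_ (f 1) 0 (leqnn _)).
elim=> [|d IHd] n fn; case: (leqP (f n.+1) (f (n.+1 + n.+1))) => [|lt_f]; try by exists n.
  by move: (leq_trans lt_f fn); rewrite ltn0.
by apply: (IHd (n + n.+1)%N); rewrite -ltnS -addSn (leq_trans lt_f).
Qed.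

(** * Modules with the Hom dimensions of the regular module *)

Section RegularLike.
Variables (k : fieldType) (H : hopfAlgebra k).
Implicit Types T U V W X Y : hmod H.

(** Freeness of rank one expressed by dimensions of Hom spaces, a form that an equivalence of
    categories can transport. *)
Definition regular_like X := forall W, \dim (homs X W) = dim W.

Lemma regular_like_reg : regular_like (reg H).
Proof.
move=> W; rewrite -[dim W]dimvf; apply/eqP; rewrite eqn_leq; apply/andP; split.
  apply: (dim_inj (f := fun f : 'Hom(reg H, W) => f (1 : H))) => [a f g _ _|f _|f].
  - by rewrite add_lfunE scale_lfunE.
  - exact: memvf.
  move=> /homsP fh f1; apply/lfunP=> x.
  by rewrite zero_lfunE -[x](mulr1 (x : H)) -reg_actE fh f1 linear0.
pose g w : 'Hom(reg H, W) := linfun (fun x : H => hact W x w).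
have gE w x : g w x = hact W x w by rewrite linfE //; lin.
apply: (dim_inj (f := g)) => [a v w _ _|w _|w _ /(congr1 (fun f : 'Hom(_, _) => f (1 : H)))].
- by apply/lfunP=> x; rewrite add_lfunE scale_lfunE !gE linearP.
- by apply/homsP=> x y; rewrite reg_actE !gE hactM.
by rewrite gE hact1 zero_lfunE.
Qed.

(** Projectivity by counting: with K the kernel of psi, dim Hom(X, V) is dim K + dim W, and maps
    killed by psi factor through K, so composition with psi fills Hom(X, W). *)
Lemma lift_surj X V W (psi : 'Hom(V, W)) (phi : 'Hom(X, W)) :
  regular_like X -> hlin psi -> limg psi = fullv -> hlin phi ->
  exists2 s : 'Hom(X, V), hlin s & (psi \o s)%VF = phi.
Proof.
move=> Xr psih psiS phih.
have cl : lin (fun s : 'Hom(X, V) => (psi \o s)%VF) by lin.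
pose c : 'Hom('Hom(X, V), 'Hom(X, W)) := linfun (fun s => (psi \o s)%VF).
have cE s : c s = (psi \o s)%VF by apply: linfE.
pose K := submod (lker_submod psih).
pose i : 'Hom('Hom(X, K), 'Hom(X, V)) := linfun (fun s => (sub_inc (lker_submod psih) \o s)%VF).
have dK : (\dim (homs X V :&: lker c) <= dim K)%N.
  rewrite -(Xr K) -(limg_ker_dim i (homs X K)).
  apply: leq_trans (leq_addl _ _); apply: dimvS; apply/subvP=> s.
  rewrite memv_cap memv_ker cE => /andP[/homsP sh /eqP s0].
  have sK x : s x \in lker psi.
    by rewrite memv_ker -comp_lfunE s0 zero_lfunE.
  have [s' s'h ->] := sub_factor (lker_submod psih) sh sK.
  apply/memv_imgP; exists s'; first exact/homsP.
  by rewrite linfE //; lin.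
have dc := limg_ker_dim c (homs X V); rewrite Xr in dc.
have := limg_ker_dim psi fullv; rewrite psiS !dimvf capfv -(dim_submod (lker_submod psih)) -/K => dp.
have cS : (c @: homs X V <= homs X W)%VS.
  apply/subvP=> _ /memv_imgP[s /homsP sh ->]; rewrite cE; apply/homsP.
  exact: hlin_comp.
have : phi \in (c @: homs X V)%VS.
  have /eqP-> : (c @: homs X V)%VS == homs X W.
    by rewrite -(geq_leqif (dimv_leqif_eq cS)) Xr -(leq_add2l (dim K)) dp -dc leq_add2r.
  exact/homsP.
by case/memv_imgP=> s /homsP sh ->; exists s; rewrite ?cE.
Qed.

(** If every such psi vanished, composition with a would embed Hom(Y, T) in Hom(X, T), and onto by
    equal dimensions. Then phi = psi a would satisfy phi b a = phi, contradicting phi b a = 0. *)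
Lemma transfer_nonzero X Y T (a : 'Hom(X, Y)) (b : 'Hom(Y, X)) (phi : 'Hom(X, T)) :
  regular_like X -> regular_like Y -> hlin a -> hlin b ->
  (forall x, a (b (a x)) = a x) -> hlin phi -> phi != 0 ->
  (forall x, phi (b (a x)) = 0) ->
  exists psi : 'Hom(Y, T), [/\ hlin psi, psi != 0 & forall y, psi (a (b y)) = 0].
Proof.
move=> Xr Yr ah bh aba phih phi0 phie.
have rl : lin (fun psi : 'Hom(Y, T) => (psi \o (a \o b))%VF) by lin.
pose U := (homs Y T :&: lker (linfun (fun psi : 'Hom(Y, T) => (psi \o (a \o b))%VF)))%VS.
have [U0|Un0] := eqVneq U 0%VS; last first.
  have := memv_pick U; rewrite memv_cap memv_ker linfE // => /andP[/homsP uh /eqP u0].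
  exists (vpick U); split; rewrite ?vpick0 // => y.
  by have := congr1 (fun h : 'Hom(Y, T) => h y) u0; rewrite /= !comp_lfunE zero_lfunE.
have [psi psih Epsi] : exists2 psi, psi \in homs Y T & (psi \o a)%VF = phi.
  apply: (@dim_inj_onto _ _ _ (homs Y T) (homs X T) (fun psi : 'Hom(Y, T) => (psi \o a)%VF)).
  - by move=> c f g _ _; rewrite comp_lfunDl comp_lfunZl.
  - by move=> f /homsP fh; apply/homsP; apply: hlin_comp.
  - move=> f fh f0; apply/eqP; rewrite -memv0 -U0 memv_cap fh memv_ker linfE //.
    by rewrite /= comp_lfunA f0 comp_lfun0l eqxx.
  - by rewrite Xr Yr.
  exact/homsP.
case/eqP: phi0; apply/lfunP=> x; rewrite zero_lfunE -(phie x) -Epsi !comp_lfunE.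
by rewrite aba.
Qed.

(** A nonzero quotient map on the complement of the idempotent e, with target of least dimension. It
    plays the part of a map onto a simple module. *)
Lemma minimal_target X (e : 'End(X)) : hlin (e : 'Hom(X, X)) ->
  (forall x, e (e x) = e x) -> e != \1%VF ->
  exists (T : hmod H) (phi : 'Hom(X, T)),
    [/\ hlin phi, phi != 0, forall x, phi (e x) = 0
      & forall T' (phi' : 'Hom(X, T')), hlin phi' -> phi' != 0 ->
          (forall x, phi' (e x) = 0) -> (dim T <= dim T')%N].
Proof.
move=> eh ee e1.
pose P T := exists2 phi : 'Hom(X, T), hlin phi & phi != 0 /\ forall x, phi (e x) = 0.
have: P X.
  exists (\1%VF - e); first by apply: hlinB => //; apply: hlin_id.
  split=> [|x]; first by rewrite subr_eq0 eq_sym.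
  by rewrite add_lfunE opp_lfunE id_lfunE ee subrr.
suff: forall n T, (dim T <= n)%N -> P T -> exists2 T, P T & forall T', P T' -> (dim T <= dim T')%N.
  move=> /(_ _ X (leqnn _)) M /M[T [phi phih [phi0 phie]] Tm].
  by exists T, phi; split=> // T' phi' h1 h2 h3; apply: Tm; exists phi'.
elim=> [|n IHn] T Tn PT; first by exists T => // T' _; apply: leq_trans Tn _.
(* Excluded middle is used because the condition ranges over all modules of smaller dimension. *)
case: (classic (exists2 T', P T' & (dim T' <= n)%N)) => [[T' PT' /IHn]|noT]; first exact.
exists T => // T' PT'; case: (leqP (dim T) (dim T')) => // lt; case: noT.
by exists T' => //; rewrite -ltnS (leq_trans lt).
Qed.

Fixpoint lpow (V : vectType k) (g : 'End(V)) n : 'End(V) :=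
  if n is n'.+1 then (g \o lpow g n')%VF else \1%VF.

Lemma lpowE (V : vectType k) (g : 'End(V)) n x : lpow g n x = iter n g x.
Proof. by elim: n => [|n IHn]; rewrite /= ?id_lfunE ?comp_lfunE ?IHn. Qed.

Lemma lpow_hlin X (g : 'End(X)) n : hlin (g : 'Hom(X, X)) -> hlin (lpow g n : 'Hom(X, X)).
Proof.
move=> gh; elim: n => [|n IHn] /=; first exact: hlin_id.
exact: (@hlin_comp _ _ X X X).
Qed.

(** With E the algebra of module endomorphisms, the right ideals g^n E and left ideals E g^n
    decrease; at an n where neither loses dimension between g^n and its square, g^n lies in both
    ideals of the square. *)
Lemma strongly_regular_power X (g : 'End(X)) : hlin (g : 'Hom(X, X)) ->
  exists n (y z : 'Hom(X, X)), [/\ hlin y, hlin z,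
    forall x, lpow g n.+1 x = lpow g n.+1 (lpow g n.+1 (y x))
  & forall x, lpow g n.+1 x = z (lpow g n.+1 (lpow g n.+1 x))].
Proof.
move=> gh; pose E := homs X X.
have ph n : hlin (lpow g n : 'Hom(X, X)) by apply: lpow_hlin.
have pD n m x : lpow g (n + m) x = lpow g n (lpow g m x) by rewrite !lpowE iterD.
have lr n : lin (fun y : 'End(X) => (lpow g n \o y)%VF) by lin.
have ll n : lin (fun y : 'End(X) => (y \o lpow g n)%VF) by lin.
pose R n := (linfun (fun y : 'End(X) => (lpow g n \o y)%VF) @: E)%VS.
pose L n := (linfun (fun y : 'End(X) => (y \o lpow g n)%VF) @: E)%VS.
have RS n : (R (n + n)%N <= R n)%VS.
  apply/subvP=> _ /memv_imgP[y /homsP yh ->]; apply/memv_imgP.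
  exists (lpow g n \o y)%VF; first by apply/homsP; apply: hlin_comp.
  by rewrite !linfE //; apply/lfunP=> x; rewrite !comp_lfunE pD.
have LS n : (L (n + n)%N <= L n)%VS.
  apply/subvP=> _ /memv_imgP[y /homsP yh ->]; apply/memv_imgP.
  exists (y \o lpow g n)%VF; first by apply/homsP; apply: hlin_comp.
  by rewrite !linfE //; apply/lfunP=> x; rewrite !comp_lfunE pD.
have [n le_n] := stationary_double (fun n => \dim (R n) + \dim (L n))%N.
have RE : R n.+1 = R (n.+1 + n.+1)%N.
  apply/esym/eqP; rewrite -(geq_leqif (dimv_leqif_eq (RS _))).
  by have := dimvS (LS n.+1); lia.
have LE : L n.+1 = L (n.+1 + n.+1)%N.
  apply/esym/eqP; rewrite -(geq_leqif (dimv_leqif_eq (LS _))).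
  by have := dimvS (RS n.+1); lia.
have : lpow g n.+1 \in R n.+1.
  apply/memv_imgP; exists \1%VF; first by apply/homsP; apply: hlin_id.
  by rewrite linfE // comp_lfun1r.
rewrite RE => /memv_imgP[y /homsP yh]; rewrite linfE // => Ey.
have : lpow g n.+1 \in L n.+1.
  apply/memv_imgP; exists \1%VF; first by apply/homsP; apply: hlin_id.
  by rewrite linfE // comp_lfun1l.
rewrite LE => /memv_imgP[z /homsP zh]; rewrite linfE // => Ez.
exists n, y, z; split=> // x; first by rewrite -pD {1}Ey comp_lfunE.
by rewrite -pD {1}Ez comp_lfunE.
Qed.

End RegularLike.

(** * Uniqueness of the regular module by growing a common summand *)

Section RegularUnique.
Variables (k : fieldType) (H : hopfAlgebra k).
Implicit Types T U V W X Y : hmod H.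

Lemma limg_full_min X T (phi : 'Hom(X, T)) :
  hlin phi -> phi != 0 ->
  (forall T' (phi' : 'Hom(X, T')), hlin phi' -> phi' != 0 ->
     (forall x, phi x = 0 -> phi' x = 0) -> (dim T <= dim T')%N) ->
  limg phi = fullv.
Proof.
move=> ph p0 pm.
have [phi' ph' E] := sub_factor (limg_submod ph) ph (fun x => memv_img phi (memvf x)).
have : (dim T <= dim (submod (limg_submod ph)))%N.
  apply: (pm _ phi') => // [|x px].
    by apply: contra p0 => /eqP p'0; rewrite E p'0 comp_lfun0r.
  by apply: subvs_inj; rewrite -[LHS]sub_incE -comp_lfunE -E px linear0.
rewrite dim_submod -(dimvf T) => le.
by apply/eqP; rewrite -(geq_leqif (dimv_leqif_eq (subvf _))).
Qed.

(* A pair (a, b) of this kind identifies a direct summand of X with a direct  *)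
(* summand of Y.                                                              *)
Record summand_pair X Y (a : 'Hom(X, Y)) (b : 'Hom(Y, X)) : Prop := SummandPair {
  sp_hlinl : hlin a;
  sp_hlinr : hlin b;
  sp_aba : forall x, a (b (a x)) = a x;
  sp_bab : forall y, b (a (b y)) = b y
}.

(** A minimal target of the complement in X is, by [transfer_nonzero], also one of the complement in
    Y. Both maps are then onto, and lifting each along the other gives s and t, which are cut down
    by the complementary projections. *)
Lemma summand_pair_proj X Y a b : @summand_pair X Y a b -> regular_like X -> regular_like Y ->
  (b \o a)%VF != \1%VF ->
  exists (s : 'Hom(X, Y)) (t : 'Hom(Y, X)) (T : hmod H) (phi : 'Hom(X, T)),
   [/\ hlin s, hlin t, phi != 0, forall x, phi (t (s x)) = phi x
     & [/\ forall x, b (s x) = 0, forall y, s (b y) = 0,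
         forall y, a (t y) = 0 & forall x, t (a x) = 0]].
Proof.
move=> [ah bh aba bab] Xr Yr ba1.
have eh : hlin (b \o a)%VF := hlin_comp bh ah.
have ee x : (b \o a)%VF ((b \o a)%VF x) = (b \o a)%VF x by rewrite !comp_lfunE aba.
have [T [phi [phih phi0 phie phim]]] := minimal_target eh ee ba1.
have {}phie x : phi (b (a x)) = 0 by rewrite -(phie x) comp_lfunE.
have [psi [psih psi0 psif]] := transfer_nonzero Xr Yr ah bh aba phih phi0 phie.
have phiS : limg phi = fullv.
  apply: limg_full_min => // T' phi' h' n' z'; apply: phim h' n' _ => x.
  by rewrite comp_lfunE; apply: z'.
have psiS : limg psi = fullv.
  apply: limg_full_min => // T' psi' h' n' z'.
  have [phi' [p1 p2 p3]] : exists phi' : 'Hom(X, T'), [/\ hlin phi', phi' != 0 & forall y, phi' (b (a y)) = 0].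
    apply: (transfer_nonzero Yr Xr bh ah bab h' n') => y.
    exact: z'.
  by apply: phim p1 p2 _ => x; rewrite comp_lfunE.
have [s0 s0h Es] := lift_surj Xr psih psiS phih.
have [t0 t0h Et] := lift_surj Yr phih phiS psih.
pose e' : 'Hom(X, X) := \1%VF - (b \o a)%VF.
pose f' : 'Hom(Y, Y) := \1%VF - (a \o b)%VF.
have e'E x : e' x = x - b (a x) by rewrite add_lfunE opp_lfunE id_lfunE comp_lfunE.
have f'E y : f' y = y - a (b y) by rewrite add_lfunE opp_lfunE id_lfunE comp_lfunE.
have e'h : hlin e' by apply: hlinB => //; apply: hlin_id.
have f'h : hlin f' by apply: hlinB; [apply: hlin_id | apply: hlin_comp].
have phie' x : phi (e' x) = phi x by rewrite e'E linearB /= phie subr0.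
have psif' y : psi (f' y) = psi y by rewrite f'E linearB /= psif subr0.
exists (f' \o (s0 \o e'))%VF, (e' \o (t0 \o f'))%VF, T, phi; split=> //.
- by do 2?apply: hlin_comp.
- by do 2?apply: hlin_comp.
- move=> x; rewrite !comp_lfunE phie' -(comp_lfunE phi t0) Et !psif'.
  by rewrite -(comp_lfunE psi s0) Es phie'.
split=> x; rewrite !comp_lfunE.
- by rewrite f'E linearB /= bab subrr.
- by rewrite [e' _]e'E bab subrr !linear0.
- by rewrite e'E linearB /= aba subrr.
by rewrite [f' (a _)]f'E aba subrr !linear0.
Qed.

(** Since phi t s = phi, powers of t s do not vanish. A strongly regular power h of it gives the
    idempotent h y = z h, orthogonal to b a, whose image also embeds in Y; adding it enlarges the
    common summand. *)
Lemma summand_pair_extend X Y a b : @summand_pair X Y a b ->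
  regular_like X -> regular_like Y -> (b \o a)%VF != \1%VF ->
  exists a' b', @summand_pair X Y a' b' /\
    (\dim (limg (b \o a)%VF) < \dim (limg (b' \o a')%VF))%N.
Proof.
move=> ab Xr Yr ba1; have [ah bh aba bab] := ab.
have [s [t [T [phi [sh th phi0 phits [bs sb at_ ta]]]]]] := summand_pair_proj ab Xr Yr ba1.
have gh : hlin (t \o s : 'Hom(X, X))%VF by apply: hlin_comp.
have [n [y [z [yh zh hy zh']]]] := strongly_regular_power gh.
pose h := lpow (t \o s)%VF n.+1.
have hh : hlin (h : 'Hom(X, X)) by apply: lpow_hlin.
have {}hy x : h x = h (h (y x)) by apply: hy.
have {}zh' x : h x = z (h (h x)) by apply: zh'.
pose s2 : 'Hom(X, Y) := (s \o lpow (t \o s)%VF n)%VF.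
have s2h : hlin s2 by apply: hlin_comp => //; apply: lpow_hlin.
have hE x : h x = t (s2 x) by rewrite /h /= !comp_lfunE.
have hb w : h (b w) = 0 by rewrite /h lpowE iterSr comp_lfunE sb linear0 -lpowE linear0.
have ah0 x : a (h x) = 0 by rewrite hE at_.
have phih x : phi (h x) = phi x.
  by rewrite /h lpowE; elim: n.+1 => //= j IHj; rewrite comp_lfunE phits.
have zy x : z (h x) = h (y x) by rewrite hy -zh'.
have ee x : h (y (h (y x))) = h (y x) by rewrite -zy -hy zy.
have bs2 x : b (s2 x) = 0 by rewrite comp_lfunE bs.
pose a1 : 'Hom(X, Y) := (s2 \o (y \o (h \o y)))%VF.
pose b1 : 'Hom(Y, X) := (h \o (y \o t))%VF.
have a1E x : a1 x = s2 (y (h (y x))) by rewrite !comp_lfunE.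
have b1E w : b1 w = h (y (t w)) by rewrite !comp_lfunE.
have eb w : h (y (b w)) = 0 by rewrite -zy hb linear0.
have ab1 w : a (b1 w) = 0 by rewrite b1E ah0.
have ba10 x : b (a1 x) = 0 by rewrite a1E bs2.
have a1b w : a1 (b w) = 0 by rewrite a1E eb !linear0.
have b1a x : b1 (a x) = 0 by rewrite b1E ta !linear0.
have b1a1 x : b1 (a1 x) = h (y x) by rewrite b1E a1E -hE !ee.
pose a2 : 'Hom(X, Y) := a + a1.
pose b2 : 'Hom(Y, X) := b + b1.
have a2E x : a2 x = a x + a1 x by rewrite add_lfunE.
have b2E w : b2 w = b w + b1 w by rewrite add_lfunE.
have baE x : (b2 \o a2)%VF x = b (a x) + h (y x).
  by rewrite comp_lfunE b2E a2E !linearD /= ba10 b1a addr0 add0r b1a1.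
exists a2, b2; split; first split.
- by apply: hlinD => //; do 3?apply: hlin_comp => //.
- by apply: hlinD => //; do 2?apply: hlin_comp => //.
- move=> x; rewrite -(comp_lfunE b2 a2) baE !a2E !linearD /= aba ah0 a1b.
  by rewrite addr0 add0r a1E ee -a1E.
- move=> w; rewrite -(comp_lfunE b2 a2) baE !b2E !linearD /= bab ab1 linear0 addr0.
  by rewrite eb add0r b1E ee.
rewrite ltn_neqAle; have sub : (limg (b \o a)%VF <= limg (b2 \o a2)%VF)%VS.
  apply/subvP=> _ /memv_imgP[x _ ->]; apply/memv_imgP; exists (b (a x)); first exact: memvf.
  by rewrite baE eb addr0 comp_lfunE aba.
rewrite dimvS // andbT; apply: contra phi0 => /eqP dE.
(* If the image did not grow, h y would vanish, and phi = phi h = phi h h y would be zero. *)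
have /eqP E : limg (b \o a)%VF == limg (b2 \o a2)%VF.
  by rewrite -(geq_leqif (dimv_leqif_eq sub)) dE.
apply/eqP/lfunP=> x; rewrite zero_lfunE -phih hy.
have : b (a x) + h (y x) \in limg (b \o a)%VF by rewrite E -baE memv_img ?memvf.
case/memv_imgP=> u _; rewrite comp_lfunE => Eu.
have := congr1 (fun v => b (a v)) Eu.
rewrite (linearD a) /= aba ah0 addr0 aba -Eu -[X in X = _]addr0 => /addrI <-.
by rewrite !linear0.
Qed.

(** Extension starts from the zero pair and stops only at b a = 1, since dimensions are bounded. *)
Theorem regular_like_iso X Y : regular_like X -> regular_like Y ->
  exists (a : 'Hom(X, Y)) (b : 'Hom(Y, X)),
    [/\ hlin a, hlin b, forall x, b (a x) = x & forall y, a (b y) = y].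
Proof.
move=> Xr Yr.
suff [a [b [[ah bh aba bab] ba1]]] : exists a b, @summand_pair X Y a b /\ (b \o a)%VF = \1%VF.
  have {}ba1 x : b (a x) = x by rewrite -comp_lfunE ba1 id_lfunE.
  exists a, b; split=> // y.
  (* With b a = 1, composition with b embeds Hom(X, Y) in Hom(Y, Y), which has the same dimension;
     so b has a left inverse too. *)
  have [c ch cb] : exists2 c, c \in homs X Y & (c \o b)%VF = \1%VF.
    apply: (@dim_inj_onto _ _ _ (homs X Y) (homs Y Y) (fun c : 'Hom(X, Y) => (c \o b)%VF)).
    - by move=> r f g _ _; rewrite comp_lfunDl comp_lfunZl.
    - by move=> f /homsP fh; apply/homsP; apply: hlin_comp.
    - move=> f fh f0; apply/lfunP=> x; rewrite zero_lfunE -(ba1 x).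
      by rewrite -(comp_lfunE f b) f0 zero_lfunE.
    - by rewrite Xr Yr.
    by apply/homsP; apply: hlin_id.
  have cbE v : c (b v) = v by rewrite -comp_lfunE cb id_lfunE.
  by rewrite -[LHS]cbE ba1 cbE.
suff: forall n a b, @summand_pair X Y a b -> (dim X - \dim (limg (b \o a)%VF) <= n)%N ->
    exists a b, @summand_pair X Y a b /\ (b \o a)%VF = \1%VF.
  apply; [|exact: leqnn]; split; try exact: hlin0.
  - by move=> x; rewrite !zero_lfunE.
  by move=> y; rewrite !zero_lfunE.
elim=> [|n IHn] a b ab; have [ba1 _|ba1 le] := eqVneq (b \o a)%VF \1%VF; try by exists a, b.
  have [a' [b' [_ lt]]] := summand_pair_extend ab Xr Yr ba1.
  by have := dimvS (subvf (limg (b' \o a')%VF)); rewrite dimvf; lia.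
have [a' [b' [ab' lt]]] := summand_pair_extend ab Xr Yr ba1.
apply: (IHn _ _ ab'); have := dimvS (subvf (limg (b' \o a')%VF)); rewrite dimvf; lia.
Qed.

End RegularUnique.

(** * Freeness of the regular module tensored with a module *)

Section RegularTensor.
Variables (k : fieldType) (H : hopfAlgebra k).
Implicit Types V W : hmod H.
Local Notation D := (cop H).
Local Notation e x := (counit H x : k).
Local Notation S := (antipode H).

Lemma htens_actE V W x t :
  hact (htens V W) x t = \sw a b <- D x; tmap (hact V a) (hact W b) t.
Proof.
rewrite /= comp_lfunE -/(tcon (D x) _).
by apply: (tcon_lin (g := fun f : 'End(tens V W) => f t)) => a f g; rewrite add_lfunE scale_lfunE.
Qed.

Lemma htens_act_ptens V W x v w :
  hact (htens V W) x (ptens v w) = \sw a b <- D x; ptens (hact V a v) (hact W b w).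
Proof. by rewrite htens_actE; apply: tcon_ext => a b; rewrite tmapE. Qed.

Variable V : hmod H.
Local Notation R := (reg H).

(** The module map sending 1 to 1 (x) v. For v in a basis these are the inclusions of the free
    summands, with [tens_to_reg] at the coordinate forms as projections. *)
Definition reg_to_tens (v : V) : 'Hom(R, htens R V) :=
  linfun (fun h : H => \sw a b <- D h; ptens (a : R) (hact V b v)).

Definition tens_to_reg (xi : 'Hom(V, k^o)) : 'Hom(htens R V, R) :=
  linfun (fun t : tens R V => \sw h v <- t; \sw a b <- D h; (xi (hact V (S b) v) : k) *: (a : R)).

Lemma reg_to_tensE v h : reg_to_tens v h = \sw a b <- D h; ptens (a : R) (hact V b v).
Proof. by rewrite /reg_to_tens linfE //; lin. Qed.

Lemma tens_to_regE xi t :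
  tens_to_reg xi t = \sw h v <- t; \sw a b <- D h; (xi (hact V (S b) v) : k) *: (a : R).
Proof. by rewrite /tens_to_reg linfE //; lin. Qed.

Lemma reg_to_tens_hlin v : hlin (reg_to_tens v).
Proof.
move=> x h; rewrite reg_actE !reg_to_tensE hopf_copM; last by lin.
rewrite (tcon_lfun (hact (htens R V) x)) tcon_exch; apply: tcon_ext => a b.
by rewrite htens_act_ptens; apply: tcon_ext => c d; rewrite reg_actE hactM.
Qed.

Lemma tens_to_reg_hlin (I : integrals H) xi : hlin (tens_to_reg xi).
Proof.
move=> x t; rewrite -[LHS]comp_lfunE -[RHS]comp_lfunE; congr (fun_of_lfun _ t).
apply: tens_ext => h v; rewrite [LHS]comp_lfunE [RHS]comp_lfunE htens_act_ptens.
rewrite !tens_to_regE tcon_tcon [in RHS]tcon_ptens; last by lin.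
transitivity (\sw a b <- D x; \sw c d <- D a; \sw p q <- D h;
  (xi (hact V (S q * (S d * b)) v) : k) *: (c * p : R)).
  apply: tcon_ext => a b; rewrite tcon_ptens; last by lin.
  rewrite reg_actE hopf_copM; last by lin.
  apply: tcon_ext => c d; apply: tcon_ext => p q.
  by rewrite -hactM mulrA -(antiM I).
rewrite hopf_coA; last by split=> ? ?; lin.
transitivity (\sw a b <- D x; (e b : k) *: (\sw p q <- D h; (xi (hact V (S q) v) : k) *: (a * p : R))).
  apply: tcon_ext => a b.
  rewrite -(tcon_lin (g := fun z => \sw p q <- D h; (xi (hact V (S q * z) v) : k) *: (a * p : R)));
    last by lin.
  rewrite hopf_antil (tcon_lin (g := fun z => _ *: z)); last by lin.
  by apply: tcon_ext => p q; rewrite falg_scaler mulr1 linearZ scale_lfunE functZ scalerA.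
rewrite (counitr_lin (hopf_cogroupoid I) tt tt x (f := fun a => \sw p q <- D h; (xi (hact V (S q) v) : k) *: (a * p : R)));
  last by lin.
rewrite (tcon_lfun (hact R x)); apply: tcon_ext => p q.
by rewrite linearZ /= reg_actE.
Qed.

Lemma tens_to_regK (I : integrals H) xi v h : tens_to_reg xi (reg_to_tens v h) = (xi v : k) *: h.
Proof.
rewrite reg_to_tensE tens_to_regE tcon_tcon.
transitivity (\sw a b <- D h; \sw c d <- D a; (xi (hact V (S d * b) v) : k) *: (c : R)).
  apply: tcon_ext => a b; rewrite tcon_ptens; last by lin.
  by apply: tcon_ext => c d; rewrite hactM.
rewrite hopf_coA; last by split=> ? ?; lin.
rewrite -[in RHS](hopf_counitr h) (tcon_lin (g := fun z => _ *: z)); last by lin.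
apply: tcon_ext => a b.
rewrite -(tcon_lin (g := fun z => (xi (hact V z v) : k) *: (a : R))); last by lin.
by rewrite hopf_antil linearZ scale_lfunE hact1 functZ scalerA mulrC.
Qed.

(** Recombining the coordinates gives h_1 (x) h_2 S(h_3) v = h (x) v. *)
Lemma sum_reg_to_tens (I : integrals H) (xi : 'I_(dim V) -> 'Hom(V, k^o)) t :
  (forall v i, xi i v = v2r v 0 i) ->
  \sum_j reg_to_tens (tbase j) (tens_to_reg (xi j) t) = t.
Proof.
move=> xiE; rewrite -[RHS]tcon_id.
transitivity (\sw h v <- t; \sum_j reg_to_tens (tbase j)
    (\sw a b <- D h; (xi j (hact V (S b) v) : k) *: (a : R))).
  rewrite tconS (eq_bigr (fun j => \sum_p \sum_q t p q *: reg_to_tens (tbase j)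
    (\sw a b <- D (tbase p); (xi j (hact V (S b) (tbase q)) : k) *: (a : R)))); last first.
    move=> j _; rewrite tens_to_regE (tcon_lin (g := fun z => reg_to_tens _ z)) ?tconS //; lin.
  rewrite exchange_big; apply: eq_bigr => p _; rewrite exchange_big.
  by apply: eq_bigr => q _; rewrite scaler_sumr.
apply: tcon_ext => h v.
transitivity (\sw a b <- D h; reg_to_tens (hact V (S b) v) a).
  rewrite [RHS]tconS (eq_bigr (fun j => \sum_p \sum_q D h p q *: ((xi j (hact V (S (tbase q)) v) : k) *:
     reg_to_tens (tbase j) (tbase p)))); last first.
    move=> j _; rewrite (tcon_lin (g := fun z => reg_to_tens _ z)) ?tconS; last by lin.
    by do 2!apply: eq_bigr => ? _; rewrite linearZ.
  rewrite exchange_big; apply: eq_bigr => p _; rewrite exchange_big.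
  apply: eq_bigr => q _; rewrite -scaler_sumr; congr (_ *: _).
  have ml : lin (fun w => reg_to_tens w (tbase p)).
    have ml0 : lin (fun w => \sw a b <- D (tbase p); ptens (a : R) (hact V b w)) by lin.
    by move=> a u w; rewrite !reg_to_tensE ml0.
  rewrite [in RHS](tbase_sum (hact V (S (tbase q)) v)) (lin_sum ml); apply: eq_bigr => j _.
  by rewrite (linZ ml) xiE.
transitivity (\sw a b <- D h; \sw c d <- D a; ptens (c : R) (hact V (d * S b) v)).
  by apply: tcon_ext => a b; rewrite reg_to_tensE; apply: tcon_ext => c d; rewrite hactM.
rewrite hopf_coA; last by split=> ? ?; lin.
rewrite -[in RHS](hopf_counitr h) (tcon_lin (g := fun z => ptens (z : R) v)); last by lin.
apply: tcon_ext => a b.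
rewrite -(tcon_lin (g := fun z => ptens (a : R) (hact V z v))); last by lin.
rewrite hopf_antir linearZ scale_lfunE hact1 (linZ (f := fun z => ptens (a : R) z)); last by lin.
by rewrite (linZ (f := fun z => ptens (z : R) v)) //; lin.
Qed.

End RegularTensor.

Lemma hiso_inv (k : fieldType) (H : hopfAlgebra k) (V W : hmod H) (f : 'Hom(V, W)) :
  hiso f -> [/\ hlin f, hlin (f^-1)%VF, cancel f (f^-1)%VF & cancel (f^-1)%VF f].
Proof.
case=> fh [g [gh gf fg]].
have gK x : g (f x) = x by rewrite -comp_lfunE gf id_lfunE.
have fK x : f (g x) = x by rewrite -comp_lfunE fg id_lfunE.
have fi : cancel f (f^-1)%VF by apply: lker0_lfunK; apply/lker0P; apply: can_inj gK.
have E : (f^-1)%VF = g by apply/lfunP=> w; rewrite -{1}(fK w) fi.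
by split; rewrite ?E.
Qed.

(** * Tensor equivalences *)

Section Functor.
Variables (k : fieldType) (H H' : hopfAlgebra k) (F : hfunctor H H').
Implicit Types V W : hmod H.

Lemma fmor0 V W : fmor F (0 : 'Hom(V, W)) = 0.
Proof.
have := @fmor_linear _ _ _ F V W 1 0 0 (@hlin0 _ _ V W) (@hlin0 _ _ V W).
by rewrite !scale1r addr0 => E; apply: (addrI (fmor F 0)); rewrite addr0 -E.
Qed.

Lemma fmorZ V W a (f : 'Hom(V, W)) : hlin f -> fmor F (a *: f) = a *: fmor F f.
Proof.
move=> fh; rewrite -[a *: f]addr0 fmor_linear //; last exact: hlin0.
by rewrite fmor0 addr0.
Qed.

Lemma fmor_sum V W (J : finType) (f : J -> 'Hom(V, W)) : (forall j, hlin (f j)) ->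
  fmor F (\sum_j f j) = \sum_j fmor F (f j).
Proof.
move=> fh; elim: (index_enum J) => [|j r IHr]; first by rewrite !big_nil fmor0.
rewrite !big_cons -[f j]scale1r fmor_linear ?IHr ?scale1r //.
by elim/big_ind: _ => //; [exact: hlin0 | exact: hlinD].
Qed.

Lemma fmor_compE (U V W : hmod H) (f : 'Hom(V, W)) (g : 'Hom(U, V)) x : hlin f -> hlin g ->
  fmor F (f \o g)%VF x = fmor F f (fmor F g x).
Proof. by move=> fh gh; rewrite fmor_comp // comp_lfunE. Qed.

Hypothesis Feq : is_equivalence F.

Lemma equiv_faithful V W (f : 'Hom(V, W)) : hlin f -> fmor F f = 0 -> f = 0.
Proof.
have [G [eta [eps [etai etan _ _]]]] := Feq => fh f0.
have [_ _ eK _] := hiso_inv (etai W).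
apply/lfunP=> v; rewrite zero_lfunE; apply: (can_inj eK).
have := congr1 (fun h : 'Hom(_, _) => h v) (etan _ _ _ fh).
rewrite /= !comp_lfunE f0 linear0 => <-.
have -> : fmor G (0 : 'Hom(F V, F W)) = 0.
  have := @fmor_linear _ _ _ G (F V) (F W) 1 0 0 (@hlin0 _ _ _ _) (@hlin0 _ _ _ _).
  by rewrite !scale1r addr0 => E; apply: (addrI (fmor G 0)); rewrite addr0 -E.
by rewrite zero_lfunE.
Qed.

Lemma equiv_full V W (g : 'Hom(F V, F W)) : hlin g ->
  exists2 f : 'Hom(V, W), hlin f & fmor F f = g.
Proof.
have [G [eta [eps [etai etan epsi epsn]]]] := Feq => gh.
have [eVh _ _ eVK] := hiso_inv (etai V).
have [_ eWh _ eWK] := hiso_inv (etai W).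
have Gh : hlin (fmor G g) by apply: fmor_hlin.
pose f : 'Hom(V, W) := ((eta W)^-1 \o (fmor G g \o eta V))%VF.
have fh : hlin f by do 2?apply: hlin_comp.
exists f => //.
have GE : fmor G (fmor F f) = fmor G g.
  apply/lfunP=> x; rewrite -(eVK x) -[LHS]comp_lfunE etan // !comp_lfunE.
  by rewrite eWK.
have [_ _ _ epsK] := hiso_inv (epsi (F V)).
apply/lfunP=> x; rewrite -(epsK x) -[LHS]comp_lfunE -[RHS]comp_lfunE !epsn //.
  by rewrite GE.
exact: fmor_hlin.
Qed.

Lemma equiv_surj (W : hmod H') : exists V (i : 'Hom(F V, W)), hiso i.
Proof. by have [G [eta [eps [_ _ epsi _]]]] := Feq; exists (G W), (eps W). Qed.

Lemma dim_homs_equiv V W : \dim (homs (F V) (F W)) = \dim (homs V W).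
Proof.
have fl a x y : x \in homs V W -> y \in homs V W -> fmor F (a *: x + y) = a *: fmor F x + fmor F y.
  by move=> /homsP xh /homsP yh; apply: fmor_linear.
apply/eqP; rewrite eqn_leq; apply/andP; split.
  apply: (dim_onto fl) => g /homsP/equiv_full[f /homsP fh <-].
  by exists f.
apply: (dim_inj fl) => f /homsP fh; first exact/homsP/fmor_hlin.
exact: equiv_faithful.
Qed.

Variable M : monoidal_structure F.
Variable I : integrals H.

Local Notation R := (reg H).
Local Notation Q := (F R).

Lemma dim_reg_image_gt0 : (0 < dim Q)%N.
Proof.
rewrite lt0n; apply/eqP => Q0.
have : (\1%VF : 'Hom(R, R)) = 0.
  apply: equiv_faithful; first exact: hlin_id.
  rewrite fmor_id; apply/lfunP=> x; rewrite id_lfunE zero_lfunE.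
  by apply/eqP; rewrite -memv0; suff /eqP<- : {:Q}%VS == 0%VS; rewrite ?memvf // -dimv_eq0 dimvf Q0.
move/lfunP/(_ (1 : H)); rewrite id_lfunE zero_lfunE => /eqP.
by rewrite (negPf (oner_neq0 H)).
Qed.

(** F(H (x) V) is isomorphic to Q (x) F(V) by the monoidal structure and to dim V copies of Q by
    freeness; the nonzero factor dim Q cancels. *)
Lemma dim_equiv V : dim (F V) = dim V.
Proof.
have [_ _ JK JVK] := hiso_inv (mJ_iso M R V).
pose xi i : 'Hom(V, k^o) := linfun (fun v => v2r v 0 i : k^o).
have xiE v i : xi i v = v2r v 0 i.
  by rewrite linfE // => a x y; rewrite linearP !mxE.
have mh v : hlin (reg_to_tens v) by apply: reg_to_tens_hlin.
have nh j : hlin (tens_to_reg (xi j)) by apply: tens_to_reg_hlin I _.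
have := @dim_copies k V (F (htens R V)) Q (fun j => fmor F (reg_to_tens (tbase j)))
  (fun j => fmor F (tens_to_reg (xi j))).
rewrite -(dim_iso JK JVK) -[dim (htens Q (F V))]/(dim (tens Q (F V))) dim_tens => E.
apply/eqP; rewrite -(eqn_pmul2l dim_reg_image_gt0) E ?(mulnC (dim V)) // => [i j y|x].
  rewrite -fmor_compE //.
  have -> : (tens_to_reg (xi i) \o reg_to_tens (tbase j) = (i == j)%:R *: \1)%VF.
    apply/lfunP=> h; rewrite comp_lfunE scale_lfunE id_lfunE tens_to_regK //.
    by rewrite xiE /tbase r2vK mxE eqxx.
  by rewrite fmorZ ?fmor_id ?scale_lfunE ?id_lfunE //; apply: hlin_id.
under eq_bigr => j _ do rewrite -fmor_compE //.
rewrite -sum_lfunE -fmor_sum; last by move=> j; apply: hlin_comp.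
rewrite (_ : \sum_j _ = \1%VF) ?fmor_id ?id_lfunE //.
apply/lfunP=> t; rewrite sum_lfunE id_lfunE.
under eq_bigr => j _ do rewrite comp_lfunE.
exact: sum_reg_to_tens I _ _ _.
Qed.

(** Every W is isomorphic to some F(V), and dim Hom(Q, F(V)) = dim Hom(H, V) = dim V = dim F(V). *)
Lemma regular_like_image : regular_like Q.
Proof.
move=> W; have [V [i ii]] := equiv_surj W.
have [ih iVh iK iVK] := hiso_inv ii.
rewrite -(dim_iso iK iVK) dim_equiv -(regular_like_reg V) -dim_homs_equiv.
have cl : forall a x y, x \in homs Q W -> y \in homs Q W ->
    (i^-1 \o (a *: x + y) = a *: (i^-1 \o x) + (i^-1 \o y))%VF.
  by move=> a x y _ _; rewrite comp_lfunDr comp_lfunZr.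
apply/eqP; rewrite eqn_leq; apply/andP; split.
  apply: (dim_inj (U' := homs Q (F V)) cl) => f.
    by move/homsP=> fh; apply/homsP; apply: hlin_comp.
  move=> _ f0; apply/lfunP=> x; rewrite zero_lfunE -[f x]iVK -[_ (f x)]comp_lfunE f0.
  by rewrite zero_lfunE linear0.
apply: (dim_onto (U' := homs Q (F V)) cl) => g /homsP gh; exists (i \o g)%VF.
  by apply/homsP; apply: hlin_comp.
by apply/lfunP=> x; rewrite !comp_lfunE iK.
Qed.

End Functor.

(** * The structure of a Hopf algebra as maps of its regular module *)

Section RegularMaps.
Variables (k : fieldType) (H : hopfAlgebra k).
Local Notation R := (reg H).

Definition rmul (a : H) : 'Hom(R, R) := linfun (fun x : H => x * a).

Lemma rmulE a (x : H) : rmul a x = x * a.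
Proof. by rewrite /rmul linfE //; lin. Qed.

Lemma rmul_hlin a : hlin (rmul a).
Proof. by move=> x v; rewrite !reg_actE !rmulE mulrA. Qed.

Lemma rmul_linear c a b : rmul (c *: a + b) = c *: rmul a + rmul b.
Proof.
by apply/lfunP=> x; rewrite add_lfunE scale_lfunE !rmulE mulrDr falg_scaler.
Qed.

Definition cop_reg : 'Hom(R, htens R R) := cop H.

Lemma cop_reg_hlin : hlin cop_reg.
Proof.
move=> x v; rewrite reg_actE; apply: tcon_inj => U f fb.
rewrite hopf_copM // htens_actE tcon_tcon; apply: tcon_ext => a b.
by rewrite tcon_tmap //; apply: tcon_ext => c d; rewrite !reg_actE.
Qed.

Definition counit_reg : 'Hom(R, hunit H) := counit H.

Lemma counit_reg_hlin : hlin counit_reg.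
Proof. by move=> x v; rewrite reg_actE [RHS]unit_actE; apply: counitM. Qed.

Lemma tmap_hlin (V V' W W' : hmod H) (f : 'Hom(V, V')) (g : 'Hom(W, W')) : hlin f -> hlin g ->
  hlin (tmap f g : 'Hom(htens V W, htens V' W')).
Proof.
move=> fh gh x t; rewrite !htens_actE (tcon_lfun (tmap f g)); apply: tcon_ext => a b.
rewrite -[LHS]comp_lfunE -[RHS]comp_lfunE; congr (fun_of_lfun _ t); apply: tens_ext => v w.
by rewrite !comp_lfunE !tmapE fh gh.
Qed.

Lemma tens3_ext (U V W X : vectType k) (f g : 'Hom(tens (tens U V) W, X)) :
  (forall u v w, f (ptens (ptens u v) w) = g (ptens (ptens u v) w)) -> f = g.
Proof.
move=> fg; apply: tens_ext => s w; rewrite -(tcon_id s).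
rewrite (tcon_lin (g := fun s => f (ptens s w))); last by lin.
rewrite (tcon_lin (g := fun s => g (ptens s w))); last by lin.
exact: tcon_ext.
Qed.

Lemma tassoc_hlin (U V W : hmod H) :
  hlin (tassoc U V W : 'Hom(htens (htens U V) W, htens U (htens V W))).
Proof.
move=> x t; rewrite -[LHS]comp_lfunE -[RHS]comp_lfunE; congr (fun_of_lfun _ t).
apply: tens3_ext => u v w; rewrite [LHS]comp_lfunE [RHS]comp_lfunE tassoc_ptens.
rewrite (@htens_act_ptens _ _ (htens U V) W x (ptens u v) w) (@htens_act_ptens _ _ U (htens V W)).
rewrite (tcon_lfun (tassoc U V W)).
transitivity (\sw a b <- cop H x; \sw c d <- cop H a;
  ptens (hact U c u) (ptens (hact V d v) (hact W b w))).
  apply: tcon_ext => a b; rewrite htens_act_ptens.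
  rewrite (tcon_lin (g := fun s => tassoc U V W (ptens s _))); last by lin.
  by apply: tcon_ext => c d; rewrite tassoc_ptens.
rewrite hopf_coA; last by split=> ? ?; lin.
apply: tcon_ext => a b; rewrite htens_act_ptens.
by rewrite (tcon_lin (g := fun s => ptens _ s)) //; lin.
Qed.

Lemma tunitl_ptens (V : vectType k) (a : k^o) (v : V) : tunitl V (ptens a v) = (a : k) *: v.
Proof.
rewrite /tunitl tliftE //; apply: bilinI => ?; last by lin.
by apply: lin_scalel; apply: lin_id.
Qed.

Lemma tunitr_ptens (V : vectType k) (a : k^o) (v : V) : tunitr V (ptens v a) = (a : k) *: v.
Proof.
rewrite /tunitr tliftE //; apply: bilinI => ?; first by lin.
by apply: lin_scalel; apply: lin_id.
Qed.

Lemma tunitl_hlin (V : hmod H) : hlin (tunitl V : 'Hom(htens (hunit H) V, V)).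
Proof.
move=> x t; rewrite -[LHS]comp_lfunE -[RHS]comp_lfunE; congr (fun_of_lfun _ t).
apply: tens_ext => a v; rewrite [LHS]comp_lfunE [RHS]comp_lfunE tunitl_ptens htens_act_ptens.
rewrite (tcon_lfun (tunitl V)) linearZ /= -[in RHS](hopf_counitl x).
rewrite (tcon_lin (g := fun z => (a : k) *: hact V z v)); last by lin.
apply: tcon_ext => c d; rewrite tunitl_ptens unit_actE linearZ scale_lfunE scalerA.
by rewrite mulrC.
Qed.

Lemma tunitr_hlin (V : hmod H) : hlin (tunitr V : 'Hom(htens V (hunit H), V)).
Proof.
move=> x t; rewrite -[LHS]comp_lfunE -[RHS]comp_lfunE; congr (fun_of_lfun _ t).
apply: tens_ext => v a; rewrite [LHS]comp_lfunE [RHS]comp_lfunE tunitr_ptens htens_act_ptens.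
rewrite (tcon_lfun (tunitr V)) linearZ /= -[in RHS](hopf_counitr x).
rewrite (tcon_lin (g := fun z => (a : k) *: hact V z v)); last by lin.
apply: tcon_ext => c d; rewrite tunitr_ptens unit_actE linearZ scale_lfunE scalerA.
by rewrite mulrC.
Qed.

Lemma reg_to_tens_rmul (a : H) :
  reg_to_tens (V := R) a
  = ((tmap \1 (rmul a) : 'Hom(htens R R, htens R R)) \o cop_reg)%VF.
Proof.
apply/lfunP=> h; rewrite reg_to_tensE comp_lfunE [RHS]tmap_tcon.
by apply: tcon_ext => b c; rewrite id_lfunE rmulE reg_actE.
Qed.

Lemma hlin_tcon (V W : hmod H) (A B : vectType k) (t : tens A B) (f : A -> B -> 'Hom(V, W)) :
  (forall a b, hlin (f a b)) -> hlin (tcon t f).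
Proof.
move=> fh; rewrite tconS; apply: hlin_sum => i; apply: hlin_sum => j; exact: hlinZ.
Qed.

Lemma tmul_assoc (s t u : tens H H) : tmul (tmul s t) u = tmul s (tmul t u).
Proof.
apply: tcon_inj => U f fb; rewrite !tcon_tmul //; last by lin.
apply: tcon_ext => a b; rewrite tcon_tmul; last by lin.
by do 2!apply: tcon_ext => ? ?; rewrite !mulrA.
Qed.

Lemma tmul1l (t : tens H H) : tmul (ptens 1 1) t = t.
Proof.
apply: tcon_inj => U f fb; rewrite tcon_tmul // tcon_ptens; last by lin.
by apply: tcon_ext => a b; rewrite !mul1r.
Qed.

Lemma tmul1r (t : tens H H) : tmul t (ptens 1 1) = t.
Proof.
apply: tcon_inj => U f fb; rewrite tcon_tmul //; apply: tcon_ext => a b.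
by rewrite tcon_ptens ?mulr1 //; lin.
Qed.

Lemma tmul_linr (t : tens H H) : lin (tmul t).
Proof. by rewrite /tmul; apply: lin_tconr => a b; apply: lin_tconl; apply: lin_id. Qed.

(** Left multiplication by t is onto, hence injective, so a right inverse is also a left inverse. *)
Lemma tmul_onto_inv (t : tens H H) : (forall w, exists s, tmul t s = w) ->
  exists s, tmul t s = ptens 1 1 /\ tmul s t = ptens 1 1.
Proof.
move=> tS; have [s ts] := tS (ptens 1 1); exists s; split=> //.
pose L : 'End(tens H H) := linfun (tmul t).
have LE w : L w = tmul t w by rewrite linfE //; apply: tmul_linr.
have Lf : limg L = fullv.
  apply/vspaceP=> w; rewrite memvf; have [u <-] := tS w.
  by rewrite -LE memv_img ?memvf.
have Li : injective L.
  apply/lker0P; rewrite -dimv_eq0; have := limg_ker_dim L fullv.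
  by rewrite Lf capfv => /eqP; rewrite -[X in _ == X]add0n eqn_add2r.
by apply: Li; rewrite !LE -tmul_assoc ts tmul1l tmul1r.
Qed.

End RegularMaps.

(** * The coalgebra structure carried by the image of the regular module *)

Section TwistOfEquivalence.
Variables (k : fieldType) (H H' : hopfAlgebra k) (I : integrals H) (I' : integrals H').
Variables (F : hfunctor H H') (Feq : is_equivalence F) (M : monoidal_structure F).
Local Notation R := (reg H).
Local Notation Q := (F R).
Local Notation J := (mJ M).

Definition im_counit : 'Hom(Q, hunit H') := ((mphi M)^-1 \o fmor F (counit_reg H))%VF.

Definition im_cop : 'Hom(Q, htens Q Q) := ((J R R)^-1 \o fmor F (cop_reg H))%VF.

Lemma im_counit_hlin : hlin im_counit.
Proof.
have [_ h _ _] := hiso_inv (mphi_iso M).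
by apply: hlin_comp h _; apply: fmor_hlin; apply: counit_reg_hlin.
Qed.

Lemma im_cop_hlin : hlin im_cop.
Proof.
have [_ h _ _] := hiso_inv (mJ_iso M R R).
by apply: hlin_comp h _; apply: fmor_hlin; apply: cop_reg_hlin.
Qed.

Lemma im_copE q : J R R (im_cop q) = fmor F (cop_reg H) q.
Proof. by have [_ _ _ K] := hiso_inv (mJ_iso M R R); rewrite comp_lfunE K. Qed.

Lemma im_counitE q : mphi M (im_counit q) = fmor F (counit_reg H) q.
Proof. by have [_ _ _ K] := hiso_inv (mphi_iso M); rewrite comp_lfunE K. Qed.

Lemma fmor_tcon (V W : hmod H) (A B : vectType k) (t : tens A B) (f : A -> B -> 'Hom(V, W)) :
  (forall a b, hlin (f a b)) -> fmor F (tcon t f) = \sw a b <- t; fmor F (f a b).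
Proof.
move=> fh; rewrite !tconS fmor_sum => [|i]; last first.
  by apply: hlin_sum => j; apply: hlinZ.
apply: eq_bigr => i _; rewrite fmor_sum => [|j]; last exact: hlinZ.
by apply: eq_bigr => j _; rewrite fmorZ.
Qed.

Lemma mJ_nat (V V' W W' : hmod H) (f : 'Hom(V, V')) (g : 'Hom(W, W')) z : hlin f -> hlin g ->
  J V' W' (tmap (fmor F f) (fmor F g) z)
  = fmor F (tmap f g : 'Hom(htens V W, htens V' W')) (J V W z).
Proof.
move=> fh gh; have := congr1 (fun h : 'Hom(_, _) => h z) (mJ_natural M fh gh).
by rewrite /= [LHS]comp_lfunE [RHS]comp_lfunE.
Qed.

Lemma mJ_assocE (U V W : hmod H) z :
  fmor F (tassoc U V W : 'Hom(htens (htens U V) W, htens U (htens V W)))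
    (J (htens U V) W (tmap (J U V) \1 z))
  = J U (htens V W) (tmap \1 (J V W) (tassoc (F U) (F V) (F W) z)).
Proof.
have := congr1 (fun h : 'Hom(_, _) => h z) (mJ_assoc M U V W).
by rewrite /= !comp_lfunE.
Qed.

Lemma mphi_lE (V : hmod H) z :
  fmor F (tunitl V : 'Hom(htens (hunit H) V, V)) (J (hunit H) V (tmap (mphi M) \1 z))
  = tunitl (F V) z.
Proof.
have := congr1 (fun h : 'Hom(_, _) => h z) (mphi_l M V).
by rewrite /= !comp_lfunE.
Qed.

Lemma mphi_rE (V : hmod H) z :
  fmor F (tunitr V : 'Hom(htens V (hunit H), V)) (J V (hunit H) (tmap \1 (mphi M) z))
  = tunitr (F V) z.
Proof.
have := congr1 (fun h : 'Hom(_, _) => h z) (mphi_r M V).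
by rewrite /= !comp_lfunE.
Qed.

Lemma tmap_comp (A A' A'' B B' B'' : vectType k) (f : 'Hom(A', A'')) (f' : 'Hom(A, A'))
  (g : 'Hom(B', B'')) (g' : 'Hom(B, B')) z :
  tmap f g (tmap f' g' z) = tmap (f \o f') (g \o g') z.
Proof.
rewrite -comp_lfunE; congr (fun_of_lfun _ z); apply: tens_ext => a b.
by rewrite comp_lfunE !tmapE !comp_lfunE.
Qed.

Lemma cop_reg_rmul a :
  (cop_reg H \o rmul a)%VF
  = (tcon (cop H a) (fun a1 a2 => tmap (rmul a1) (rmul a2) : 'Hom(htens R R, htens R R))
      \o cop_reg H)%VF.
Proof.
apply/lfunP=> x; rewrite !comp_lfunE rmulE; apply: tcon_inj => U f fb.
rewrite hopf_copM // (tcon_lin (g := fun h : 'End(tens R R) => h (cop_reg H x))); last by lin.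
rewrite tcon_tcon [RHS](_ : _ = \sw a1 a2 <- cop H a; \sw p q <- cop H x; f (p * a1) (q * a2)).
  by rewrite tcon_exch.
apply: tcon_ext => a1 a2; rewrite tcon_tmap //.
by apply: tcon_ext => p q; rewrite !rmulE.
Qed.

Lemma im_cop_rmul a q :
  im_cop (fmor F (rmul a) q)
  = \sw a1 a2 <- cop H a; tmap (fmor F (rmul a1)) (fmor F (rmul a2)) (im_cop q).
Proof.
have [_ _ JK _] := hiso_inv (mJ_iso M R R); apply: (can_inj JK).
have th a1 a2 : hlin (tmap (rmul a1) (rmul a2) : 'Hom(htens R R, htens R R)).
  by apply: tmap_hlin; apply: rmul_hlin.
rewrite im_copE -fmor_compE; [|exact: cop_reg_hlin|exact: rmul_hlin].
rewrite cop_reg_rmul fmor_compE; [|exact: hlin_tcon|exact: cop_reg_hlin].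
rewrite fmor_tcon // (tcon_lin (g := fun h : 'Hom(_, _) => h (fmor F (cop_reg H) q))); last by lin.
rewrite (tcon_lfun (J R R)); apply: tcon_ext => a1 a2.
by rewrite mJ_nat ?im_copE //; apply: rmul_hlin.
Qed.

(** Naturality of J and its associativity axiom bring both sides to F applied to coassociativity in
    H. *)
Lemma im_cop_coassoc q :
  tassoc Q Q Q (tmap im_cop \1 (im_cop q)) = tmap \1 im_cop (im_cop q).
Proof.
have [_ _ JK _] := hiso_inv (mJ_iso M R R).
have [_ _ J1K _] := hiso_inv (mJ_iso M R (htens R R)).
have tK : cancel (tmap (\1 : 'End(Q)) (J R R)) (tmap \1 (J R R)^-1)%VF.
  move=> z; rewrite tmap_comp -[RHS]id_lfunE; congr (fun_of_lfun _ z).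
  by apply: tens_ext => u v; rewrite tmapE !comp_lfunE !id_lfunE JK.
have JG : (J R R \o im_cop)%VF = fmor F (cop_reg H).
  by apply/lfunP=> u; rewrite comp_lfunE im_copE.
have idh : hlin (\1%VF : 'Hom(R, R)) := @hlin_id _ _ R.
have coph := @cop_reg_hlin _ H.
apply: (can_inj tK); apply: (can_inj J1K).
transitivity (fmor F (tmap \1 (cop_reg H) : 'Hom(htens R R, htens R (htens R R)))
   (fmor F (cop_reg H) q)); last first.
  by rewrite tmap_comp JG comp_lfun1l -(fmor_id F R) mJ_nat // im_copE.
rewrite -mJ_assocE tmap_comp JG comp_lfun1l -(fmor_id F R) mJ_nat //.
have th : hlin (tmap (cop_reg H) \1 : 'Hom(htens R R, htens (htens R R) R)) := tmap_hlin coph idh.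
have th' : hlin (tmap \1 (cop_reg H) : 'Hom(htens R R, htens R (htens R R))) := tmap_hlin idh coph.
have ah := @tassoc_hlin _ H R R R.
rewrite im_copE -!fmor_compE //; last by apply: hlin_comp.
by congr (fmor F _ q); apply/lfunP=> x; rewrite !comp_lfunE copA.
Qed.

Lemma im_cop_counitl q : (\sw u v <- im_cop q; (im_counit u : k) *: v) = q.
Proof.
have idh : hlin (\1%VF : 'Hom(R, R)) := @hlin_id _ _ R.
have coph := @cop_reg_hlin _ H; have couh := @counit_reg_hlin _ H.
have JG : (mphi M \o im_counit)%VF = fmor F (counit_reg H).
  by apply/lfunP=> u; rewrite comp_lfunE im_counitE.
transitivity (tunitl Q (tmap im_counit \1 (im_cop q))).
  rewrite tmap_tcon (tcon_lfun (tunitl Q)); apply: tcon_ext => u v.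
  by rewrite tunitl_ptens id_lfunE.
rewrite -mphi_lE tmap_comp JG comp_lfun1l -(fmor_id F R) mJ_nat //.
have th : hlin (tmap (counit_reg H) \1 : 'Hom(htens R R, htens (hunit H) R)) := tmap_hlin couh idh.
have ah := @tunitl_hlin _ H R.
rewrite im_copE -!fmor_compE //; last by apply: hlin_comp.
rewrite -[RHS](id_lfunE q) -(fmor_id F R).
by congr (fmor F _ q); apply/lfunP=> x; rewrite !comp_lfunE id_lfunE cop_counitl.
Qed.

Lemma im_cop_counitr q : (\sw u v <- im_cop q; (im_counit v : k) *: u) = q.
Proof.
have idh : hlin (\1%VF : 'Hom(R, R)) := @hlin_id _ _ R.
have coph := @cop_reg_hlin _ H; have couh := @counit_reg_hlin _ H.
have JG : (mphi M \o im_counit)%VF = fmor F (counit_reg H).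
  by apply/lfunP=> u; rewrite comp_lfunE im_counitE.
transitivity (tunitr Q (tmap \1 im_counit (im_cop q))).
  rewrite tmap_tcon (tcon_lfun (tunitr Q)); apply: tcon_ext => u v.
  by rewrite tunitr_ptens id_lfunE.
rewrite -mphi_rE tmap_comp JG comp_lfun1l -(fmor_id F R) mJ_nat //.
have th : hlin (tmap \1 (counit_reg H) : 'Hom(htens R R, htens R (hunit H))) := tmap_hlin idh couh.
have ah := @tunitr_hlin _ H R.
rewrite im_copE -!fmor_compE //; last by apply: hlin_comp.
rewrite -[RHS](id_lfunE q) -(fmor_id F R).
by congr (fmor F _ q); apply/lfunP=> x; rewrite !comp_lfunE id_lfunE cop_counitr.
Qed.

(** The image under F of the freeness of H (x) H over the diagonal action; it will make the twist
    invertible. *)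
Lemma im_cop_span z : exists q : 'I_(dim R) -> Q,
  z = \sum_i tmap \1 (fmor F (rmul (@tbase k H i))) (im_cop (q i)).
Proof.
have [_ _ JK _] := hiso_inv (mJ_iso M R R).
have coph := @cop_reg_hlin _ H; have idh : hlin (\1%VF : 'Hom(R, R)) := @hlin_id _ _ R.
pose xi i : 'Hom(R, k^o) := linfun (fun v => v2r v 0 i : k^o).
have xiE v i : xi i v = v2r v 0 i.
  by rewrite linfE // => a x y; rewrite linearP !mxE.
exists (fun i => fmor F (tens_to_reg (xi i)) (J R R z)).
apply: (can_inj JK); rewrite linear_sum /=.
transitivity (fmor F (\1%VF : 'Hom(htens R R, htens R R)) (J R R z)).
  by rewrite fmor_id id_lfunE.
have nh i : hlin (tens_to_reg (xi i)) by apply: tens_to_reg_hlin I _.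
have mh v : hlin (reg_to_tens (V := R) v) by apply: reg_to_tens_hlin.
have -> : (\1%VF : 'Hom(htens R R, htens R R))
    = \sum_i (reg_to_tens (V := R) (tbase i) \o tens_to_reg (xi i))%VF.
  apply/lfunP=> t; rewrite sum_lfunE id_lfunE.
  under eq_bigr => j _ do rewrite comp_lfunE.
  by rewrite (sum_reg_to_tens I).
rewrite fmor_sum => [|i]; last exact: hlin_comp.
rewrite sum_lfunE; apply: eq_bigr => i _; rewrite fmor_compE //.
rewrite reg_to_tens_rmul fmor_compE //; last by apply: tmap_hlin => //; apply: rmul_hlin.
by rewrite -im_copE -mJ_nat ?fmor_id //; apply: rmul_hlin.
Qed.

End TwistOfEquivalence.

(** * The twist read on a generator *)

Section Generator.
Variables (k : fieldType) (H H' : hopfAlgebra k) (I : integrals H) (I' : integrals H').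
Variables (F : hfunctor H H') (Feq : is_equivalence F) (M : monoidal_structure F).
Local Notation R := (reg H).
Local Notation Q := (F R).
Local Notation cou := (im_counit M).
Local Notation Gam := (im_cop M).

Lemma im_counit_act h q : cou (hact Q h q) = (counit H' h : k) * (cou q : k) :> k.
Proof. by rewrite im_counit_hlin unit_actE. Qed.

(** [iota] is the inverse of the orbit map h -> h q; the counit condition normalises the twist. *)
Record generator (q : Q) (iota : 'Hom(Q, H')) : Prop := Generator {
  gen_iotaK : forall u, hact Q (iota u) q = u;
  gen_actK : forall h, iota (hact Q h q) = h;
  gen_counit : cou q = 1 :> k
}.

Lemma generator_exists : exists q iota, generator q iota.
Proof.
have [a [b [ah bh ba ab]]] := regular_like_iso (regular_like_image Feq M I) (@regular_like_reg k H').
have bE h : b h = hact Q h (b (1 : H')) by rewrite -bh reg_actE mulr1.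
pose c : k := cou (b (1 : H')).
have c0 : c != 0.
  (* If the counit vanished on a generator it would vanish on Q, and faithfulness of F would kill
     the counit of H. *)
  apply/eqP=> c0; have cou0 : cou = 0.
    by apply/lfunP=> u; rewrite zero_lfunE -(ba u) bE im_counit_act -/c c0 mulr0.
  have : counit_reg H = 0.
    apply: (equiv_faithful Feq); first exact: counit_reg_hlin.
    by apply/lfunP=> u; rewrite -(im_counitE M) cou0 !zero_lfunE linear0.
  move/lfunP/(_ (1 : H)); rewrite zero_lfunE [LHS]counit1 => /eqP.
  by rewrite (negPf (oner_neq0 k)).
exists (c^-1 *: b (1 : H')), (c *: a); split.
- move=> u; rewrite scale_lfunE (lfunZ (hact Q (c *: a u))) lfunZ scale_lfunE scalerA mulVf // scale1r.
  by rewrite -bE ba.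
- by move=> h; rewrite (lfunZ (hact Q h)) -bE scale_lfunE lfunZ ab scalerA mulfV // scale1r.
by rewrite functZ -/c mulVf.
Qed.

Variables (q0 : Q) (iota : 'Hom(Q, H')).
Hypothesis gq : generator q0 iota.

Definition gen_map : 'Hom(H, H') := linfun (fun a => iota (fmor F (rmul a) q0)).

(** The coefficients of the image coproduct: it sends q0 to t (q0 (x) q0). *)
Definition gen_twist : tens H' H' := tmap iota iota (Gam q0).

Local Notation sg := gen_map.
Local Notation t := gen_twist.

Lemma gen_mapE a : sg a = iota (fmor F (rmul a) q0).
Proof.
rewrite /gen_map linfE // => c x y; rewrite rmul_linear fmor_linear; try exact: rmul_hlin.
by rewrite add_lfunE scale_lfunE linearP.
Qed.

Lemma gen_map_act a : hact Q (sg a) q0 = fmor F (rmul a) q0.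
Proof. by rewrite gen_mapE (gen_iotaK gq). Qed.

Lemma fmor_rmul_act a h : fmor F (rmul a) (hact Q h q0) = hact Q (h * sg a) q0.
Proof. by rewrite (fmor_hlin (@rmul_hlin _ H a)) -gen_map_act hactM. Qed.

Lemma act_inj h h' : hact Q h q0 = hact Q h' q0 -> h = h'.
Proof. by move/(congr1 iota); rewrite !(gen_actK gq). Qed.

Lemma gen_map1 : sg 1 = 1.
Proof.
apply: act_inj; rewrite gen_map_act hact1.
have -> : rmul (1 : H) = \1%VF by apply/lfunP=> x; rewrite rmulE id_lfunE mulr1.
by rewrite fmor_id id_lfunE.
Qed.

(** Right multiplication reverses products, and moving coefficients past F([rmul]) reverses them
    again. *)
Lemma gen_mapM a b : sg (a * b) = sg a * sg b.
Proof.
apply: act_inj; rewrite gen_map_act -fmor_rmul_act gen_map_act -fmor_compE; try exact: rmul_hlin.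
by congr (fmor F _ q0); apply/lfunP=> x; rewrite comp_lfunE !rmulE mulrA.
Qed.

Lemma gen_map_counit a : counit H' (sg a) = counit H a :> k.
Proof.
have := im_counit_act (sg a) q0; rewrite (gen_counit gq) mulr1 => <-.
have [_ _ K _] := hiso_inv (mphi_iso M).
rewrite gen_map_act -[RHS]mulr1 -[X in _ * X](gen_counit gq).
rewrite -[_ * (cou q0)]/(counit H a *: cou q0 : k^o).
apply: (can_inj K); rewrite im_counitE lfunZ im_counitE -fmor_compE.
- rewrite -[RHS]scale_lfunE -fmorZ; last exact: counit_reg_hlin.
  congr (fmor F _ q0); apply/lfunP=> x; rewrite comp_lfunE rmulE scale_lfunE.
  by rewrite [LHS]counitM mulrC.
- exact: counit_reg_hlin.
exact: rmul_hlin.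
Qed.

Lemma gen_map_inj : injective sg.
Proof.
apply/lker0P; rewrite -subv0; apply/subvP=> a; rewrite memv_ker memv0 => /eqP a0.
have : rmul a = 0.
  apply: (equiv_faithful Feq); first exact: rmul_hlin.
  apply/lfunP=> u; rewrite -(gen_iotaK gq u) fmor_rmul_act a0 mulr0.
  by rewrite linear0 !zero_lfunE.
by move/lfunP/(_ (1 : H)); rewrite rmulE mul1r zero_lfunE => /eqP.
Qed.

Definition gen_inv : 'Hom(H', H) := (sg^-1)%VF.

Lemma gen_mapK a : gen_inv (sg a) = a.
Proof. by apply: lker0_lfunK; apply/lker0P; apply: gen_map_inj. Qed.

Lemma gen_invK h : sg (gen_inv h) = h.
Proof.
apply: limg_lfunVK; suff -> : limg sg = fullv by apply: memvf.
apply/eqP; rewrite -(geq_leqif (dimv_leqif_eq (subvf _))).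
have /eqP k0 : lker sg == 0%VS by apply/lker0P; apply: gen_map_inj.
(* Injectivity suffices since dim H = dim Q = dim H'. *)
rewrite limg_dim_eq ?k0 ?capv0 // !dimvf -[dim H]/(dim R) -(dim_equiv Feq M I R).
pose j : 'Hom(H', Q) := linfun (fun h => hact Q h q0).
have jE u : j u = hact Q u q0 by rewrite linfE //; lin.
rewrite (@dim_iso _ _ _ j iota) // => u; first by rewrite jE (gen_actK gq).
by rewrite jE (gen_iotaK gq).
Qed.

Lemma im_cop_gen (U : vectType k) (f : Q -> Q -> U) : bilin f ->
  tcon (Gam q0) f = \sw c d <- t; f (hact Q c q0) (hact Q d q0).
Proof.
move=> fb; rewrite /gen_twist tcon_tmap; last by lin.
by apply: tcon_ext => u v; rewrite !(gen_iotaK gq).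
Qed.

Lemma im_cop_act h (U : vectType k) (f : Q -> Q -> U) : bilin f ->
  tcon (Gam (hact Q h q0)) f
  = \sw a b <- cop H' h; \sw c d <- t; f (hact Q (a * c) q0) (hact Q (b * d) q0).
Proof.
move=> fb; rewrite im_cop_hlin htens_actE tcon_tcon; apply: tcon_ext => a b.
rewrite tcon_tmap // im_cop_gen; last by lin.
by apply: tcon_ext => c d; rewrite !hactM.
Qed.

Lemma gen_twist_counitl : (\sw a b <- t; (counit H' a : k) *: b) = 1.
Proof.
apply: act_inj; rewrite hact1 -[RHS](im_cop_counitl M).
rewrite (im_cop_gen (f := fun u v => (cou u : k) *: v)); last by lin.
rewrite (tcon_lin (g := fun z => hact Q z q0)); last by lin.
apply: tcon_ext => c d.
by rewrite im_counit_act (gen_counit gq) mulr1 linearZ scale_lfunE.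
Qed.

Lemma gen_twist_counitr : (\sw a b <- t; (counit H' b : k) *: a) = 1.
Proof.
apply: act_inj; rewrite hact1 -[RHS](im_cop_counitr M).
rewrite (im_cop_gen (f := fun u v => (cou v : k) *: u)); last by lin.
rewrite (tcon_lin (g := fun z => hact Q z q0)); last by lin.
apply: tcon_ext => c d.
by rewrite im_counit_act (gen_counit gq) mulr1 linearZ scale_lfunE.
Qed.

(** Coassociativity of the image coproduct at q0, read through [iota]. *)
Lemma gen_twist_cocycle (U : vectType k) (f : H' -> H' -> H' -> U) : trilin f ->
  (\sw a b <- t; \sw a1 a2 <- cop H' a; \sw c d <- t; f (a1 * c) (a2 * d) b)
  = \sw a b <- t; \sw b1 b2 <- cop H' b; \sw c d <- t; f a (b1 * c) (b2 * d).
Proof.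
move=> fl; pose g u v w := f (iota u) (iota v) (iota w).
have gl : trilin g by rewrite /g; split=> ? ?; lin.
have E := congr1 (fun z => tcon z (fun u z => tcon z (g u))) (im_cop_coassoc M q0).
rewrite /= (tcon_tassoc (f := g)) // !tcon_tmap in E; [|by lin..].
rewrite (im_cop_gen (f := fun a b => \sw u v <- Gam a; g u v ((\1%VF : 'End(Q)) b))) in E;
  last by lin.
rewrite (im_cop_gen (f := fun a b => tcon (Gam b) (g ((\1%VF : 'End(Q)) a)))) in E; last by lin.
transitivity (\sw c d <- t; \sw u v <- Gam (hact Q c q0); g u v ((\1%VF : 'End(Q)) (hact Q d q0))).
  apply: tcon_ext => a b; rewrite im_cop_act; last by lin.
  do 2!apply: tcon_ext => ? ?; by rewrite /g id_lfunE !(gen_actK gq).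
rewrite {}E; apply: tcon_ext => a b; rewrite im_cop_act; last by lin.
by do 2!apply: tcon_ext => ? ?; rewrite /g id_lfunE !(gen_actK gq).
Qed.

(** The image coproduct of sg(a) q0 is computed twice: by linearity over H', and through F of right
    multiplication by a. *)
Lemma gen_twist_conj a (U : vectType k) (f : H' -> H' -> U) : bilin f ->
  (\sw p q <- cop H' (sg a); \sw c d <- t; f (p * c) (q * d))
  = \sw c d <- t; \sw a1 a2 <- cop H a; f (c * sg a1) (d * sg a2).
Proof.
move=> fb.
transitivity (tcon (Gam (hact Q (sg a) q0)) (fun u v => f (iota u) (iota v))).
  rewrite im_cop_act; last by lin.
  by do 2!apply: tcon_ext => ? ?; rewrite !(gen_actK gq).
rewrite gen_map_act im_cop_rmul tcon_tcon [RHS]tcon_exch; apply: tcon_ext => a1 a2.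
rewrite tcon_tmap; last by lin.
rewrite (im_cop_gen (f := fun u v => f (iota (fmor F (rmul a1) u)) (iota (fmor F (rmul a2) v))));
  last by lin.
by apply: tcon_ext => c d; rewrite !fmor_rmul_act !(gen_actK gq).
Qed.

(** By [im_cop_span] every tensor is a sum of values Delta(sg(a)) t times right factors, and
    [gen_twist_conj] brings t to the left. *)
Lemma gen_twist_onto (w : tens H' H') : exists s, tmul t s = w.
Proof.
pose j : 'Hom(H', Q) := linfun (fun h => hact Q h q0).
have jE u : j u = hact Q u q0 by rewrite linfE //; lin.
have [u Eu] := im_cop_span I M (tmap j j w).
exists (\sum_i \sw a1 a2 <- cop H (gen_inv (iota (u i)));
   ptens (sg a1) (sg a2 * sg (@tbase k H i))).
apply: tcon_inj => U f fb.
have -> : tcon w f = tcon (tmap j j w) (fun u v => f (iota u) (iota v)).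
  rewrite tcon_tmap; last by lin.
  by apply: tcon_ext => a b; rewrite !jE !(gen_actK gq).
rewrite tcon_tmul // Eu.
have tl (g : Q -> Q -> U) : lin (fun z : tens Q Q => tcon z g) by apply: lin_tconl; apply: lin_id.
have tl' (g : H' -> H' -> U) : lin (fun z : tens H' H' => tcon z g) by apply: lin_tconl; apply: lin_id.
rewrite (lin_sum (tl _)).
transitivity (\sum_i \sw c d <- t; \sw a1 a2 <- cop H (gen_inv (iota (u i)));
   f (c * sg a1) (d * (sg a2 * sg (@tbase k H i)))).
  rewrite [LHS]tconS.
  under eq_bigr => p _ do under eq_bigr => q _ do rewrite (lin_sum (tl' _)) scaler_sumr.
  rewrite (eq_bigr (fun p => \sum_i \sum_q t p q *: tcon (\sw a1 a2 <- cop H (gen_inv (iota (u i)));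
   ptens (sg a1) (sg a2 * sg (@tbase k H i))) (fun c d => f (tbase p * c) (tbase q * d))));
     last first.
    by move=> p _; rewrite exchange_big.
  rewrite exchange_big; apply: eq_bigr => i _; rewrite [RHS]tconS.
  do 2!apply: eq_bigr => ? _; congr (_ *: _); rewrite tcon_tcon; apply: tcon_ext => a1 a2.
  by rewrite tcon_ptens //; lin.
apply: eq_bigr => i _; rewrite tcon_tmap; last by lin.
rewrite -{2}(gen_iotaK gq (u i)) im_cop_act; last by lin.
rewrite -{2}(gen_invK (iota (u i))).
rewrite (@gen_twist_conj _ _ (fun x y => f (iota (\1%VF (hact Q x q0)))
   (iota (fmor F (rmul (@tbase k H i)) (hact Q y q0))))); last by lin.
by do 2!apply: tcon_ext => ? ?; rewrite id_lfunE fmor_rmul_act !(gen_actK gq) mulrA.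
Qed.

Lemma gen_is_twist : exists s, is_twist t s.
Proof.
have [s [ts st]] := tmul_onto_inv gen_twist_onto; exists s; split.
- move=> U f fb; rewrite -(tcon_tmul t s fb) ts tcon_ptens //.
- move=> U f fb; rewrite -(tcon_tmul s t fb) st tcon_ptens //.
- exact: gen_twist_counitl.
- exact: gen_twist_counitr.
exact: gen_twist_cocycle.
Qed.

End Generator.

(** * From tensor equivalences to equal traces *)

Theorem twist_of_equivalence (k : fieldType) (H H' : hopfAlgebra k) (I : integrals H) :
  tensor_equivalent H H' ->
  exists (sg : 'Hom(H, H')) (r : 'Hom(H', H)) (t s : tens H' H'),
    [/\ cancel sg r /\ cancel r sg,
        sg 1 = 1 /\ {morph sg : x y / x * y},
        forall x, counit H' (sg x) = counit H x :> k,
        is_twist t s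
      & forall a (U : vectType k) (f : H' -> H' -> U), bilin f ->
        (\sw p q <- cop H' (sg a); \sw c d <- t; f (p * c) (q * d))
        = \sw c d <- t; \sw a1 a2 <- cop H a; f (c * sg a1) (d * sg a2)].
Proof.
case=> F [Feq [M]]; have [q0 [iota gq]] := generator_exists I Feq M.
have [s ts] := gen_is_twist I Feq gq.
exists (gen_map q0 iota), (gen_inv q0 iota), (gen_twist M q0 iota), s; split=> //.
- by split=> x; [apply: gen_mapK Feq _ _ _ gq _ | apply: gen_invK I _ Feq _ _ _ gq _].
- by split=> [|x y]; [apply: gen_map1 gq | apply: gen_mapM gq _ _].
- by move=> x; apply: gen_map_counit gq x.
by move=> a U f; apply: gen_twist_conj gq a _ f.
Qed.

Lemma kup_trace_gauge (k : fieldType) (H H' : hopfAlgebra k) (I : integrals H)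
    (I' : integrals H') m n : tensor_equivalent H H' ->
  Tr2 (fun x y => kup (hopf_cogroupoid I) m n tt x y (@ptens k H H))
  = Tr2 (fun x y => kup (hopf_cogroupoid I') m n tt x y (@ptens k H' H')).
Proof.
case/(twist_of_equivalence I) => sg [r [t [s [[sK rK] [s1 sM] se ts sconj]]]].
(* Two objects: [false] carries the trivial twist and [true] the twist t. *)
pose tf b := if b then t else ptens (1 : H') (1 : H').
pose sf b := if b then s else ptens (1 : H') (1 : H').
have tsf b : is_twist (tf b) (sf b) by case: b => //; apply: is_twist1.
pose G := twist_cogroupoid I' tsf.
transitivity (Tr2 (fun x y => kup G m n false x y (@ptens k H' H'))); last first.
  (* At [false] the cogroupoid is H' itself. *)
  apply: (transport_trace (s := \1%VF) (r := \1%VF)) => [x|x||x y|x|x U f fb];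
    rewrite ?id_lfunE // [LHS]tw_copE //= tcon_ptens; last by lin.
  apply: tcon_ext => a b; rewrite tcon_ptens; last by lin.
  by rewrite !mul1r !mulr1 !id_lfunE.
rewrite (kup_trace_inv G m n false true); apply/esym.
apply: (transport_trace sK rK) => // x U f fb.
(* At [true], s Delta(sg x) t = s t (sg (x) sg) Delta(x), and s t = 1: the diagonal Hopf algebra is
   H transported by sg. *)
rewrite [LHS]tw_copE //=.
transitivity (\sw p q <- s; \sw c d <- t; \sw a1 a2 <- cop H x;
   f (p * c * sg a1) (q * d * sg a2)).
  apply: tcon_ext => p q.
  transitivity (\sw a b <- cop H' (sg x); \sw c d <- t; f (p * (a * c)) (q * (b * d))).
    by do 2!apply: tcon_ext => ? ?; rewrite !mulrA.
  rewrite (sconj x U (fun u v => f (p * u) (q * v))); last by lin.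
  by do 2!apply: tcon_ext => ? ?; rewrite !mulrA.
rewrite (twVK ts (f := fun u v => \sw a1 a2 <- cop H x; f (u * sg a1) (v * sg a2))); last by lin.
by apply: tcon_ext => a b; rewrite !mul1r.
Qed.

Theorem theorem7p3 (k : fieldType) (H : hopfAlgebra k) (I : integrals H)
    (m n : nat) (m_gt0 : (0 < m)%N) (n_gt0 : (0 < n)%N) :
  [/\ kuperberg (diagram_mn m n) I
        = tr_lfun (tmap (antipode H) (antipode H) \o Psi H m n)%VF,
      tr_lfun (tmap (antipode H) (antipode H) \o Psi H m n)%VF
        = integral_formula I m n
    & gauge_invariant (fun H' : hopfAlgebra k =>
        @kuperberg (diagram_mn m n) k H')].
Proof.
(* Positivity turns m and n into successors, so the powers of index m - 1 and n - 1 become those of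
   index m and n used in [kup]. *)
case: m m_gt0 => // m _; case: n n_gt0 => // n _; split.
- by rewrite kuperberg_kupE (tr_Psi I) kup_kupE.
- by rewrite (tr_Psi I) kup_kupE integral_formulaE.
move=> H1 H2 I1 I2 eqv; rewrite !kuperberg_kupE -!kup_kupE.
exact: kup_trace_gauge eqv.
Qed.
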